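(* Let $p\ge 2$, let $q$ be its conjugate exponent, let $f\in W^{1,q}_{\mathrm{loc}}(\Omega)$, and let $u\in W^{1,p}_{\mathrm{loc}}(\Omega)$ be a local weak solution of $$-\operatorname{div}F(\nabla u)=f \quad\text{in }\Omega .$$ Then $\mathcal{H}:=H(\nabla u)\in W^{1,2}_{\mathrm{loc}}(\Omega)$. More precisely, for every $k=1,\dots,N$, $\mathcal{H}_k:=H_k(\nabla u)\in W^{1,2}_{\mathrm{loc}}(\Omega)$.
   Context: $\Omega$ is a bounded domain of $\mathbb{R}^d$ ($d\ge 2$) with Lipschitz boundary. $N\in\mathbb{N}$, and for $k=1,\dots,N$, $v_k\in\mathbb{S}^{d-1}$ (unit vectors of $\mathbb{R}^d$), $c_k>0$ and $\delta_k>0$ are constants. Write $t_+=\max(t,0)$. For $z\in\mathbb{R}^d$, $$F(z)=\sum_{k=1}^N F_k(z),\quad F_k(z)=(z\cdot v_k-\delta_kc_k)_+^{p-1}\,v_k,$$ $$H(z)=\sum_{k=1}^N H_k(z),\quad H_k(z)=(z\cdot v_k-\delta_kc_k)_+^{p/2}\,v_k.$$ A local weak solution $u \in W^{1,p}_{\mathrm{loc}}(\Omega)$ satisfies $\int_\Omega F(\nabla u)\cdot\nabla\varphi\,dx=\int_\Omega f\varphi\,dx$ for all $\varphi\in C_c^\infty(\Omega)$. *)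

(* Defs.v *)
From HB Require Import structures.
From mathcomp Require Import all_boot all_order all_algebra.
From mathcomp Require Import all_classical all_reals all_analysis.
Import Order.TTheory GRing.Theory Num.Theory.
Import numFieldNormedType.Exports.

Set Implicit Arguments.
Unset Strict Implicit.
Unset Printing Implicit Defensive.

Local Open Scope classical_set_scope.
Local Open Scope ring_scope.

(* The space R^d is 'rV[R]_d. Its library norm (and hence [ball]) is the sup
   norm, so Euclidean notions are expressed with [dotv] below. It is equipped
   with the product of the Borel sigma-algebras of R, as the library does for
   n.-tuple. *)

Definition rV_display : measure_display -> measure_display.
Proof. exact. Qed.

Section measurable_rV.
Context {d} {T : measurableType d}.
Variable n : nat.

Let coors : 'I_n -> 'rV[T]_n -> T := fun i x => x ord0 i.

Let rV_set0 : g_sigma_preimage coors set0.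
Proof. exact: sigma_algebra0. Qed.

Let rV_setC A : g_sigma_preimage coors A -> g_sigma_preimage coors (~` A).
Proof. exact: sigma_algebraC. Qed.

Let rV_bigcup (F : (set 'rV[T]_n)^nat) :
  (forall i, g_sigma_preimage coors (F i)) ->
  g_sigma_preimage coors (\bigcup_i (F i)).
Proof. exact: sigma_algebra_bigcup. Qed.

HB.instance Definition _ := @isMeasurable.Build (rV_display d)
  'rV[T]_n (g_sigma_preimage coors) rV_set0 rV_setC rV_bigcup.

Lemma measurable_coor (i : 'I_n) :
  measurable_fun [set: 'rV[T]_n] (fun x : 'rV[T]_n => x ord0 i).
Proof.
move=> _ Y mY; rewrite setTI; apply: sub_sigma_algebra.
have H : (preimage_set_system setT (coors i) measurable : set (set _))
    `<=` \big[setU/set0]_(i < n) preimage_set_system setT (coors i) measurable.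
  by rewrite (bigD1 i) //=; apply: subsetUl.
by apply: H; exists Y => //; rewrite setTI.
Qed.

Lemma measurable_rV_coor d' (S : measurableType d') (f : S -> 'rV[T]_n) :
  (forall i, measurable_fun setT (fun s => f s ord0 i)) ->
  measurable_fun setT f.
Proof.
move=> mf; apply: (@measurability _ _ _ _ _ _
  (\big[setU/set0]_(i < n) preimage_set_system setT (coors i) measurable)) => //.
move=> _ [B BU <-].
have : exists i, preimage_set_system setT (coors i) measurable B.
  move: BU; elim/big_ind: _ => [//|X Y IX IY [/IX|/IY]//|i _ ?]; by exists i.
case=> i [A mA <-]; rewrite !setTI -comp_preimage.
by have := mf i measurableT A mA; rewrite setTI.
Qed.

End measurable_rV.

Section lebesgue_rV.
Context {R : realType}.
Local Notation lebR := (@lebesgue_measure R).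

Definition consv n (z : measurableTypeR R * 'rV[R]_n) : 'rV[R]_n.+1 :=
  row_mx (z.1%:M : 'rV_1) z.2.

Definition unconsv n (x : 'rV[R]_n.+1) : measurableTypeR R * 'rV[R]_n :=
  (x ord0 ord0, rsubmx (x : 'rV[R]_(1 + n))).

Lemma consv0 n (z : measurableTypeR R * 'rV[R]_n) : consv z ord0 ord0 = z.1.
Proof.
have := row_mxEl (z.1%:M : 'rV_1) z.2 ord0 ord0.
rewrite [X in _ = X -> _]mxE eqxx mulr1n => <-.
by congr (row_mx _ _ _ _); apply/val_inj.
Qed.

Lemma consvS n (z : measurableTypeR R * 'rV[R]_n) i :
  consv z ord0 (lift ord0 i) = z.2 ord0 i.
Proof.
have <- := row_mxEr (z.1%:M : 'rV_1) z.2 ord0 i.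
by congr (row_mx _ _ _ _); apply/val_inj.
Qed.

Lemma unconsvK n : cancel (@unconsv n) (@consv n).
Proof.
move=> x; apply/rowP => i; case: (unliftP ord0 i) => [j|] ->.
  by rewrite consvS mxE; congr (x _ _); apply/val_inj.
by rewrite consv0.
Qed.

Lemma consvK n : cancel (@consv n) (@unconsv n).
Proof.
move=> [a x]; rewrite /unconsv consv0; congr pair.
by rewrite /consv row_mxKr.
Qed.

Lemma measurable_consv n : measurable_fun setT (@consv n).
Proof.
apply: measurable_rV_coor => i; case: (unliftP ord0 i) => [j|] ->.
  under eq_fun do rewrite consvS.
  exact: measurableT_comp (measurable_coor j) measurable_snd.
by under eq_fun do rewrite consv0; exact: measurable_fst.
Qed.

Lemma measurable_unconsv n : measurable_fun setT (@unconsv n).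
Proof.
apply: measurable_fun_pair; first exact: measurable_coor.
apply: measurable_rV_coor => i.
by under eq_fun do rewrite mxE; exact: measurable_coor.
Qed.

Section step.
Variables (n : nat) (m : {sigma_finite_measure set 'rV[R]_n -> \bar R}).

Definition lebesgue_step := pushforward (lebR \x m)%E (@consv n).

Let push : {measure set 'rV[R]_n.+1 -> \bar R} :=
  @measure_function_pushforward__canonical__measure_function_Measure
    _ _ _ _ _ (lebR \x m)%E _ (@measurable_consv n).

Let lebesgue_step0 : lebesgue_step set0 = 0%E.
Proof. exact: (measure0 push). Qed.

Let lebesgue_step_ge0 A : (0 <= lebesgue_step A)%E.
Proof. exact: (measure_ge0 push). Qed.

Let lebesgue_step_sigma_additive : semi_sigma_additive lebesgue_step.
Proof. exact: (@measure_semi_sigma_additive _ _ _ push). Qed.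

HB.instance Definition _ := isMeasure.Build _ _ _ lebesgue_step
  lebesgue_step0 lebesgue_step_ge0 lebesgue_step_sigma_additive.

Let lebesgue_step_sigma_finite : sigma_finite setT lebesgue_step.
Proof.
have /sigma_finiteP[F [TF ndF Foo]] := sigma_finiteT lebR.
have /sigma_finiteP[G [TG ndG Goo]] := sigma_finiteT m.
exists (fun k => @unconsv n @^-1` (F k `*` G k)).
  rewrite -preimage_bigcup -[LHS](preimage_setT (@unconsv n)); congr (_ @^-1` _).
  apply/seteqP; split=> // -[x y] _.
  have [k _ Fkx] : (\bigcup_i F i) x by rewrite -TF.
  have [l _ Gly] : (\bigcup_i G i) y by rewrite -TG.
  exists (maxn k l) => //; split.
  - by move: x Fkx; exact/subsetPset/ndF/leq_maxl.
  - by move: y Gly; exact/subsetPset/ndG/leq_maxr.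
move=> k; have [? ?] := Foo k; have [? ?] := Goo k; split.
  rewrite -[X in measurable X]setTI; apply: measurable_unconsv => //.
  exact: measurableX.
rewrite /lebesgue_step /pushforward -comp_preimage.
rewrite (_ : @unconsv n \o @consv n = id); last by apply/funext => z; exact: consvK.
by rewrite preimage_id product_measure1E// lte_mul_pinfty// ge0_fin_numE.
Qed.

HB.instance Definition _ := Measure_isSigmaFinite.Build _ _ _ lebesgue_step
  lebesgue_step_sigma_finite.

End step.

(* Lebesgue measure on R^n: iterated product of the Lebesgue measure of R,
   transported along R * R^n = R^(n+1). See [lebesgue_rVE]. *)
Fixpoint lebesgue_rV n : {sigma_finite_measure set 'rV[R]_n -> \bar R} :=
  match n with
  | 0 => \d_(0 : 'rV[R]_0)
  | k.+1 => lebesgue_step (lebesgue_rV k)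
  end.

Lemma measurable_rV_box n (A : 'I_n -> set R) :
  (forall i, measurable (A i)) ->
  measurable [set x : 'rV[R]_n | forall i, A i (x ord0 i)].
Proof.
move=> mA; rewrite (_ : [set _ | _] =
    \bigcap_(i in [set: 'I_n]) [set x : 'rV[R]_n | A i (x ord0 i)]).
  apply: fin_bigcap_measurable => // i _.
  rewrite -[X in measurable X]setTI.
  exact: (measurable_coor i measurableT (mA i)).
by apply/seteqP; split=> x /= xA i => [_|]; exact: xA.
Qed.

Lemma lebesgue_rVE n (A : 'I_n -> set R) : (forall i, measurable (A i)) ->
  lebesgue_rV n [set x | forall i, A i (x ord0 i)] =
  (\prod_(i < n) lebR (A i))%E.
Proof.
elim: n A => [|n IH] A mA.
  rewrite big_ord0 /= diracE mem_set //; by case.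
rewrite big_ord_recl -IH // -product_measure1E //; last 2 first.
- exact: (mA ord0).
- exact: (measurable_rV_box (fun i => mA (lift ord0 i))).
rewrite /= /lebesgue_step /pushforward; congr (_ _).
apply/seteqP; split=> -[a x] /= H.
  split; first by have := H ord0; rewrite consv0.
  by move=> i; have := H (lift ord0 i); rewrite consvS.
move=> i; case: (unliftP ord0 i) => [j|] ->; rewrite ?consvS ?consv0.
  exact: H.2.
exact: H.1.
Qed.

End lebesgue_rV.

Section domains.
Context {R : realType} {d : nat}.
Implicit Types (Omega : set 'rV[R]_d).

Definition dotv (x y : 'rV[R]_d) : R := \sum_(i < d) x ord0 i * y ord0 i.

Definition bounded_domain Omega :=
  [/\ Omega !=set0, open Omega, connected Omega & bounded_set Omega].

Definition boundary Omega := closure Omega `\` Omega°.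

(* Near each boundary point, Omega is the strict epigraph, in some unit
   direction e, of a Lipschitz function on the hyperplane orthogonal to e;
   y - (y.e)e is the orthogonal projection of y on that hyperplane. *)
Definition lipschitz_boundary Omega :=
  forall x, boundary Omega x ->
  exists (e : 'rV[R]_d) (g : 'rV[R]_d -> R) (L r : R),
    [/\ dotv e e = 1, L.-lipschitz g, 0 < r &
        Omega `&` ball x r =
        [set y | g (y - dotv y e *: e) < dotv y e] `&` ball x r].

End domains.

Section sobolev.
Context {R : realType} {d : nat}.
Implicit Types (Omega : set 'rV[R]_d) (u phi : 'rV[R]_d -> R)
  (U Du : 'rV[R]_d -> 'rV[R]_d) (p : R).
Local Notation mu := (@lebesgue_rV R d).

Definition partial (i : 'I_d) u : 'rV[R]_d -> R :=
  fun x => 'D_(delta_mx ord0 i) u x.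

Definition grad u : 'rV[R]_d -> 'rV[R]_d := fun x => \row_i partial i u x.

Definition iter_partial (s : seq 'I_d) u : 'rV[R]_d -> R := foldr partial u s.

Definition smooth u :=
  forall s : seq 'I_d, continuous (iter_partial s u) /\
    forall (i : 'I_d) x, derivable (iter_partial s u) x (delta_mx ord0 i).

Definition support u := closure [set x | u x != 0].

Definition test_function Omega phi :=
  [/\ smooth phi, compact (support phi) & support phi `<=` Omega].

(* [u \_ K] is u extended by 0 outside K; [u \in Lfun mu p%:E] means that u is
   measurable with finite L^p norm. Values of u outside Omega are irrelevant. *)
Definition Lp_loc Omega p u :=
  forall K, compact K -> K `<=` Omega -> u \_ K \in Lfun mu p%:E.

Definition weak_gradient Omega u Du :=
  forall phi, test_function Omega phi -> forall i : 'I_d,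
  \int[mu]_(x in Omega) (u x * partial i phi x) =
  - \int[mu]_(x in Omega) (Du x ord0 i * phi x).

(* u belongs to W^{1,p}_loc(Omega) and Du is a representative of its weak
   gradient. *)
Definition W1p_loc_with_grad Omega p u Du :=
  [/\ Lp_loc Omega p u, forall i : 'I_d, Lp_loc Omega p (fun x => Du x ord0 i)
    & weak_gradient Omega u Du].

Definition W1p_loc Omega p u := exists Du, W1p_loc_with_grad Omega p u Du.

Definition W1p_loc_vec Omega p U :=
  forall j : 'I_d, W1p_loc Omega p (fun x => U x ord0 j).

End sobolev.

Section anisotropic.
Context {R : realType} {d N : nat}.
Variables (v : 'I_N -> 'rV[R]_d) (delta c : 'I_N -> R) (p : R).

Definition F_k (k : 'I_N) (z : 'rV[R]_d) : 'rV[R]_d :=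
  Num.max (dotv z (v k) - delta k * c k) 0 `^ (p - 1) *: v k.

Definition F (z : 'rV[R]_d) : 'rV[R]_d := \sum_(k < N) F_k k z.

Definition H_k (k : 'I_N) (z : 'rV[R]_d) : 'rV[R]_d :=
  Num.max (dotv z (v k) - delta k * c k) 0 `^ (p / 2) *: v k.

Definition H (z : 'rV[R]_d) : 'rV[R]_d := \sum_(k < N) H_k k z.

(* u in W^{1,p}_loc(Omega), with weak gradient Du, is a local weak solution of
   - div F(Du) = f in Omega. *)
Definition local_weak_solution (Omega : set 'rV[R]_d) (f u : 'rV[R]_d -> R)
    (Du : 'rV[R]_d -> 'rV[R]_d) :=
  W1p_loc_with_grad Omega p u Du /\
  forall phi, test_function Omega phi ->
  \int[@lebesgue_rV R d]_(x in Omega) dotv (F (Du x)) (grad phi x) =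
  \int[@lebesgue_rV R d]_(x in Omega) (f x * phi x).

End anisotropic.

(* Main.v *)
(* Write [s_k = (Du . v_k - delta_k c_k)_+], and let [tau_h] be the difference
   [x |-> w(x + h e_i) - w(x)]. Mollifying [u] shows that the equation satisfied
   by [tau_h F(Du)] may be tested with [zeta^2 tau_h u], for a cutoff [zeta]. The
   monotonicity inequality
     [(s^(p/2) - t^(p/2))^2 <= p/2 (s^(p-1) - t^(p-1)) (s - t)]
   turns the left-hand side into a sum of the terms [(zeta tau_h s_k^(p/2))^2]; the
   derivative of [zeta^2] and the right-hand side are absorbed using
   [||tau_h u||_p <= C h] and [||tau_h f||_q <= C h], which hold locally since
   [u] and [f] are Sobolev functions. Hence [||tau_h s_k^(p/2)||_2 <= C h] locally.

   The weak derivative of [g = s_k^(p/2)] is then the Riesz representative of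
   [phi |-> - \int g d_i phi], which the bound makes continuous for a weighted L^2
   norm; choosing a weight that grows fast enough towards the boundary of [Omega]
   handles all compact subsets at once, so that no gluing is needed. *)
Require Import Defs.
From HB Require Import structures.
From mathcomp Require Import all_boot all_order all_algebra.
From mathcomp Require Import all_classical all_reals all_analysis.
From mathcomp Require Import measurable_realfun ring lra.
Import Order.TTheory GRing.Theory Num.Theory.
Import numFieldNormedType.Exports.

Set Implicit Arguments.
Unset Strict Implicit.
Unset Printing Implicit Defensive.

Local Open Scope classical_set_scope.
Local Open Scope ring_scope.

(** * Borel sets and Lebesgue measure on R^d *)

(** All functions are first cut down to a compact inset [K0] of [Omega] and extended by 0 to the
    whole space, where translation invariance is available; since [delta k * c k >= 0], the excess
    of a zero gradient is 0, so this is compatible with [F] and [H]. Passing to an inner inset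
    leaves room for a shift of length [h] and a mollification radius at once. The limit in the
    mollified equation exists because [(p - 1) q = p] puts [F(Du)] in L^q, while the gradients of
    the test functions converge in L^p. Absorption works because the monotonicity inequality is used
    with constant [p] instead of [p/2]: the spare copy of the square pays for the cross term. The
    right-hand side is of order [h^2] because the differences of [f] and of [u] are each of order
    [h]; this is where the derivatives of [f] enter. In the last part the bound on differences
    degenerates towards the boundary, so the functional has no reason to be bounded on the
    unweighted space; the step [h] may depend on the test function, as long as the final constant
    does not. *)

Section rV_measurable.
Context {R : realType} {d : nat}.
Implicit Types (x y : 'rV[R]_d) (O : set 'rV[R]_d).

Lemma ball_rVE x (r : R) : 0 < r ->
  ball x r = [set y | forall i, ball (x ord0 i) r (y ord0 i)].
Proof.
move=> r0; apply/seteqP; split=> y /= => [[_ h] i|h]; first exact: h.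
by split => // i j; rewrite ord1.
Qed.

Lemma measurable_ball_rV x (r : R) : measurable (ball x r).
Proof.
have [r0|r0] := ltP 0 r; last first.
  rewrite (_ : ball x r = set0) //; apply/seteqP; split=> // y [].
  by rewrite ltNge r0.
rewrite ball_rVE //; apply: (measurable_rV_box (A := fun i => ball (x ord0 i) r)).
by move=> i; exact: measurable_ball.
Qed.

Lemma ball_rV_ratr x (e : R) : 0 < e ->
  exists q : 'rV[rat]_d, ball x e (map_mx ratr q).
Proof.
move=> e0.
have h i : exists q : rat, ball (x ord0 i) e (ratr q).
  have : x ord0 i - e < x ord0 i + e by lra.
  move/rat_in_itvoo => [q]; rewrite in_itv /= => /andP[h1 h2].
  by exists q; rewrite /ball /= ltr_norml; lra.
have [q hq] := choice h.
exists (\row_i q i); rewrite ball_rVE // => i /=.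
by rewrite !mxE.
Qed.

(** The sigma-algebra is generated by the coordinates, so an open set has to be written as a
    countable union of boxes: sup-norm balls with rational centre and radius [1/(n+1)]. *)
Lemma measurable_open_rV O : open O -> measurable O.
Proof.
move=> oO.
pose F (q : 'rV[rat]_d * nat) : set 'rV[R]_d :=
  let B := ball (map_mx ratr q.1 : 'rV[R]_d) q.2.+1%:R^-1 in
  if pselect (B `<=` O) then B else set0.
have -> : O = \bigcup_q F q.
  apply/seteqP; split=> [x Ox|x [q _]]; last first.
    by rewrite /F; case: pselect => // h /h.
  have [e /= e0 eO] := (nbhs_ballP _ _).1 (oO x Ox).
  have e20 : 0 < e / 2 by lra.
  pose n := Num.truncn (e / 2)^-1.
  have n0 : 0 < n.+1%:R^-1 :> R by rewrite invr_gt0.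
  have ne : n.+1%:R^-1 < e / 2.
    rewrite -[ltRHS]invrK ltf_pV2 ?posrE ?invr_gt0//.
    exact: truncnS_gt.
  have [q hq] := ball_rV_ratr x n0.
  exists (q, n) => //; rewrite /F /=; case: pselect => [h|[]].
    exact: ball_sym.
  move=> y hy; apply: eO.
  by have := ball_triangle (le_ball (ltW ne) hq) (le_ball (ltW ne) hy); rewrite -splitr.
apply: countable_bigcupT_measurable.
  exact: countableP.
by move=> q; rewrite /F /=; case: pselect => ? /=; [exact: measurable_ball_rV|exact: measurable0].
Qed.

Lemma measurable_closed_rV O : closed O -> measurable O.
Proof.
move=> cO; rewrite -(setCK O); apply: measurableC; apply: measurable_open_rV.
exact: closed_openC.
Qed.

Lemma measurable_compact_rV O : compact O -> measurable O.
Proof.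
move=> cO; apply: measurable_closed_rV; exact: compact_closed.
Qed.

Lemma continuous_measurable_rV (f : 'rV[R]_d -> R) :
  continuous f -> measurable_fun setT f.
Proof.
move=> cf; apply: (measurability _ (RGenOpens.measurableE R)) => //.
move=> _ [_ [a [b ->]] <-]; rewrite setTI; apply: measurable_open_rV.
by apply: open_comp => //; move=> x _; exact: cf.
Qed.

(** Coordinates are continuous, hence Borel. This allows a Dynkin class argument to start from the
    open sets. *)
Lemma measurable_sigma_open (A : set 'rV[R]_d) : measurable A -> <<s [set O | open O] >> A.
Proof.
pose G : set_system 'rV[R]_d := [set O | open O].
move=> mA; have : <<s G >> A; last by [].
apply: (smallest_sub (C := sigma_algebra setT)) mA; first exact: smallest_sigma_algebra.
move=> B; elim/big_ind: _ => [//|X Y IX IY [/IX|/IY]//|i _ [C mC <-]].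
rewrite setTI.
have cT : measurable_fun setT ((fun x => x ord0 i) : g_sigma_algebraType G -> R).
  apply: (measurability _ (RGenOpens.measurableE R)) => //.
  move=> _ [_ [a [b ->]] <-]; rewrite setTI; apply: sub_sigma_algebra.
  by apply: open_comp => // x _; exact: coord_continuous.
by have := cT measurableT C mC; rewrite setTI.
Qed.

Lemma measurable_shift_rV y : measurable_fun setT (fun x => x + y).
Proof.
apply: measurable_rV_coor => i; under eq_fun do rewrite mxE.
by apply: measurable_funD => //; exact: measurable_coor.
Qed.

Lemma measurable_preimage_shift_rV y (A : set 'rV[R]_d) : measurable A ->
  measurable [set x | A (x + y)].
Proof.
by move=> mA; rewrite -[X in measurable X]setTI; exact: measurable_shift_rV.
Qed.

Lemma measurable_add_rV :
  measurable_fun setT (fun z : 'rV[R]_d * 'rV[R]_d => z.1 + z.2).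
Proof.
apply: measurable_rV_coor => i; under eq_fun do rewrite mxE.
apply: measurable_funD.
- exact: (measurableT_comp (measurable_coor i) measurable_fst).
- exact: (measurableT_comp (measurable_coor i) measurable_snd).
Qed.

End rV_measurable.

(** * Translation invariance of Lebesgue measure *)

Section translation.
Context {R : realType}.
Local Notation lebR := (@lebesgue_measure R).

Lemma lebesgue_measure_shift (y : R) (A : set R) : measurable A ->
  lebR [set x | A (x + y)] = lebR A.
Proof.
move=> mA.
have mphi : measurable_fun setT (fun x : measurableTypeR R => (x + y : measurableTypeR R)).
  by apply: measurable_funD.
pose push : {measure set (measurableTypeR R) -> \bar R} :=
  @measure_function_pushforward__canonical__measure_function_Measure
    _ _ _ _ _ lebR _ mphi.
apply/esym; apply: (@lebesgue_measure_unique _ push) mA => X [[a b] _ <-].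
have -> : push `]a, b]%classic = lebR `]a - y, b - y]%classic.
  congr (lebR _); apply/seteqP; split=> x /=; rewrite !in_itv /=; lra.
rewrite !lebesgue_measure_itv /= !lte_fin.
have -> : (a - y < b - y) = (a < b) by apply/idP/idP; lra.
by case: ifP => // _; rewrite -!EFinD; congr (_%:E); lra.
Qed.

(** Boxes are stable under intersection and generate the sigma-algebra, and the cubes [g k] of
    finite measure exhaust the space; on boxes the one-dimensional invariance applies to each
    factor. *)
Lemma lebesgue_rV_shift d (y : 'rV[R]_d) (A : set 'rV[R]_d) : measurable A ->
  lebesgue_rV d [set x | A (x + y)] = lebesgue_rV d A.
Proof.
move=> mA.
pose push : {measure set 'rV[R]_d -> \bar R} :=
  @measure_function_pushforward__canonical__measure_function_Measure
    _ _ _ _ _ (lebesgue_rV d) _ (measurable_shift_rV y).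
pose G : set_system 'rV[R]_d := [set B | exists2 C : 'I_d -> set R,
  (forall i, measurable (C i)) & B = [set x : 'rV[R]_d | forall i, C i (x ord0 i)]].
pose g k : set 'rV[R]_d := [set x : 'rV[R]_d | forall i, `[- k%:R, k%:R]%classic (x ord0 i)].
suff H : forall E, <<s G >> E -> lebesgue_rV d E = push E.
  apply/esym/H; apply: (smallest_sub (C := sigma_algebra setT)) mA; first exact: smallest_sigma_algebra.
  move=> B; elim/big_ind: _ => [//|X Y IX IY [/IX|/IY]//|i _ [C mC <-]].
  apply: sub_sigma_algebra.
  exists (fun j => if j == i then C else setT); first by move=> j; case: ifP.
  apply/seteqP; split=> x /=; rewrite /preimage /=.
    by move=> [_ Cx] j; case: eqP => [->|].
  by move=> /(_ i); rewrite eqxx.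
apply: (@g_sigma_algebra_measure_unique _ _ _ G _ g).
- by move=> _ [C mC ->]; exact: measurable_rV_box.
- by move=> k; exists (fun _ => `[- k%:R, k%:R]%classic).
- apply/seteqP; split=> // x _.
  have [k hk] : exists k : nat, forall i, `|x ord0 i| <= k%:R.
    exists (Num.truncn (\big[Num.max/0]_i `|x ord0 i|)).+1 => i.
    apply: le_trans (ltW (truncnS_gt _)).
    by apply: (le_bigmax _ (fun i => `|x ord0 i|)).
  exists k => // i /=; rewrite in_itv /=; have := hk i; rewrite ler_norml.
  by [].
- move=> _ _ [C mC ->] [D mD ->]; exists (fun i => C i `&` D i).
    by move=> i; exact: measurableI.
  apply/seteqP; split=> x /=; first by move=> [h1 h2] i; split.
  by move=> h; split=> i; have [] := h i.
- move=> _ [C mC ->]; 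
  change (lebesgue_rV d [set x : 'rV[R]_d | forall i, C i (x ord0 i)] =
    lebesgue_rV d [set x : 'rV[R]_d | forall i, C i ((x + y) ord0 i)]).
  rewrite lebesgue_rVE //.
  transitivity (lebesgue_rV d [set x : 'rV[R]_d | forall i, [set a | C i (a + y ord0 i)] (x ord0 i)]).
    rewrite (@lebesgue_rVE R d (fun i => [set a | C i (a + y ord0 i)])); last first.
      move=> i; rewrite -[X in measurable X]setTI.
      have mf : measurable_fun setT (fun a : measurableTypeR R => (a + y ord0 i : measurableTypeR R)).
        exact: measurable_funD.
      exact: (mf measurableT _ (mC i)).
    by apply: eq_bigr => i _; rewrite lebesgue_measure_shift.
  by congr (lebesgue_rV d _); apply/seteqP; split=> x /= h i; have := h i; rewrite /= mxE.
- move=> k; have := @lebesgue_rVE R d (fun=> `[- k%:R, k%:R]%classic) (fun=> measurable_itv _).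
  change (lebesgue_rV d (g k) = (\prod_(i < d) lebR (`[- k%:R, k%:R]%classic)%R)%E ->
    (lebesgue_rV d (g k) < +oo)%E) => ->.
  elim/big_rec: _ => [|i z _ zoo]; first exact: ltry.
  apply: lte_mul_pinfty => //.
  by rewrite lebesgue_measure_itv /=; case: ifP => _.
Qed.

Lemma lebesgue_rV_ball d (x : 'rV[R]_d) (r : R) : 0 < r ->
  lebesgue_rV d (ball x r) = ((r *+ 2) ^+ d)%:E.
Proof.
move=> r0; rewrite ball_rVE //.
have := @lebesgue_rVE R d (fun i => ball (x ord0 i) r) (fun i => measurable_ball _ _).
change (lebesgue_rV d [set y | forall i, ball (x ord0 i) r (y ord0 i)] =
  (\prod_(i < d) lebR (ball (x ord0 i) r))%E ->
  lebesgue_rV d [set y | forall i, ball (x ord0 i) r (y ord0 i)] = ((r *+ 2) ^+ d)%:E) => ->.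
under eq_bigr do rewrite lebesgue_measure_ball ?ltW //.
by rewrite prodEFin prodr_const card_ord.
Qed.

End translation.

(** * Integrals of p-th powers *)

Section nonneg_integral.
Context {dT} {T : measurableType dT} {R : realType}.
Variable mu : {measure set T -> \bar R}.
Implicit Types f g : T -> R.

Lemma le_nintegral f g : measurable_fun setT f -> measurable_fun setT g ->
  (forall x, 0 <= f x <= g x) ->
  (\int[mu]_x (f x)%:E <= \int[mu]_x (g x)%:E)%E.
Proof.
move=> mf mg fg; apply: ge0_le_integral => //.
- by move=> x _; rewrite lee_fin; have /andP[] := fg x.
- exact/measurable_EFinP.
- exact/measurable_EFinP.
- by move=> x _; rewrite lee_fin; have /andP[] := fg x.
Qed.

Lemma nintegralD f g : measurable_fun setT f -> measurable_fun setT g ->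
  (forall x, 0 <= f x) -> (forall x, 0 <= g x) ->
  (\int[mu]_x (f x + g x)%:E = \int[mu]_x (f x)%:E + \int[mu]_x (g x)%:E)%E.
Proof.
move=> mf mg f0 g0; rewrite -ge0_integralD //.
- by move=> x _; rewrite lee_fin.
- exact/measurable_EFinP.
- by move=> x _; rewrite lee_fin.
- exact/measurable_EFinP.
Qed.

Lemma nintegralZ (k : R) f : 0 <= k -> measurable_fun setT f ->
  (forall x, 0 <= f x) ->
  (\int[mu]_x (k * f x)%:E = k%:E * \int[mu]_x (f x)%:E)%E.
Proof.
move=> k0 mf f0; rewrite -ge0_integralZl_EFin //.
- by move=> x _; rewrite lee_fin.
- exact/measurable_EFinP.
Qed.

Lemma nintegral_integrable f : measurable_fun setT f -> (forall x, 0 <= f x) ->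
  (\int[mu]_x (f x)%:E < +oo)%E -> mu.-integrable setT (EFin \o f).
Proof.
move=> mf f0 foo; apply/integrableP; split; first exact/measurable_EFinP.
by under eq_integral => x _ do rewrite /= ger0_norm //.
Qed.

Lemma integrable_nintegral f : mu.-integrable setT (EFin \o f) ->
  (\int[mu]_x (`|f x|)%:E < +oo)%E.
Proof. by move=> /integrableP[_]. Qed.

Lemma integrable_EFin_measurable f : mu.-integrable setT (EFin \o f) ->
  measurable_fun setT f.
Proof. by move=> /measurable_int /measurable_EFinP. Qed.

Lemma integrable_addr f g : mu.-integrable setT (EFin \o f) ->
  mu.-integrable setT (EFin \o g) ->
  mu.-integrable setT (EFin \o (fun x => f x + g x)).
Proof. exact: integrableD. Qed.

Lemma integrable_subr f g : mu.-integrable setT (EFin \o f) ->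
  mu.-integrable setT (EFin \o g) ->
  mu.-integrable setT (EFin \o (fun x => f x - g x)).
Proof. exact: integrableB. Qed.

Lemma integrable_mulrl (c : R) f : mu.-integrable setT (EFin \o f) ->
  mu.-integrable setT (EFin \o (fun x => c * f x)).
Proof. exact: integrableZl. Qed.

Lemma nintegral_Rintegral f : mu.-integrable setT (EFin \o f) ->
  (\int[mu]_x (f x)%:E = (\int[mu]_x f x)%:E)%E.
Proof. by move=> fi; rewrite /Rintegral fineK //; exact: integrable_fin_num. Qed.

(** Either the right-hand side is [+oo], or [g] is integrable and dominates [f]; measurability is
    therefore all that has to be checked when this is applied. *)
Lemma le_abs_Rintegral f g : measurable_fun setT f -> measurable_fun setT g ->
  (forall x, `|f x| <= g x) ->
  (`|\int[mu]_x f x|%:E <= \int[mu]_x (g x)%:E)%E.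
Proof.
move=> mf mg fg.
have g0 x : 0 <= g x by apply: le_trans (fg x).
have [goo|] := ltP (\int[mu]_x (g x)%:E)%E +oo%E; last by rewrite leye_eq => /eqP->; rewrite leey.
have gi := nintegral_integrable mg g0 goo.
have fi : mu.-integrable setT (EFin \o f).
  apply: (le_integrable _ _ _ gi) => //; first exact/measurable_EFinP.
  by move=> x _ /=; rewrite lee_fin (ger0_norm (g0 x)).
rewrite nintegral_Rintegral // lee_fin.
apply: le_trans (le_normr_Rintegral _ fi) _ => //.
apply: le_Rintegral => //.
by have := integrable_norm fi.
Qed.

End nonneg_integral.

(** The p-th power of the L^p norm, without the root, which keeps constants explicit. The lock keeps
    the integral folded under conversion. *)
HB.lock Definition pint {dT} {T : measurableType dT} {R : realType}
  (mu : {measure set T -> \bar R}) (p : R) (f : T -> R) : \bar R :=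
  (\int[mu]_x (`|f x| `^ p)%:E)%E.

Definition isLp {dT} {T : measurableType dT} {R : realType}
  (mu : {measure set T -> \bar R}) (p : R) (f : T -> R) :=
  measurable_fun setT f /\ (pint mu p f < +oo)%E.

Section Lp.
Context {dT} {T : measurableType dT} {R : realType}.
Variable mu : {measure set T -> \bar R}.
Implicit Types (p q : R) (f g w : T -> R).

Local Notation pint := (pint mu).
Local Notation isLp := (isLp mu).

Lemma pintE p f : pint p f = (\int[mu]_x (`|f x| `^ p)%:E)%E.
Proof. by rewrite unlock. Qed.

Lemma pint_ge0 p f : (0 <= pint p f)%E.
Proof. by rewrite pintE; apply: integral_ge0 => x _; rewrite lee_fin powR_ge0. Qed.

Lemma measurable_abs_powR p f : measurable_fun setT f ->
  measurable_fun setT (fun x => `|f x| `^ p).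
Proof.
move=> mf; apply: (measurableT_comp (measurable_powR p)).
exact: measurableT_comp.
Qed.

Lemma isLp_fin p f : isLp p f -> pint p f \is a fin_num.
Proof. by move=> [_ h]; rewrite ge0_fin_numE // pint_ge0. Qed.

Lemma le_pint p f g (c : R) : 0 <= p -> 0 <= c -> measurable_fun setT f ->
  measurable_fun setT g -> (forall x, `|f x| <= c * `|g x|) ->
  (pint p f <= (c `^ p)%:E * pint p g)%E.
Proof.
move=> p0 c0 mf mg fg.
rewrite !pintE -nintegralZ ?powR_ge0 //; last exact: measurable_abs_powR.
apply: le_nintegral; first exact: measurable_abs_powR.
- by apply: measurable_funM => //; exact: measurable_abs_powR.
- move=> x; rewrite powR_ge0 /= -powRM //.
  by apply: ge0_ler_powR => //; rewrite nnegrE ?mulr_ge0.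
Qed.

Lemma isLp_le p f g (c : R) : 0 <= p -> 0 <= c -> measurable_fun setT f ->
  (forall x, `|f x| <= c * `|g x|) -> isLp p g -> isLp p f.
Proof.
move=> p0 c0 mf fg [mg gp]; split=> //.
apply: le_lt_trans (le_pint p0 c0 mf mg fg) _.
by apply: lte_mul_pinfty => //; rewrite lee_fin powR_ge0.
Qed.

(** The sum is at most twice the larger modulus; this crude constant covers every [p >= 0] and is
    good enough throughout. *)
Lemma ler_powR_add p (a b : R) : 0 <= p ->
  `|a + b| `^ p <= 2 `^ p * (`|a| `^ p + `|b| `^ p).
Proof.
move=> p0.
have key (x y : R) : 0 <= x <= y -> (x + y) `^ p <= 2 `^ p * (x `^ p + y `^ p).
  move=> /andP[x0 xy]; have y0 : 0 <= y by exact: le_trans xy.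
  apply: (@le_trans _ _ (2 `^ p * y `^ p)).
    rewrite -powRM //; apply: ge0_ler_powR => //; rewrite ?nnegrE; lra.
  by rewrite ler_wpM2l ?powR_ge0 // lerDr powR_ge0.
apply: (@le_trans _ _ ((`|a| + `|b|) `^ p)).
  by apply: ge0_ler_powR; rewrite ?nnegrE ?addr_ge0 ?ler_normD.
have [ab|/ltW ba] := leP `|a| `|b|; first by apply: key; rewrite normr_ge0.
by rewrite addrC [X in _ * X]addrC; apply: key; rewrite normr_ge0.
Qed.

Lemma pintD p f g : 0 <= p -> measurable_fun setT f -> measurable_fun setT g ->
  (pint p (fun x => f x + g x)%R <= (2 `^ p)%:E * (pint p f + pint p g))%E.
Proof.
move=> p0 mf mg.
have mfp := measurable_abs_powR p mf; have mgp := measurable_abs_powR p mg.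
rewrite !pintE -nintegralD -?nintegralZ ?powR_ge0 //; last exact: measurable_funD.
apply: le_nintegral.
- by apply: measurable_abs_powR; exact: measurable_funD.
- by apply: measurable_funM => //; exact: measurable_funD.
- by move=> x; rewrite powR_ge0 ler_powR_add.
Qed.

Lemma isLpD p f g : 0 <= p -> isLp p f -> isLp p g ->
  isLp p (fun x => f x + g x).
Proof.
move=> p0 [mf fp] [mg gp]; split; first exact: measurable_funD.
apply: le_lt_trans (pintD p0 mf mg) _.
by apply: lte_mul_pinfty; rewrite ?lee_fin ?powR_ge0 // lte_add_pinfty.
Qed.

Lemma isLpZ p f (c : R) : 0 <= p -> isLp p f -> isLp p (fun x => c * f x).
Proof.
move=> p0 fp; apply: (isLp_le (c := `|c|) p0 _ _ _ fp) => //.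
- by apply: measurable_funM => //; case: fp.
- by move=> x; rewrite normrM.
Qed.

Lemma pintN p f : pint p (fun x => - f x) = pint p f.
Proof. by rewrite !pintE; apply: eq_integral => x _; rewrite normrN. Qed.

Lemma isLpN p f : isLp p f -> isLp p (fun x => - f x).
Proof.
by move=> [mf fp]; split; rewrite ?pintN //; exact: measurableT_comp.
Qed.

Lemma isLpB p f g : 0 <= p -> isLp p f -> isLp p g ->
  isLp p (fun x => f x - g x).
Proof. by move=> p0 fp gp; apply: isLpD p0 fp _; exact: isLpN. Qed.

Lemma isLp0 p : p != 0 -> isLp p (fun=> 0).
Proof.
move=> p0; split => //; rewrite pintE integral0_eq ?ltry // => x _.
by rewrite normr0 powR0.
Qed.

Lemma isLp_sum p n (F : 'I_n -> T -> R) : 0 < p -> (forall i, isLp p (F i)) ->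
  isLp p (fun x => \sum_i F i x).
Proof.
move=> p0; elim: n F => [|n IH] F hF.
  under eq_fun do rewrite big_ord0; apply: isLp0; exact: lt0r_neq0.
under eq_fun do rewrite big_ord_recl.
by apply: isLpD; [exact: ltW|exact: hF|apply: IH => i; exact: hF].
Qed.

(** Young's inequality with the factors [1/p] and [1/q], both at most 1, dropped. *)
Lemma young_powR p q (a b : R) : 0 < p -> 0 < q -> p^-1 + q^-1 = 1 ->
  `|a * b| <= `|a| `^ p + `|b| `^ q.
Proof.
move=> p0 q0 pq; rewrite normrM.
have := conjugate_powR (normr_ge0 a) (normr_ge0 b) p0 q0 pq.
have A := powR_ge0 `|a| p; have B := powR_ge0 `|b| q.
have P : 0 < p^-1 by rewrite invr_gt0.
have Q : 0 < q^-1 by rewrite invr_gt0.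
nra.
Qed.

Lemma isLp_mul_integrable p q f g : 0 < p -> 0 < q -> p^-1 + q^-1 = 1 ->
  isLp p f -> isLp q g -> mu.-integrable setT (EFin \o (fun x => f x * g x)).
Proof.
move=> p0 q0 pq [mf fp] [mg gq].
have mfp := measurable_abs_powR p mf; have mgq := measurable_abs_powR q mg.
have fgi : mu.-integrable setT (EFin \o (fun x => `|f x| `^ p + `|g x| `^ q)).
  apply: nintegral_integrable; first exact: measurable_funD.
    by move=> x; rewrite addr_ge0 ?powR_ge0.
  by rewrite nintegralD // -!pintE lte_add_pinfty.
apply: (le_integrable _ _ _ fgi) => //.
  by apply/measurable_EFinP; exact: measurable_funM.
move=> x _ /=; rewrite lee_fin [leRHS]ger0_norm ?addr_ge0 ?powR_ge0 //.
exact: young_powR.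
Qed.

Lemma le_mul_pint p q f g : 0 < p -> 0 < q -> p^-1 + q^-1 = 1 ->
  measurable_fun setT f -> measurable_fun setT g ->
  (\int[mu]_x `|f x * g x|%:E <= pint p f + pint q g)%E.
Proof.
move=> p0 q0 pq mf mg.
have mfp := measurable_abs_powR p mf; have mgq := measurable_abs_powR q mg.
rewrite !pintE -nintegralD //.
apply: le_nintegral.
- by apply: measurableT_comp => //; exact: measurable_funM.
- exact: measurable_funD.
- by move=> x; rewrite normr_ge0 young_powR.
Qed.

(* In this form Young's inequality replaces Hoelder's: scale [f] by [l] and [g] by [l^-1]. *)
Lemma mul_pint_small p q f (e : R) : 0 < p -> 0 < q -> p^-1 + q^-1 = 1 ->
  isLp p f -> 0 < e ->
  exists2 eta : R, 0 < eta & forall g, measurable_fun setT g ->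
    (pint q g <= eta%:E)%E -> (\int[mu]_x `|f x * g x|%:E <= e%:E)%E.
Proof.
move=> p0 q0 pq fp e0; have [mf fpoo] := fp.
set A := fine (pint p f).
have A0 : 0 <= A by rewrite fine_ge0 // pint_ge0.
have EA : pint p f = A%:E by rewrite fineK // isLp_fin.
(* With this [l] the rescaled [f] contributes at most [e/2]; the [+ 1] avoids dividing by a
   vanishing integral. *)
set l := (e / 2 / (A + 1)) `^ p^-1.
have A1 : 0 < A + 1 by lra.
have l0 : 0 < l by rewrite powR_gt0 // !divr_gt0.
have lp : l `^ p = e / 2 / (A + 1).
  by rewrite /l -powRrM mulVf ?gt_eqF // powRr1 // !divr_ge0 // ltW.
exists (e / 2 / (l^-1 `^ q)).
  by apply: divr_gt0; [exact: divr_gt0|rewrite powR_gt0 ?invr_gt0].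
move=> g mg gq.
have -> : (\int[mu]_x `|f x * g x|%:E =
    \int[mu]_x `|(l * f x) * (l^-1 * g x)|%:E)%E.
  apply: eq_integral => x _; congr (`| _ |%:E).
  by rewrite mulrACA divff ?gt_eqF // mul1r.
apply: (@le_trans _ _ ((l `^ p)%:E * pint p f + (l^-1 `^ q)%:E * pint q g)%E).
  apply: le_trans (le_mul_pint p0 q0 pq _ _) _; [exact: measurable_funM..|].
  apply: leeD; apply: le_pint => //; try exact: ltW.
  - exact: measurable_funM.
  - by move=> x; rewrite normrM (gtr0_norm l0).
  - by rewrite invr_ge0 ltW.
  - exact: measurable_funM.
  - by move=> x; rewrite normrM gtr0_norm // invr_gt0.
have -> : e = e / 2 + e / 2 by lra.
rewrite EFinD; apply: leeD.
  rewrite EA lp -EFinM lee_fin mulrAC ler_pdivrMr // ler_pM2l ?divr_gt0 //.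
  by rewrite lerDl.
have lq0 : 0 < l^-1 `^ q by apply: powR_gt0; rewrite invr_gt0.
apply: (@le_trans _ _ ((l^-1 `^ q)%:E * (e / 2 / l^-1 `^ q)%:E)%E).
  by apply: lee_wpmul2l => //; rewrite lee_fin ltW.
by rewrite -EFinM lee_fin mulrC divfK ?gt_eqF.
Qed.

(** Let A be the integral of [w |g|] and J the right-hand side. Young's inequality for [|g x|] and
    [A^(p/q)], integrated against the probability density [w], reads [A A^(p/q) <= J/p + A^p/q]. As
    [1 + p/q = p], the left side is [A^p], and what remains is [A^p/p <= J/p]. *)
Lemma jensen_powR p q w g : 0 < p -> 0 < q -> p^-1 + q^-1 = 1 ->
  measurable_fun setT w -> measurable_fun setT g -> (forall x, 0 <= w x) ->
  (\int[mu]_x (w x)%:E = 1)%E ->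
  ((`|\int[mu]_x (w x * g x)| `^ p)%:E <= \int[mu]_x (w x * `|g x| `^ p)%:E)%E.
Proof.
move=> p0 q0 pq mw mg w0 w1.
have mgp := measurable_abs_powR p mg.
have mwg : measurable_fun setT (fun x => w x * `|g x| `^ p).
  exact: measurable_funM.
have wg0 x : 0 <= w x * `|g x| `^ p by rewrite mulr_ge0 ?powR_ge0.
have [goo|] := ltP (\int[mu]_x (w x * `|g x| `^ p)%:E)%E +oo%E; last first.
  by rewrite leye_eq => /eqP->; rewrite leey.
have Ji := nintegral_integrable mwg wg0 goo.
have wi : mu.-integrable setT (EFin \o w).
  by apply: nintegral_integrable => //; rewrite w1 ltry.
have Rw : \int[mu]_x w x = 1 by rewrite /Rintegral w1.
(* Young's inequality against the constant 1 gives [|g| <= |g|^p + 1]. *)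
have Ai : mu.-integrable setT (EFin \o (fun x => w x * `|g x|)).
  apply: (le_integrable _ _ _ (integrableD _ wi Ji)) => //.
    apply/measurable_EFinP; apply: measurable_funM => //; exact: measurableT_comp.
  move=> x _ /=; rewrite lee_fin (ger0_norm (mulr_ge0 _ _)) //.
  rewrite (ger0_norm (addr_ge0 _ _)) //.
  rewrite -[X in _ <= X + _]mulr1 -mulrDr ler_wpM2l // addrC.
  have := young_powR `|g x| 1 p0 q0 pq.
  by rewrite mulr1 !normr_id normr1 powR1.
set A := \int[mu]_x (w x * `|g x|).
have A0 : 0 <= A by apply: Rintegral_ge0 => x _; rewrite mulr_ge0.
have AI : `|\int[mu]_x (w x * g x)| <= A.
  rewrite -lee_fin -nintegral_Rintegral //; apply: le_abs_Rintegral.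
  - exact: measurable_funM.
  - by apply: measurable_funM => //; exact: measurableT_comp.
  - by move=> x; rewrite normrM (ger0_norm (w0 x)).
rewrite nintegral_Rintegral // lee_fin.
apply: (@le_trans _ _ (A `^ p)).
  by apply: ge0_ler_powR; rewrite ?nnegrE // ltW.
have [->|An0] := eqVneq A 0.
  rewrite powR0 ?gt_eqF //; apply: Rintegral_ge0 => x _; exact: wg0.
set J := \int[mu]_x (w x * `|g x| `^ p).
suff : A * A `^ (p / q) <= p^-1 * J + q^-1 * A `^ p * 1.
  have -> : A * A `^ (p / q) = A `^ p.
    rewrite -{1}(powRr1 A0) -powRD; last by rewrite An0 implybT.
    congr (_ `^ _); have -> : 1 + p / q = p * (p^-1 + q^-1) by rewrite mulrDr divff ?gt_eqF.
    by rewrite pq mulr1.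
  have -> : q^-1 = 1 - p^-1 by rewrite -pq; ring.
  have := powR_ge0 A p; set B := A `^ p => B0 h.
  have : p^-1 * B <= p^-1 * J by lra.
  by rewrite ler_pM2l // invr_gt0.
rewrite -Rw /J -!RintegralZl // -RintegralD //; last 2 first.
- by have := integrableZl measurableT (p^-1) Ji.
- by have := integrableZl measurableT (q^-1 * A `^ p) wi.
rewrite /A mulrC -/A -RintegralZl //; apply: le_Rintegral => //.
- by have := integrableZl measurableT (A `^ (p / q)) Ai.
- apply: integrable_addr.
  + by have := integrableZl measurableT (p^-1) Ji.
  + by have := integrableZl measurableT (q^-1 * A `^ p) wi.
move=> x _.
have := conjugate_powR (normr_ge0 (g x)) (powR_ge0 A (p / q)) p0 q0 pq.
rewrite -powRrM -mulrA mulVf ?gt_eqF // mulr1.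
move=> /(ler_wpM2l (w0 x)); set B := A `^ p; set a := A `^ _; set G := _ `^ _.
by move=> h; apply: le_trans (le_trans _ h) _; rewrite le_eqVlt; apply/orP; left; apply/eqP; ring.
Qed.

(** [Lnorm] is the p-th root of [pint], and both are finite together. This is the bridge to the
    Lebesgue spaces of the statement. *)
Lemma Lfun_isLp p f : p != 0 -> f \in Lfun mu p%:E <-> isLp p f.
Proof.
move=> p0.
have E : Lnorm mu p%:E (EFin \o f) = ((pint p f) `^ p^-1)%E.
  rewrite pintE unlock /=; congr (_ `^ _)%E; apply: eq_integral => x _.
split=> [/andP[/set_mem mf /set_mem]|[mf fp]].
  rewrite /= /finite_norm E => h; split; first by [].
  have [//|] := ltP (pint p f) +oo%E; rewrite leye_eq => /eqP h1.
  by move: h; rewrite h1 poweRyr ?invr_eq0 // ltxx.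
apply/andP; split; first exact/mem_set.
apply/mem_set; rewrite /= /finite_norm E.
by rewrite poweR_lty.
Qed.

End Lp.

(** * Translations in L^p *)

Lemma nonincreasing_measure_small {dT} {T : measurableType dT} {R : realType}
    (mu : {measure set T -> \bar R}) (F : (set T)^nat) (e : R) :
  (forall n, measurable (F n)) -> (mu (F 0%N) < +oo)%E ->
  {homo F : m n / (m <= n)%N >-> n `<=` m} -> \bigcap_n F n = set0 -> 0 < e ->
  exists n, (mu (F n) <= e%:E)%E.
Proof.
move=> mF F0oo ndF F0 e0.
have : mu (F n) @[n --> \oo] --> mu (\bigcap_n F n).
  apply: nonincreasing_cvg_mu => //; first exact: bigcapT_measurable.
  by move=> m n mn; apply/subsetPset; exact: ndF.
rewrite F0 measure0 => /fine_cvgP[Ffin /cvgrPdist_lt /(_ e e0) Hlt].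
have [n [hfin hlt]] : exists n, mu (F n) \is a fin_num /\ `|0 - fine (mu (F n))| < e.
  by have [n hn] := filter_ex (filterI Ffin Hlt); exists n.
exists n; rewrite -(fineK hfin) lee_fin; apply: ltW; apply: le_lt_trans hlt.
by rewrite sub0r normrN ler_norm.
Qed.

(* Lebesgue measure is only used through these properties: [lebesgue_rV R d] is a
   fixpoint on [d], and keeping [mu] abstract prevents it from unfolding. *)
Record haar (R : realType) (d : nat)
    (mu : {sigma_finite_measure set 'rV[R]_d -> \bar R}) : Prop := Haar {
  haar_shift : forall (y : 'rV[R]_d) (A : set 'rV[R]_d), measurable A ->
    mu [set x | A (x + y)] = mu A ;
  haar_ball_fin : forall (x : 'rV[R]_d) (r : R), (mu (ball x r) < +oo)%E ;
  haar_ball_gt0 : forall (x : 'rV[R]_d) (r : R), 0 < r -> (0 < mu (ball x r))%E }.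

Lemma haar_lebesgue_rV (R : realType) (d : nat) : haar (@lebesgue_rV R d).
Proof.
split.
- exact: lebesgue_rV_shift.
- move=> x r; have [r0|r0] := ltP 0 r; first by rewrite lebesgue_rV_ball // ltry.
  rewrite (_ : ball x r = set0) ?measure0 ?ltry //.
  by apply/seteqP; split=> // y []; rewrite ltNge r0.
- by move=> x r r0; rewrite lebesgue_rV_ball // lte_fin exprn_gt0 // mulrn_wgt0.
Qed.

Section haar_theory.
Context {R : realType} {d : nat}.
Variable mu : {sigma_finite_measure set 'rV[R]_d -> \bar R}.
Hypothesis hmu : haar mu.
Implicit Types (x y z : 'rV[R]_d) (p : R) (f g : 'rV[R]_d -> R).

Definition trans y f : 'rV[R]_d -> R := fun x => f (x + y).

Lemma measurable_trans y f : measurable_fun setT f ->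
  measurable_fun setT (trans y f).
Proof. move=> mf; exact: (measurableT_comp mf (measurable_shift_rV y)). Qed.

Lemma ge0_integral_trans y (f : 'rV[R]_d -> \bar R) : measurable_fun setT f ->
  (forall x, 0 <= f x)%E ->
  (\int[mu]_x f (x + y)%R = \int[mu]_x f x)%E.
Proof.
move=> mf f0.
rewrite -(@ge0_integral_pushforward _ _ _ _ _ _ (measurable_shift_rV y) mu setT f) //.
apply: eq_measure_integral => [|mphi A mA _]; first exact: measurable_shift_rV.
exact: (haar_shift hmu y mA).
Qed.

Lemma integral_trans y (f : 'rV[R]_d -> \bar R) : measurable_fun setT f ->
  (\int[mu]_x f (x + y)%R = \int[mu]_x f x)%E.
Proof.
move=> mf; rewrite integralE [RHS]integralE; congr (_ - _)%E.
- rewrite -[RHS](ge0_integral_trans y (measurable_funepos mf)) ?funepos_ge0 //.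
  by apply: eq_integral => x _; rewrite !funeposE.
- rewrite -[RHS](ge0_integral_trans y (measurable_funeneg mf)) ?funeneg_ge0 //.
  by apply: eq_integral => x _; rewrite !funenegE.
Qed.

Lemma Rintegral_trans y f : measurable_fun setT f ->
  \int[mu]_x f (x + y) = \int[mu]_x f x.
Proof.
move=> mf; rewrite /Rintegral (integral_trans y (f := EFin \o f)) //.
exact/measurable_EFinP.
Qed.

Lemma pint_trans p y f : measurable_fun setT f -> pint mu p (trans y f) = pint mu p f.
Proof.
move=> mf; rewrite !pintE.
rewrite (ge0_integral_trans y (f := fun x => (`|f x| `^ p)%:E)) //.
by apply/measurable_EFinP; exact: measurable_abs_powR.
Qed.

Lemma isLp_trans p y f : isLp mu p f -> isLp mu p (trans y f).
Proof.
by move=> [mf fp]; split; [exact: measurable_trans|rewrite pint_trans].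
Qed.

Lemma integrable_trans y f : mu.-integrable setT (EFin \o f) ->
  mu.-integrable setT (EFin \o trans y f).
Proof.
move=> fi; have mf := integrable_EFin_measurable fi.
apply/integrableP; split; first by apply/measurable_EFinP; exact: measurable_trans.
have := integrable_nintegral fi.
rewrite -(ge0_integral_trans y (f := fun x => `|f x|%:E)) //.
by apply/measurable_EFinP; exact: measurableT_comp.
Qed.

Definition trans_cont p g := forall e : R, 0 < e -> exists2 r : R, 0 < r &
  forall y, `|y| < r -> (pint mu p (fun x => g (x + y) - g x)%R <= e%:E)%E.

Lemma trans_contD p f g : 0 <= p -> measurable_fun setT f -> measurable_fun setT g ->
  trans_cont p f -> trans_cont p g -> trans_cont p (fun x => f x + g x).
Proof.
move=> p0 mf mg tf tg e e0.
have E0 : 0 < e / 2 / 2 `^ p by rewrite !divr_gt0 // powR_gt0.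
have [r r0 hr] := tf _ E0; have [s s0 hs] := tg _ E0.
exists (Num.min r s); first by rewrite lt_min r0.
move=> y; rewrite lt_min => /andP[yr ys].
have -> : (fun x => f (x + y) + g (x + y) - (f x + g x)) =
  (fun x => (f (x + y) - f x) + (g (x + y) - g x)) by apply/funext => x; ring.
apply: le_trans (pintD _ p0 _ _) _.
- by apply: measurable_funB => //; exact: measurable_trans.
- by apply: measurable_funB => //; exact: measurable_trans.
apply: (@le_trans _ _ ((2 `^ p)%:E * ((e / 2 / 2 `^ p)%:E + (e / 2 / 2 `^ p)%:E))%E).
  by apply: lee_wpmul2l; rewrite ?lee_fin ?powR_ge0 //; apply: leeD; [exact: hr|exact: hs].
rewrite -EFinD -EFinM lee_fin le_eqVlt; apply/orP; left; apply/eqP.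
by field; rewrite gt_eqF // powR_gt0.
Qed.

Lemma trans_contZ p f (c : R) : 0 <= p -> measurable_fun setT f ->
  trans_cont p f -> trans_cont p (fun x => c * f x).
Proof.
move=> p0 mf tf e e0.
have c1 : 0 < (`|c| + 1) `^ p by rewrite powR_gt0 // ltr_wpDl.
have [r r0 hr] := tf _ (divr_gt0 e0 c1); exists r => // y /hr h.
apply: (@le_trans _ _ (((`|c| + 1) `^ p)%:E * (e / (`|c| + 1) `^ p)%:E)%E); last first.
  by rewrite -EFinM lee_fin mulrC divfK // gt_eqF.
apply: le_trans (lee_wpmul2l _ h); last by rewrite lee_fin ltW.
apply: le_pint => //.
- by apply: measurable_funB; apply: measurable_funM => //; exact: measurable_trans.
- by apply: measurable_funB => //; exact: measurable_trans.
- by move=> x; rewrite -mulrBr normrM ler_wpM2r // lerDl.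
Qed.

(** Three terms: the shifted error, the error, and the translation defect of [g]. Shifting does not
    change the first integral; the product [2^p 2^p] in [c] comes from splitting the sum twice. *)
Lemma trans_cont_closed p f : 0 < p -> measurable_fun setT f ->
  (forall e : R, 0 < e -> exists g, [/\ measurable_fun setT g, trans_cont p g &
    (pint mu p (fun x => f x - g x)%R <= e%:E)%E]) -> trans_cont p f.
Proof.
move=> p0 mf H e e0.
have P0 : 0 < 2 `^ p by rewrite powR_gt0.
pose c := e / 4 / (2 `^ p * 2 `^ p).
have c0 : 0 < c by rewrite !divr_gt0 // mulr_gt0.
have [g [mg tg fg]] := H c c0.
have [r r0 hr] := tg _ (divr_gt0 e0 (mulr_gt0 (ltr0Sn R 1) P0)).
exists r => // y /hr h.
have mfg : measurable_fun setT (fun x => f x - g x) by exact: measurable_funB.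
have -> : (fun x => f (x + y) - f x) =
  (fun x => ((trans y (fun x => f x - g x) x) + (-1) * (f x - g x)) + (g (x + y) - g x)).
  by apply/funext => x; rewrite /trans; ring.
have m1 := measurable_trans y mfg.
have m2 : measurable_fun setT (fun x => (-1) * (f x - g x)) by exact: measurable_funM.
have m3 : measurable_fun setT (fun x => g (x + y) - g x).
  by apply: measurable_funB => //; exact: measurable_trans.
apply: le_trans (pintD _ (ltW p0) (measurable_funD m1 m2) m3) _.
apply: (@le_trans _ _ ((2 `^ p)%:E * ((2 `^ p)%:E * (c%:E + c%:E) + (e / (2 * 2 `^ p))%:E))%E); last first.
  rewrite -!(EFinD, EFinM) lee_fin le_eqVlt; apply/orP; left; apply/eqP.
  by rewrite /c; field; rewrite gt_eqF.
apply: lee_wpmul2l; first by rewrite lee_fin ltW.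
apply: leeD => //; apply: le_trans (pintD _ (ltW p0) m1 m2) _.
apply: lee_wpmul2l; first by rewrite lee_fin ltW.
apply: leeD; first by rewrite pint_trans.
apply: le_trans fg.
rewrite (_ : (fun x => -1 * (f x - g x)) = (fun x => - (f x - g x))) ?pintN //.
by apply/funext => x; rewrite mulN1r.
Qed.

(** For [r > 0], the points at sup-distance at least [r] from the complement of [O]. These insets
    are closed for any [O], and a shift costs no more than its length, which makes them convenient
    domains for local estimates. *)
Definition inner (O : set 'rV[R]_d) (r : R) : set 'rV[R]_d := [set x | ball x r `<=` O].

Lemma closed_inner O r : 0 < r -> closed (inner O r).
Proof.
move=> r0; rewrite -openC openE => x /= nx.
have [y [xy nOy]] : exists y, ball x r y /\ ~ O y.
  by apply: contrapT => h; apply: nx => y xy; apply: contrapT => nO; apply: h; exists y.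
have oB : open (ball y r) by exact: ball_open.
rewrite /interior; apply: filterS (open_nbhs_nbhs (conj oB (ball_sym xy))).
by move=> z /ball_sym yz h; apply: nOy; exact: h.
Qed.

Lemma inner_sub O r : 0 < r -> inner O r `<=` O.
Proof. by move=> r0 x; apply; exact: ballxx. Qed.

Lemma le_inner O (r s : R) : r <= s -> inner O s `<=` inner O r.
Proof. by move=> rs x h y xy; apply: h; exact: le_ball xy. Qed.

Lemma inner_shift O (r s : R) x y : inner O (r + s) x -> ball x s y -> inner O r y.
Proof. by move=> h xy z yz; apply: h; rewrite addrC; exact: ball_triangle xy yz. Qed.

Lemma indicB_powR p (A B : set 'rV[R]_d) x : p != 0 ->
  `|\1_A x - \1_B x : R| `^ p <= \1_(A `\` B) x + \1_(B `\` A) x.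
Proof.
move=> p0; rewrite !indicE !in_setD.
by case: (x \in A); case: (x \in B); rewrite /= ?subr0 ?sub0r ?subrr ?normrN ?normr1 ?normr0 ?powR1 ?powR0 ?addr0 ?add0r.
Qed.

Lemma pint_indicB p (A B : set 'rV[R]_d) : p != 0 -> measurable A -> measurable B ->
  (pint mu p (fun x => \1_A x - \1_B x)%R <= mu (A `\` B) + mu (B `\` A))%E.
Proof.
move=> p0 mA mB.
have mAB : measurable (A `\` B) by exact: measurableD.
have mBA : measurable (B `\` A) by exact: measurableD.
have E (C : set 'rV[R]_d) : measurable C -> mu C = (\int[mu]_x (\1_C x)%:E)%E.
  by move=> mC; rewrite integral_indic // setIT.
rewrite pintE (E _ mAB) (E _ mBA) -nintegralD //.
apply: le_nintegral.
- by apply: measurable_abs_powR; exact: measurable_funB.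
- exact: measurable_funD.
- by move=> x; rewrite powR_ge0 indicB_powR.
Qed.

(** If [|y| < 1/(n+1)], then [O] and its translate by [y] differ only inside the boundary layer
    [F n] and a translate of it. The layers decrease to the empty set because [O] is open, and their
    measures tend to 0 because [O] has finite measure. *)
Lemma trans_cont_open p (O : set 'rV[R]_d) : p != 0 -> open O -> (mu O < +oo)%E ->
  trans_cont p \1_O.
Proof.
move=> p0 oO Ooo e e0.
have mO := measurable_open_rV oO.
pose F n := O `\` inner O n.+1%:R^-1.
have mF n : measurable (F n).
  apply: measurableD => //; apply: measurable_closed_rV; apply: closed_inner.
  by rewrite invr_gt0.
have F0 : \bigcap_n F n = set0.
  apply/seteqP; split=> // x h.
  have Ox : O x by have [] := h 0%N I.
  have [r /= r0 rO] := (nbhs_ballP _ _).1 (oO x Ox).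
  have [_] := h (Num.truncn r^-1) I; apply => y xy; apply: rO.
  apply: le_ball xy; rewrite -[leRHS]invrK lef_pV2 ?posrE ?invr_gt0 //.
  exact/ltW/truncnS_gt.
have [n hn] : exists n, (mu (F n) <= (e / 2)%:E)%E.
  apply: nonincreasing_measure_small => //; last exact: divr_gt0.
  - by apply: le_lt_trans Ooo; apply: le_measure; rewrite ?inE //; exact: subDsetl.
  - move=> m n mn x [Ox h]; split=> // h'; apply: h.
    by apply: le_inner h'; rewrite lef_pV2 ?posrE // ler_nat.
exists n.+1%:R^-1; first by rewrite invr_gt0.
move=> y yn.
have by_ x : ball x n.+1%:R^-1 (x + y).
  by rewrite -ball_normE /= opprD addNKr normrN.
have by' x : ball x n.+1%:R^-1 (x - y).
  by rewrite -ball_normE /= opprB addrC subrK.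
have mOy : measurable [set x | O (x + y)].
  exact: measurable_preimage_shift_rV.
have -> : (fun x => \1_O (x + y) - \1_O x : R) = (fun x => \1_[set x | O (x + y)] x - \1_O x).
  by apply/funext => x; rewrite !indicE.
apply: le_trans (pint_indicB p0 mOy mO) _.
have -> : e = e / 2 + e / 2 by lra.
rewrite EFinD; apply: leeD; apply: le_trans hn.
  rewrite -(haar_shift hmu y (mF n)); apply: le_measure; rewrite ?inE.
  - exact: measurableD.
  - exact: measurable_preimage_shift_rV.
  - move=> x [/= h1 h2]; split=> // h3; apply: h2.
    by rewrite -[x](addrK y); apply: h3.
apply: le_measure; rewrite ?inE //; first exact: measurableD.
by move=> x [/= h1 h2]; split=> // h3; apply: h2; exact: h3.
Qed.

End haar_theory.

Section pint_dominated.
Context {dT} {T : measurableType dT} {R : realType}.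
Variable mu : {measure set T -> \bar R}.

Lemma cvg_powR0 (p : R) (u : R^nat) : 0 < p -> (forall n, 0 <= u n) ->
  u n @[n --> \oo] --> 0 -> u n `^ p @[n --> \oo] --> 0.
Proof.
move=> p0 u0 /cvgrPdist_lt hu; apply/cvgrPdist_le => e e0.
have E0 : 0 < e `^ p^-1 by rewrite powR_gt0.
apply: filterS (hu _ E0) => n; rewrite !sub0r !normrN !ger0_norm ?powR_ge0 // => /ltW h.
rewrite -[leRHS](powRr1 (ltW e0)) -(mulVf (lt0r_neq0 p0)) powRrM.
by apply: ge0_ler_powR; rewrite ?nnegrE ?powR_ge0 // ltW.
Qed.

Lemma pint_dominated (p : R) (f g : T -> R) (F : nat -> T -> R) (e : R) : 0 < p ->
  measurable_fun setT f -> (forall n, measurable_fun setT (F n)) -> isLp mu p g ->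
  (forall n x, `|f x - F n x| <= g x) -> (forall x, F n x @[n --> \oo] --> f x) ->
  0 < e -> exists n, (pint mu p (fun x => f x - F n x)%R <= e%:E)%E.
Proof.
move=> p0 mf mF [mg gp] dom cvF e0.
have g0 x : 0 <= g x by apply: le_trans (dom 0%N x).
have [] := @dominated_convergence _ _ _ mu setT measurableT
  (fun n x => (`|f x - F n x| `^ p)%:E) (cst 0%E) (fun x => (`|g x| `^ p)%:E).
- move=> n; apply/measurable_EFinP; apply: measurable_abs_powR.
  exact: measurable_funB.
- exact: measurable_cst.
- apply: aeW => x _ /=; apply/fine_cvgP; split; first exact: nearW.
  apply: cvg_powR0 => //.
  have /cvgrPdist_lt h := cvF x.
  apply/cvgrPdist_lt => a /h; apply: filterS => n.
  by rewrite sub0r normrN normr_id.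
- apply: nintegral_integrable; first exact: measurable_abs_powR.
  + by move=> x; rewrite powR_ge0.
  + by rewrite -pintE.
- apply: aeW => x n _; rewrite /= lee_fin ger0_norm ?powR_ge0 //.
  apply: ge0_ler_powR; [exact: ltW|by rewrite nnegrE..|].
  by rewrite (ger0_norm (g0 x)).
move=> _ _; rewrite integral0 => /fine_cvgP[hfin /cvgrPdist_lt /(_ e e0) Hlt].
have [n [h1 h2]] : exists n, pint mu p (fun x => f x - F n x) \is a fin_num /\
    `|0 - fine (pint mu p (fun x => f x - F n x))| < e.
  by have [n hn] := filter_ex (filterI hfin Hlt); exists n; rewrite pintE.
exists n; rewrite -(fineK h1) lee_fin; apply: ltW; apply: le_lt_trans h2.
by rewrite sub0r normrN ler_norm.
Qed.

End pint_dominated.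

Section translation_continuity.
Context {R : realType} {d : nat}.
Variable mu : {sigma_finite_measure set 'rV[R]_d -> \bar R}.
Hypothesis hmu : haar mu.
Implicit Types (x y z : 'rV[R]_d) (p : R) (f g : 'rV[R]_d -> R).

(** Dynkin's argument: the sets [A] with this property form a lambda-system containing the open
    sets, which are stable under intersection. Intersecting with a ball keeps all measures
    finite. *)
Lemma trans_cont_indic_bounded p (r : R) (A : set 'rV[R]_d) : 0 < p ->
  measurable A -> trans_cont mu p \1_(A `&` ball 0 r).
Proof.
move=> p0 mA.
have pn0 : p != 0 by rewrite gt_eqF.
have mB : measurable (ball (0 : 'rV[R]_d) r) by exact: measurable_ball_rV.
pose H := [set C : set 'rV[R]_d | measurable C /\ trans_cont mu p \1_(C `&` ball 0 r)].
have oB : open (ball (0 : 'rV[R]_d) r).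
  have [r0|r0] := ltP 0 r; first exact: ball_open.
  rewrite (_ : ball _ r = set0); first exact: open0.
  by apply/seteqP; split=> // z []; rewrite ltNge r0.
have HO (O : set 'rV[R]_d) : open O -> H O.
  move=> oO; split; first exact: measurable_open_rV.
  apply: trans_cont_open => //; first exact: openI.
  apply: le_lt_trans (haar_ball_fin hmu 0 r); apply: le_measure; rewrite ?inE //.
    by apply: measurable_open_rV; exact: openI.
suff : <<s [set O : set 'rV[R]_d | open O] >> `<=` H.
  by move=> /(_ A (measurable_sigma_open mA)) [].
apply: lambda_system_subset => //.
- by move=> O1 O2; exact: openI.
- split=> //.
  + exact/HO/openT.
  + move=> C D DC [mC tC] [mD tD]; split; first exact: measurableD.
    (* A lambda-system only asks for differences with [D] inside [C], where the indicators subtract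
       exactly. *)
    have E (B : set 'rV[R]_d) : \1_((C `\` D) `&` B) =
      (fun x => \1_(C `&` B) x + (-1) * \1_(D `&` B) x : R).
      apply/funext => x; rewrite !indicE in_setI in_setD !in_setI.
      have : x \in D -> x \in C by rewrite !inE; exact: DC.
      case: (x \in D) => /= [->//|_]; last by rewrite andbT mulr0 addr0.
      by case: (x \in B); rewrite /= ?mulN1r ?subrr ?mulr0 ?addr0.
    rewrite E.
    apply: (trans_contD (ltW p0)) => //.
    * by apply: measurable_indic; exact: measurableI.
    * by apply: measurable_funM => //; apply: measurable_indic; exact: measurableI.
    * apply: (trans_contZ _ (ltW p0)) => //.
      by apply: measurable_indic; exact: measurableI.
  + move=> F ndF HF.
    have mF n : measurable (F n) by have [] := HF n.
    have mU : measurable (\bigcup_i F i) by exact: bigcupT_measurable.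
    split=> //; apply: (trans_cont_closed hmu p0).
      by apply: measurable_indic; exact: measurableI.
    move=> e e0.
    pose G n := (\bigcup_i F i `&` ball 0 r) `\` (F n `&` ball 0 r).
    have [n hn] : exists n, (mu (G n) <= e%:E)%E.
      apply: nonincreasing_measure_small => //.
      * by move=> n; apply: measurableD; exact: measurableI.
      * apply: le_lt_trans (haar_ball_fin hmu 0 r); apply: le_measure; rewrite ?inE //.
          by apply: measurableD; exact: measurableI.
        by move=> x [[]].
      * move=> m n mn x [h1 h2]; split=> // -[h3 h4]; apply: h2; split=> //.
        by move: x h3 {h1 h4}; apply/subsetPset; exact: ndF.
      * apply/seteqP; split=> // x h.
        have [[[i _ Fix] Bx] _] := h 0%N I.
        by have [_] := h i I; apply.
    exists \1_(F n `&` ball 0 r); split.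
    * by apply: measurable_indic; exact: measurableI.
    * by have [] := HF n.
    apply: le_trans (pint_indicB mu pn0 _ _) _; [exact: measurableI..|].
    rewrite [X in (_ + X)%E](_ : _ = 0%E) ?adde0 //.
    rewrite (_ : _ `\` _ = set0) ?measure0 //.
    by apply/seteqP; split=> // x [[Fx Bx]]; apply; split=> //; exists n.
Qed.

Lemma trans_cont_sum p n (F : 'I_n -> 'rV[R]_d -> R) : 0 < p ->
  (forall i, measurable_fun setT (F i)) -> (forall i, trans_cont mu p (F i)) ->
  trans_cont mu p (fun x => \sum_i F i x).
Proof.
move=> p0; elim: n F => [|n IH] F mF tF.
  move=> e e0; exists 1 => // y _; under eq_fun do rewrite !big_ord0 subr0.
  rewrite pintE integral0_eq ?lee_fin ?ltW // => x _.
  by rewrite normr0 powR0 ?gt_eqF.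
under eq_fun do rewrite big_ord_recl.
apply: (trans_contD (ltW p0)) => //.
- exact: measurable_sum.
- by apply: IH => i; [exact: mF|exact: tF].
Qed.

Import HBSimple HBNNSimple.

(** Simple functions cut to balls are finite combinations of the indicators already treated, and
    they converge to [g] in L^p by dominated convergence, with [g] itself as the bound. *)
Lemma trans_cont_ge0 p g : 0 < p -> isLp mu p g -> (forall x, 0 <= g x) ->
  trans_cont mu p g.
Proof.
move=> p0 Lg g0; have [mg gp] := Lg.
have mEg : measurable_fun setT (EFin \o g) by exact/measurable_EFinP.
pose s n := nnsfun_approx measurableT mEg n.
pose h n x := s n x * \1_(ball (0 : 'rV[R]_d) n%:R) x.
have s0 n x : 0 <= s n x by exact: fun_ge0.
have sg n x : s n x <= g x.
  rewrite -lee_fin /s nnsfun_approxE.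
  by apply: le_approx => // z _; rewrite lee_fin.
have mh n : measurable_fun setT (h n).
  apply: measurable_funM => //; apply: measurable_indic; exact: measurable_ball_rV.
apply: (trans_cont_closed hmu p0 mg) => e e0.
have [n hn] : exists n, (pint mu p (fun x => g x - h n x)%R <= e%:E)%E.
  apply: (pint_dominated p0 mg mh Lg) => //.
  - move=> n x; have := sg n x; have := s0 n x; have := g0 x.
    rewrite /h indicE; case: (_ \in _); rewrite ?mulr1 ?mulr0 ?subr0.
      by move=> *; rewrite ger0_norm ?subr_ge0 // gerBl.
    by move=> *; rewrite ger0_norm.
  - move=> x.
    have := cvg_nnsfun_approx measurableT mEg (fun x _ => g0 x : (0 <= (g x)%:E)%E) (I : setT x).
    move=> /fine_cvgP[_ hs].
    apply: cvg_trans hs; apply: near_eq_cvg.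
    (* At a fixed [x] the cut to the ball of radius [n] is invisible once [n > |x|]. *)
    exists (Num.truncn `|x|).+1 => // n /= nx; rewrite /h indicE mem_set ?mulr1 //.
    rewrite -ball_normE /= sub0r normrN; apply: lt_le_trans (truncnS_gt _) _.
    by rewrite ler_nat.
exists (h n); split => //.
pose S : seq R := finmap.enum_fset (fset_set (s n @` setT)).
have -> : h n = (fun x => \sum_(i < size S)
    (nth 0 S i * \1_((s n @^-1` [set nth 0 S i]) `&` ball 0 n%:R) x)).
  apply/funext => x; rewrite /h (fimfunEord (s n)) big_distrl /=.
  apply: eq_bigr => i _; rewrite -mulrA; congr (_ * _).
  move: (ball (0 : 'rV[R]_d) n%:R) => B.
  by rewrite !indicE in_setI; case: (_ \in _); case: (_ \in _); rewrite ?mulr1 ?mulr0.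
have ms (a : R) : measurable (s n @^-1` [set a]) by exact: measurable_funPTI.
apply: trans_cont_sum => // i.
- apply: measurable_funM => //; apply: measurable_indic.
  by apply: measurableI => //; exact: measurable_ball_rV.
- apply: (trans_contZ _ (ltW p0)).
    by apply: measurable_indic; apply: measurableI => //; exact: measurable_ball_rV.
  exact: trans_cont_indic_bounded.
Qed.

Theorem isLp_trans_cont p g : 0 < p -> isLp mu p g -> trans_cont mu p g.
Proof.
move=> p0 [mg gp].
have L1 (f : 'rV[R]_d -> R) : measurable_fun setT f -> (forall x, `|f x| <= 1 * `|g x|) -> isLp mu p f.
  by move=> mf fg; apply: (isLp_le (ltW p0) ler01 mf fg).
have -> : g = (fun x => Num.max (g x) 0 + (-1) * Num.max (- g x) 0).
  by apply/funext => x; have [h|h] := leP (g x) 0; have [h'|h'] := leP (- g x) 0; lra.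
have m1 : measurable_fun setT (fun x => Num.max (g x) 0) by exact: measurable_maxr.
have m2 : measurable_fun setT (fun x => Num.max (- g x) 0).
  by apply: measurable_maxr => //; exact: measurableT_comp.
apply: (trans_contD (ltW p0)) => //; first exact: measurable_funM.
- apply: trans_cont_ge0 => //; last by move=> x; rewrite le_max lexx orbT.
  apply: L1 => // x; rewrite mul1r; have [h|h] := leP (g x) 0; rewrite ?normr0 //.
- apply: (trans_contZ _ (ltW p0)) => //.
  apply: trans_cont_ge0 => //; last by move=> x; rewrite le_max lexx orbT.
  by apply: L1 => // x; rewrite mul1r; have [h|h] := leP (- g x) 0; rewrite ?normr0 ?normrN.
Qed.

End translation_continuity.

(** * Smooth functions *)

Section smooth_theory.
Context {R : realType} {d : nat}.
Local Notation V := 'rV[R]_d.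
Implicit Types (f g u phi : V -> R) (x y v : V) (i j : 'I_d).
Local Notation e_ i := (delta_mx ord0 i : V).

Lemma continuous_rVP f : continuous f <->
  forall x (e : R), 0 < e -> exists2 r : R, 0 < r &
    forall y, `|y| < r -> `|f (x + y) - f x| < e.
Proof.
split=> [cf x e e0|h x].
  have /cvgrPdist_lt /(_ e e0) := cf x.
  move=> /nbhs_ballP[r /= r0 hr]; exists r => // y yr.
  rewrite distrC; apply: hr.
  by rewrite -ball_normE /= opprD addNKr normrN.
have F := nbhs_filter (x : 'rV[R]_d).
apply/cvgrPdist_lt => e e0; have [r r0 hr] := h x e e0.
suff S : \forall t \near (x : 'rV[R]_d), `|f x - f t| < e by exact: S.
apply/nbhs_ballP; exists r => //= y; rewrite -ball_normE /= distrC => /hr.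
by rewrite subrKC distrC.
Qed.

(** Smoothness quantifies over all lists of indices; a class of continuous derivable functions
    stable under [partial] is an invariant that can be carried along any such list. *)
Lemma smooth_ind (P : (V -> R) -> Prop) :
  (forall f, P f -> continuous f /\
     forall i, (forall x, derivable f x (e_ i)) /\ P (partial i f)) ->
  forall f, P f -> smooth f.
Proof.
move=> hP f Pf s.
have Ps : P (iter_partial s f).
  by elim: s => [//|i s IH] /=; have [_ /(_ i)[]] := hP _ IH.
by have [cf df] := hP _ Ps; split=> // i x; have [] := df i.
Qed.

Lemma smooth_continuous f : smooth f -> continuous f.
Proof. by move=> /(_ [::])[]. Qed.

Lemma smooth_derivable f i x : smooth f -> derivable f x (e_ i).
Proof. by move=> /(_ [::])[_ /(_ i x)]. Qed.

Lemma smooth_partial f i : smooth f -> smooth (partial i f).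
Proof.
(* [foldr] applies the last index of the list first, so differentiating [f] beforehand appends
   [i]. *)
move=> sf s; have := sf (rcons s i).
by rewrite /iter_partial foldr_rcons.
Qed.

Lemma smooth_measurable f : smooth f -> measurable_fun setT f.
Proof. by move=> /smooth_continuous; exact: continuous_measurable_rV. Qed.

Lemma smooth_cst (c : R) : smooth (cst c : V -> R).
Proof.
apply: (@smooth_ind (fun f => exists c, f = cst c)); last by exists c.
move=> _ [a ->]; split; first exact: cst_continuous.
move=> i; split; first by move=> x; exact: derivable_cst.
by exists 0; apply/funext => x; rewrite /partial derive_cst.
Qed.

(** The Leibniz rule turns a product into a sum of products, so a class stable under [partial] has
    to be closed under both operations. *)
Inductive smooth_closure : (V -> R) -> Prop :=
| SmoothBase f : smooth f -> smooth_closure f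
| SmoothAdd f g : smooth_closure f -> smooth_closure g -> smooth_closure (f + g)
| SmoothMul f g : smooth_closure f -> smooth_closure g -> smooth_closure (f * g).

Lemma smooth_closure_smooth f : smooth_closure f -> smooth f.
Proof.
move: f; apply: smooth_ind => f; elim=> {f} [f sf|f g sf [cf df] sg [cg dg]|f g sf [cf df] sg [cg dg]].
- split; first exact: smooth_continuous.
  move=> i; split; first by move=> x; exact: smooth_derivable.
  exact/SmoothBase/smooth_partial.
- split; first by move=> x; exact: (cvgD (cf x) (cg x)).
  move=> i; have [di Pi] := df i; have [di' Pi'] := dg i; split.
    by move=> x; apply: derivableD.
  rewrite (_ : partial i (f + g) = partial i f + partial i g); first exact: SmoothAdd.
  by apply/funext => x; rewrite /partial deriveD.
- split; first by move=> x; exact: (cvgM (cf x) (cg x)).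
  move=> i; have [di Pi] := df i; have [di' Pi'] := dg i; split.
    by move=> x; apply: derivableM.
  rewrite (_ : partial i (f * g) = f * partial i g + g * partial i f).
    by apply: SmoothAdd; apply: SmoothMul.
  by apply/funext => x; rewrite /partial deriveM.
Qed.

Lemma smoothD f g : smooth f -> smooth g -> smooth (fun x => f x + g x).
Proof.
by move=> sf sg; apply: smooth_closure_smooth; apply: (SmoothAdd (f := f) (g := g)); exact: SmoothBase.
Qed.

Lemma smoothM f g : smooth f -> smooth g -> smooth (fun x => f x * g x).
Proof.
by move=> sf sg; apply: smooth_closure_smooth; apply: (SmoothMul (f := f) (g := g)); exact: SmoothBase.
Qed.

Lemma smoothZ (c : R) f : smooth f -> smooth (fun x => c * f x).
Proof. by move=> sf; apply: smoothM sf; exact: smooth_cst. Qed.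

Lemma smoothB f g : smooth f -> smooth g -> smooth (fun x => f x - g x).
Proof.
move=> sf sg; under eq_fun do rewrite -mulN1r.
by apply: smoothD sf _; exact: smoothZ.
Qed.

Lemma smooth_prod (I : Type) (r : seq I) (F : I -> V -> R) :
  (forall a, smooth (F a)) -> smooth (fun x => \prod_(a <- r) F a x).
Proof.
move=> sF; elim: r => [|a r IH].
  by under eq_fun do rewrite big_nil; exact: smooth_cst.
by under eq_fun do rewrite big_cons; by apply: smoothM; [exact: sF|exact: IH].
Qed.

Lemma partialD f g i : smooth f -> smooth g ->
  partial i (fun x => f x + g x) = (fun x => partial i f x + partial i g x).
Proof. by move=> sf sg; apply/funext => x; rewrite /partial deriveD //; exact: smooth_derivable. Qed.

Lemma partialM f g i : smooth f -> smooth g ->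
  partial i (fun x => f x * g x) = (fun x => f x * partial i g x + g x * partial i f x).
Proof. by move=> sf sg; apply/funext => x; rewrite /partial deriveM //; exact: smooth_derivable. Qed.

Lemma partialZ (c : R) f i : smooth f ->
  partial i (fun x => c * f x) = (fun x => c * partial i f x).
Proof.
move=> sf; rewrite (partialM i (smooth_cst c) sf); apply/funext => x.
by rewrite /partial derive_cst mulr0 addr0.
Qed.

Lemma partialB f g i : smooth f -> smooth g ->
  partial i (fun x => f x - g x) = (fun x => partial i f x - partial i g x).
Proof.
move=> sf sg; under [X in partial i X]eq_fun do rewrite -mulN1r.
rewrite (partialD i sf (smoothZ _ sg)) (partialZ _ i sg).
by apply/funext => x; rewrite mulN1r.
Qed.

Lemma derivable_shift f x y v :
  derivable (fun z => f (z + y)) x v = derivable f (x + y) v.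
Proof.
have E : (fun h : R => h^-1 *: (f (h *: v + x + y) - f (x + y))) =
  (fun h : R => h^-1 *: (f (h *: v + (x + y)) - f (x + y))).
  by apply/funext => h; rewrite addrA.
exact: (congr1 (fun q : R -> R => cvg (q @ 0^')) E).
Qed.

Lemma derive_shift f x y v : 'D_v (fun z => f (z + y)) x = 'D_v f (x + y).
Proof.
have E : (fun h : R => h^-1 *: (f (h *: v + x + y) - f (x + y))) =
  (fun h : R => h^-1 *: (f (h *: v + (x + y)) - f (x + y))).
  by apply/funext => h; rewrite addrA.
exact: (congr1 (fun q : R -> R => lim (q @ 0^')) E).
Qed.

Lemma partial_shift f y i : partial i (fun z => f (z + y)) = (fun z => partial i f (z + y)).
Proof. by apply/funext => x; rewrite /partial derive_shift. Qed.

Lemma smooth_shift f y : smooth f -> smooth (fun z => f (z + y)).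
Proof.
move=> sf; apply: (@smooth_ind (fun h => exists2 g, smooth g & h = fun z => g (z + y))).
  move=> _ [g sg ->]; split.
    apply/continuous_rVP => x e e0.
    have [r r0 hr] := (continuous_rVP g).1 (smooth_continuous sg) (x + y) e e0.
    by exists r => // z zr; rewrite addrAC; exact: hr.
  move=> i; split; first by move=> x; rewrite derivable_shift; exact: smooth_derivable.
  by exists (partial i g); [exact: smooth_partial|exact: partial_shift].
by exists f.
Qed.

Lemma derivable_line f x v (t : R) :
  derivable (fun s : R => f (x + s *: v)) t 1 = derivable f (x + t *: v) v.
Proof.
have E : (fun h : R => h^-1 *: (f (x + (h *: 1 + t) *: v) - f (x + t *: v))) =
  (fun h : R => h^-1 *: (f (h *: v + (x + t *: v)) - f (x + t *: v))).
  by apply/funext => h; rewrite [h *: 1]mulr1 scalerDl addrCA.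
exact: (congr1 (fun q : R -> R => cvg (q @ 0^')) E).
Qed.

Lemma derive_line f x v (t : R) :
  'D_1 (fun s : R => f (x + s *: v)) t = 'D_v f (x + t *: v).
Proof.
have E : (fun h : R => h^-1 *: (f (x + (h *: 1 + t) *: v) - f (x + t *: v))) =
  (fun h : R => h^-1 *: (f (h *: v + (x + t *: v)) - f (x + t *: v))).
  by apply/funext => h; rewrite [h *: 1]mulr1 scalerDl addrCA.
exact: (congr1 (fun q : R -> R => lim (q @ 0^')) E).
Qed.

Lemma is_derive_line f x v (t D : R) :
  is_derive t 1 (fun s : R => f (x + s *: v)) D -> is_derive (x + t *: v) v f D.
Proof.
move=> [h1 h2]; split; first by rewrite -derivable_line.
by rewrite -derive_line.
Qed.

Lemma line_mvt f x v (h : R) : (forall t : R, derivable f (x + t *: v) v) ->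
  exists2 c : R, `|c| <= `|h| & f (x + h *: v) - f x = 'D_v f (x + c *: v) * h.
Proof.
move=> df.
have dl (t : R) : is_derive t (1 : R) (fun s : R => f (x + s *: v)) ('D_v f (x + t *: v)).
  by rewrite -derive_line; apply: derivableP; rewrite derivable_line.
have cl (a b : R) : {within `[a, b], continuous (fun s : R => f (x + s *: v))}.
  by apply: derivable_within_continuous => t _; rewrite derivable_line.
have [h0|h0|->] := ltgtP h 0; last 1 first.
- by exists 0 => //; rewrite mulr0 scale0r addr0 subrr.
- have [c] := MVT h0 (fun t _ => dl t) (cl h 0).
  rewrite in_itv /= => /andP[hc c0] E; exists c.
    by rewrite !ltr0_norm // lerN2 ltW.
  by move: E; rewrite scale0r addr0 => E; lra.
- have [c] := MVT h0 (fun t _ => dl t) (cl 0 h).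
  rewrite in_itv /= => /andP[c0 hc] E; exists c.
    by rewrite !gtr0_norm // ltW.
  by move: E; rewrite scale0r addr0 subr0.
Qed.

(** The mean value theorem twice, first for [f] and then for its partial derivative; this yields [M]
    rather than [M/2]. *)
Lemma smooth_taylor f i (M : R) x (h : R) : smooth f ->
  (forall y, `|partial i (partial i f) y| <= M) ->
  `|f (x + h *: e_ i) - f x - h * partial i f x| <= M * h ^+ 2.
Proof.
move=> sf fM.
have [c ch ->] := @line_mvt f x (e_ i) h (fun t => smooth_derivable sf).
have [c' _ E] := @line_mvt (partial i f) x (e_ i) c
  (fun t => smooth_derivable (smooth_partial i sf)).
rewrite -/(partial i f _) mulrC -mulrBr E !normrM -(real_normK (num_real h)) expr2 mulrCA.
by apply: ler_pM; rewrite ?mulr_ge0 //; [exact: fM|exact: ler_wpM2l].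
Qed.

Lemma partial_eq0 f (U : set V) i : open U -> (forall x, U x -> f x = 0) ->
  forall x, U x -> partial i f x = 0.
Proof.
move=> oU fU x Ux; rewrite /partial -(derive_cst (0 : R) x (e_ i)).
apply: near_eq_derive; apply: filterS (open_nbhs_nbhs (conj oU Ux)) => y.
exact: fU.
Qed.

Lemma compact_rV_closed (K : set V) : compact K -> closed K.
Proof. exact: compact_closed. Qed.

Lemma test_functionI (Omega K : set V) phi : smooth phi -> compact K -> K `<=` Omega ->
  (forall x, ~ K x -> phi x = 0) -> test_function Omega phi.
Proof.
move=> sphi cK KO phi0.
have sK : Defs.support phi `<=` K.
  rewrite [X in _ `<=` X](closure_id K).1; last exact: compact_rV_closed.
  by apply: closureS => x /= /eqP n0; apply: contrapT => /phi0.
split=> //; last exact: subset_trans sK KO.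
by apply: subclosed_compact cK sK; exact: closed_closure.
Qed.

Lemma test_function_eq0 (Omega : set V) phi x : test_function Omega phi ->
  ~ Defs.support phi x -> phi x = 0.
Proof.
move=> _ ns; apply: contrapT => /eqP n0; apply: ns; exact: subset_closure.
Qed.

Lemma partial_compl_eq0 phi (K : set V) i : closed K -> (forall x, ~ K x -> phi x = 0) ->
  forall x, ~ K x -> partial i phi x = 0.
Proof. by move=> cK h x; apply: (partial_eq0 (U := ~` K)) => //; exact: closed_openC. Qed.

Lemma continuous_compact_supp_bounded phi (K : set V) : continuous phi -> compact K ->
  (forall x, ~ K x -> phi x = 0) -> exists2 M : R, 0 < M & forall x, `|phi x| <= M.
Proof.
move=> cphi cK phi0.
have : compact (phi @` K).
  by apply: continuous_compact => //; exact: continuous_subspaceT.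
move=> /compact_bounded[M [_ hM]].
exists (`|M| + 1); first by rewrite ltr_wpDl.
move=> x; have [Kx|/phi0->] := pselect (K x).
  by apply: hM; [rewrite ltr_pwDr // ler_norm|exists x].
by rewrite normr0 addr_ge0.
Qed.

Lemma smooth_bounded phi (K : set V) : smooth phi -> compact K ->
  (forall x, ~ K x -> phi x = 0) -> exists2 M : R, 0 < M & forall x, `|phi x| <= M.
Proof. by move=> /smooth_continuous; exact: continuous_compact_supp_bounded. Qed.

End smooth_theory.

(** * A smooth bump built from exp(-1/t) *)

Section bump1.
Context {R : realType}.
Implicit Types (q : {poly R}) (f : R -> R) (t : R).

(** The polynomial in [1/t] makes the family stable under differentiation: the derivative of the
    member for [q] is the member for [X^2 (q - q')]. *)
Definition pexp q t : R := if 0 < t then q.[t^-1] * expR (- t^-1) else 0.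

(** The term of degree [size q + 2] of the exponential series beats the polynomial. The factor
    [s ^+ 2] later gives [pexp q t = O(t^2)], hence derivative 0 at the origin. *)
Lemma poly_expR_bound q : exists2 C : R, 0 <= C & forall s : R, 1 <= s -> `|q.[s]| * s ^+ 2 <= C * expR s.
Proof.
elim/poly_ind: q => [|q c _]; first by exists 0 => // s _; rewrite horner0 normr0 mul0r mul0r.
move: (q * 'X + c%:P) => {}q.
exists ((\sum_(i < size q) `|q`_i|) * ((size q).+2)`!%:R).
  by rewrite mulr_ge0 // sumr_ge0.
move=> s s1; have s0 : 0 <= s by lra.
rewrite horner_coef.
have h : `|\sum_(i < size q) q`_i * s ^+ i| <= (\sum_(i < size q) `|q`_i|) * s ^+ size q.
  rewrite mulr_suml; apply: le_trans (ler_norm_sum _ _ _) _.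
  apply: ler_sum => i _; rewrite normrM ler_wpM2l // ger0_norm ?exprn_ge0 //.
  by rewrite ler_weXn2l // ltnW.
apply: le_trans (ler_wpM2r (exprn_ge0 2 s0) h) _.
rewrite -!mulrA; apply: ler_wpM2l; first by rewrite sumr_ge0.
rewrite -exprD addn2.
have := expR_ge1Dxn (size q).+1 s0.
have F : 0 < ((size q).+2)`!%:R :> R by rewrite ltr0n fact_gt0.
move=> hE; have : s ^+ (size q).+2 / ((size q).+2)`!%:R <= expR s by lra.
by rewrite ler_pdivrMr // mulrC.
Qed.

Lemma pexp_bound q : exists2 C : R, 0 <= C & forall t, `|t| <= 1 -> `|pexp q t| <= C * t ^+ 2.
Proof.
have [C C0 hC] := poly_expR_bound q; exists C => // t t1.
rewrite /pexp; case: ifP => [t0|_]; last by rewrite normr0 mulr_ge0 // sqr_ge0.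
have s1 : 1 <= t^-1 by rewrite invf_ge1 //; move: t1; rewrite ger0_norm // ltW.
have := hC _ s1; rewrite normrM (ger0_norm (expR_ge0 _)) expRN.
rewrite ler_pdivrMr ?expR_gt0 // exprVn => h.
by rewrite mulrAC -ler_pdivrMr ?exprn_gt0.
Qed.

Lemma is_derive_pexp q t :
  is_derive t (1 : R) (pexp q) (pexp ('X ^+ 2 * (q - q^`())) t).
Proof.
have [t0|t0|->] := ltgtP t 0.
- rewrite {2}/pexp ltNge ltW //=.
  apply: near_eq_is_derive (is_derive_cst (0 : R) (t : R) (1 : R)).
  have : \forall s \near t, s < 0 by exact: lt_nbhsl.
  by apply: filterS => s s0; rewrite /pexp ltNge ltW.
- rewrite {2}/pexp t0.
  have tn0 : t != 0 by rewrite gt_eqF.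
  have dV : is_derive t (1 : R) (fun s : R => s^-1) (- t ^- 2).
    have := @is_deriveV R id t 1 1 tn0 (is_derive_id _ _).
    by move=> h; apply: is_derive_eq h _; rewrite /= scaler1.
  have dq : is_derive t (1 : R) (fun s : R => q.[s^-1]) (- t ^- 2 * q^`().[t^-1]).
    by have := is_derive1_comp (is_derive_poly q t^-1) dV; rewrite mulrC.
  have de : is_derive t (1 : R) (fun s : R => expR (- s^-1)) (t ^- 2 * expR (- t^-1)).
    have dN : is_derive t (1 : R) (fun s : R => - s^-1) (t ^- 2).
      by have := is_deriveN dV; rewrite opprK.
    by have := @is_derive1_comp R expR (fun s => - s^-1) t _ _ (is_derive_expR _) dN; rewrite mulrC.
  apply: (near_eq_is_derive _ (f := (fun s => q.[s^-1]) * (fun s => expR (- s^-1)))).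
    have : \forall s \near t, 0 < s by exact: lt_nbhsr.
    by apply: filterS => s s0; rewrite /pexp s0.
  apply: is_derive_eq (is_deriveM dq de) _.
  rewrite hornerM hornerD hornerN hornerXn exprVn /GRing.scale /=; ring.
rewrite {2}/pexp ltxx.
have [C C0 hC] := pexp_bound q.
have L : (fun h : R => h^-1 *: ((pexp q \o shift 0) (h *: 1) - pexp q 0)) @ 0^' --> (0 : R).
  apply/cvgrPdist_le => e e0.
  have E0 : 0 < Num.min 1 (e / (C + 1)) by rewrite lt_min ltr01 divr_gt0 //; lra.
  exists (Num.min 1 (e / (C + 1))) => //= h hh hn0.
  have : `|h| < Num.min 1 (e / (C + 1)) by move: hh; rewrite /= sub0r normrN.
  rewrite lt_min => /andP[h1 h2].
  have -> : pexp q 0 = 0 by rewrite /pexp ltxx.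
  rewrite sub0r normrN subr0 /= addr0 [h *: 1]mulr1 /GRing.scale /= normrM normfV.
  have hp : 0 < `|h| by rewrite normr_gt0.
  rewrite mulrC ler_pdivrMr //.
  apply: le_trans (hC h (ltW h1)) _.
  rewrite -(real_normK (num_real h)) expr2 mulrA ler_pM2r //.
  have C1 : 0 < C + 1 by lra.
  move: h2; rewrite ltr_pdivlMr // => h2.
  have : C * `|h| <= `|h| * (C + 1) by rewrite mulrDr mulr1 mulrC lerDl ltW.
  lra.
split; first by apply/cvg_ex; exists 0.
by rewrite /derive; apply/cvg_lim.
Qed.

End bump1.

Section bump.
Context {R : realType} {d : nat}.
Local Notation V := 'rV[R]_d.
Implicit Types (x y v : V).

(** The multiples of such functions, over all [q], form a class stable under [partial]; in a
    direction other than [j] the multiple is 0. *)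
Lemma smooth_pexp_coor (q : {poly R}) (j : 'I_d) (a c : R) :
  smooth (fun x : V => pexp q (a * x ord0 j + c)).
Proof.
apply: (@smooth_ind R d (fun h => exists k q, h = fun x : V => k * pexp q (a * x ord0 j + c))); last first.
  by exists 1, q; apply/funext => x; rewrite mul1r.
move=> _ [k [{}q ->]].
have dp i x : is_derive x (delta_mx ord0 i : V) (fun x : V => k * pexp q (a * x ord0 j + c))
   ((k * (a * (i == j)%:R)) * pexp ('X ^+ 2 * (q - q^`())) (a * x ord0 j + c)).
  have dl : is_derive (0 : R) (1 : R) (fun s : R => k * pexp q (a * (x + s *: (delta_mx ord0 i : V)) ord0 j + c))
    ((k * (a * (i == j)%:R)) * pexp ('X ^+ 2 * (q - q^`())) (a * x ord0 j + c)).
    have -> : (fun s : R => k * pexp q (a * (x + s *: (delta_mx ord0 i : V)) ord0 j + c)) =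
      (fun s : R => k *: pexp q ((a * (i == j)%:R) *: s + (a * x ord0 j + c))).
      apply/funext => s; congr (k * pexp q _).
      by rewrite !mxE eqxx /= eq_sym /GRing.scale /=; ring.
    have dA : is_derive (0 : R) (1 : R) (fun s : R => (a * (i == j)%:R) *: s + (a * x ord0 j + c)) (a * (i == j)%:R).
      have := is_deriveD (is_deriveZ (a * (i == j)%:R) (is_derive_id (0 : R) (1 : R))) (is_derive_cst (a * x ord0 j + c) (0 : R) (1 : R)).
      by move=> h; apply: is_derive_eq h _; rewrite addr0 [_ *: 1]mulr1.
    have := is_derive1_comp (is_derive_pexp q _) dA => h.
    apply: is_derive_eq (is_deriveZ k h) _.
    by rewrite scaler0 add0r /GRing.scale /=; ring.
  have := @is_derive_line R d (fun x : V => k * pexp q (a * x ord0 j + c)) x (delta_mx ord0 i) 0 _ dl.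
  by rewrite scale0r addr0.
split; last first.
  move=> i; split; first by move=> x; have [] := dp i x.
  exists (k * (a * (i == j)%:R)), ('X ^+ 2 * (q - q^`())).
  by apply/funext => x; have [_ <-] := dp i x.
have cp : continuous (pexp q).
  by move=> t; apply: differentiable_continuous; apply/derivable1_diffP; have [] := is_derive_pexp q t.
move=> x.
have cx : (fun x : V => x ord0 j) @ (x : V) --> (x : V) ord0 j by exact: coord_continuous.
exact: (cvgM (cvg_cst k) (cvg_comp _ _ (cvgD (cvgM (cvg_cst a) cx) (cvg_cst c)) (cp _))).
Qed.

(** A product over the coordinates, so that for [0 < r] it is positive exactly on a cube, which is
    the ball of the sup norm. *)
Definition box_bump (r : R) x : R :=
  \prod_(j < d) (pexp 1 (r + x ord0 j) * pexp 1 (r - x ord0 j)).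

Lemma smooth_box_bump r : smooth (box_bump r).
Proof.
apply: smooth_prod => j; apply: smoothM.
  by under eq_fun do rewrite addrC -[_ ord0 j]mul1r; exact: smooth_pexp_coor.
by under eq_fun do rewrite addrC -[_ ord0 j]mul1r -mulNr; exact: smooth_pexp_coor.
Qed.

Lemma pexp1E (t : R) : pexp 1 t = if 0 < t then expR (- t^-1) else 0.
Proof. by rewrite /pexp hornerE mul1r. Qed.

Lemma pexp1_ge0 (t : R) : 0 <= pexp 1 t.
Proof. by rewrite pexp1E; case: ifP => // _; exact: expR_ge0. Qed.

Lemma box_bump_ge0 r x : 0 <= box_bump r x.
Proof. by apply: prodr_ge0 => j _; rewrite mulr_ge0 ?pexp1_ge0. Qed.

Lemma box_bump_gt0 r x : ball 0 r x -> 0 < box_bump r x.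
Proof.
move=> /[dup] -[r0 _]; rewrite ball_rVE // => h; apply: prodr_gt0 => j _.
have := h j; rewrite mxE /ball /= sub0r normrN ltr_norml => /andP[h1 h2].
have A : 0 < r + x ord0 j by rewrite -ltrBlDl sub0r.
by rewrite !pexp1E A subr_gt0 h2 mulr_gt0 ?expR_gt0.
Qed.

Lemma box_bump_eq0 r x : ~ ball 0 r x -> 0 < r -> box_bump r x = 0.
Proof.
move=> nb r0.
have [j hj] : exists j, ~ ball 0 r (x ord0 j).
  apply: contrapT => h; apply: nb; rewrite ball_rVE // => j; rewrite mxE.
  by apply: contrapT => h'; apply: h; exists j.
rewrite /box_bump (bigD1 j) //= !pexp1E.
move: hj; rewrite /ball /= sub0r normrN ltr_norml => /negP; rewrite negb_and -!leNgt.
case/orP => h; clear nb.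
  by rewrite (_ : (0 < r + x ord0 j) = false) ?mul0r //; apply/negbTE; rewrite -leNgt; lra.
by rewrite (_ : (0 < r - x ord0 j) = false) ?mulr0 ?mul0r //; apply/negbTE; rewrite -leNgt; lra.
Qed.

End bump.

(** * Mollification *)

Section convolution.
Context {R : realType} {d : nat}.
Variable mu : {sigma_finite_measure set 'rV[R]_d -> \bar R}.
Hypothesis hmu : haar mu.
Local Notation V := 'rV[R]_d.
Implicit Types (x y z : V) (p : R) (f g rho : V -> R) (i : 'I_d).
Local Notation e_ i := (delta_mx ord0 i : V).

Definition cball x (r : R) : set V := [set y | `|y - x| <= r].

Lemma compact_cball x (r : R) : compact (cball x r).
Proof.
apply: bounded_closed_compact.
  exists (`|x| + r); split; first exact: num_real.
  move=> M hM y /= hy; apply: le_trans (ltW hM); rewrite -[y](subrK x).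
  by apply: le_trans (ler_normD _ _) _; rewrite addrC lerD2l.
rewrite (_ : cball x r = (fun y => `|y - x|) @^-1` [set t | t <= r]) //.
apply: preimage_closed; last exact: closed_le.
move=> y _; move: y; apply/continuous_rVP => y e e0; exists e => // z ze.
by apply: le_lt_trans (ler_dist_dist _ _) _; rewrite opprB addrA subrK addrAC subrr add0r.
Qed.

Lemma isLp1_integrable g : isLp mu 1 g <-> mu.-integrable setT (EFin \o g).
Proof.
have E : pint mu 1 g = (\int[mu]_x `|g x|%:E)%E.
  by rewrite pintE; apply: eq_integral => x _; rewrite powRr1.
split=> [[mg]|gi].
  by rewrite E => goo; apply/integrableP; split=> //; exact/measurable_EFinP.
by split; [exact: integrable_EFin_measurable gi|rewrite E; exact: integrable_nintegral].
Qed.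

Lemma bounded_isLp p f (M : R) (A : set V) : 0 < p -> 0 <= M -> measurable_fun setT f ->
  measurable A -> (mu A < +oo)%E -> (forall x, `|f x| <= M) ->
  (forall x, ~ A x -> f x = 0) -> isLp mu p f.
Proof.
move=> p0 M0 mf mA Aoo fM fA.
apply: (isLp_le (g := \1_A) (ltW p0) M0 mf).
  move=> x; rewrite indicE; have [Ax|nA] := pselect (A x).
    by rewrite mem_set // normr1 mulr1.
  by rewrite fA // memNset // !normr0 mulr0.
split=> //; rewrite pintE (_ : (fun x => _) = (fun x => (\1_A x)%:E)).
  by rewrite integral_indic // setIT.
apply/funext => x; rewrite indicE; case: (_ \in _); first by rewrite normr1 powR1.
by rewrite normr0 powR0 // gt_eqF.
Qed.

Lemma compact_measure_fin (K : set V) : compact K -> (mu K < +oo)%E.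
Proof.
move=> cK; have [M [_ hM]] := compact_bounded cK.
apply: le_lt_trans (haar_ball_fin hmu 0 (`|M| + 2)).
apply: le_measure; rewrite ?inE.
- exact: measurable_compact_rV.
- exact: measurable_ball_rV.
- move=> x Kx; rewrite -ball_normE /= sub0r normrN.
  have : M < `|M| + 1 by rewrite (le_lt_trans (ler_norm M)) // ltrDl.
  by move=> /hM/(_ x Kx) /le_lt_trans; apply; rewrite ltrD2l ltr1n.
Qed.

Lemma compact_supp_isLp p f (K : set V) : 0 < p -> continuous f -> compact K ->
  (forall x, ~ K x -> f x = 0) -> isLp mu p f.
Proof.
move=> p0 cf cK f0; have [M M0 fM] := continuous_compact_supp_bounded cf cK f0.
apply: (bounded_isLp p0 (ltW M0) _ (measurable_compact_rV cK) (compact_measure_fin cK) fM f0).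
exact: continuous_measurable_rV.
Qed.

Record mollifier (r : R) rho : Prop := Mollifier {
  molli_smooth : smooth rho ;
  molli_ge0 : forall x, 0 <= rho x ;
  molli_supp : forall x, ~ cball 0 r x -> rho x = 0 ;
  molli_int : (\int[mu]_x (rho x)%:E = 1)%E }.

Lemma mollifier_exists (r : R) : 0 < r -> exists rho, mollifier r rho.
Proof.
move=> r0.
have sb := @smooth_box_bump R d r.
have mb := smooth_measurable sb.
have b0 x : ~ cball 0 r x -> box_bump r x = 0.
  move=> nb; apply: box_bump_eq0 => // xr; apply: nb; move: xr.
  by rewrite -ball_normE /cball /= sub0r subr0 normrN => /ltW.
have /isLp1_integrable bi := compact_supp_isLp ltr01 (smooth_continuous sb) (@compact_cball 0 r) b0.
have Ioo : (\int[mu]_x (box_bump r x)%:E < +oo)%E.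
  apply: le_lt_trans (integrable_nintegral bi); apply: le_nintegral => //.
    exact: measurableT_comp.
  by move=> x; rewrite box_bump_ge0 ler_norm.
(* Were the integral zero, the bump would vanish almost everywhere, whereas it is positive on a ball
   of positive measure. *)
have I0 : (0 < \int[mu]_x (box_bump r x)%:E)%E.
  rewrite lt0e integral_ge0 ?andbT; last by move=> x _; rewrite lee_fin box_bump_ge0.
  apply/eqP => h.
  have h' : (\int[mu]_x `|(box_bump r x)%:E| = 0)%E.
    by rewrite -h; apply: eq_integral => x _; rewrite /= ger0_norm // box_bump_ge0.
  have := (ae_eq_integral_abs mu measurableT ((measurable_EFinP _ _).2 mb)).1 h'.
  move=> [N [mN N0 hN]].
  have := haar_ball_gt0 hmu 0 r0; rewrite ltNge => /negP; apply.
  rewrite -N0; apply: le_measure; rewrite ?inE //; first exact: measurable_ball_rV.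
  apply: subset_trans hN => x /box_bump_gt0 bx /= /(_ I) [] E.
  by rewrite E ltxx in bx.
pose I := fine (\int[mu]_x (box_bump r x)%:E)%E.
have EI : (\int[mu]_x (box_bump r x)%:E = I%:E)%E by rewrite /I fineK // ge0_fin_numE // ltW.
have Ip : 0 < I by rewrite -lte_fin -EI.
exists (fun x => I^-1 * box_bump r x); split.
- exact: smoothZ.
- by move=> x; rewrite mulr_ge0 ?box_bump_ge0 // invr_ge0 ltW.
- by move=> x /b0->; rewrite mulr0.
- rewrite nintegralZ ?EI ?invr_ge0 ?ltW //; last by move=> x; exact: box_bump_ge0.
  by rewrite -EFinM mulVf // gt_eqF.
Qed.

(** The kernel is reflected compared with a convolution: [y |-> rho (y - x)] is then directly a test
    function, and differentiating in [x] gives minus the integral against [partial i rho], as in the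
    definition of a weak gradient. *)
Definition mollify rho g x : R := \int[mu]_y (g y * rho (y - x)).

Lemma measurable_shiftN f x : measurable_fun setT f -> measurable_fun setT (fun y => f (y - x)).
Proof. exact: measurable_trans. Qed.

Lemma conv_integrable rho g (M : R) x : measurable_fun setT rho -> (forall y, `|rho y| <= M) ->
  mu.-integrable setT (EFin \o g) ->
  mu.-integrable setT (EFin \o (fun y => g y * rho (y - x))).
Proof.
move=> mrho rM gi; have mg := integrable_EFin_measurable gi.
apply: (le_integrable _ _ _ (integrableZl measurableT M (integrable_norm gi))) => //.
  by apply/measurable_EFinP; apply: measurable_funM => //; exact: measurable_shiftN.
move=> y _ /=; rewrite lee_fin normrM normrM normr_id mulrC.
by rewrite ler_wpM2r // (le_trans (rM _)) // ler_norm.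
Qed.

Lemma conv_shift rho g x z : measurable_fun setT rho -> measurable_fun setT g ->
  mollify rho g (x + z) = \int[mu]_y (g (y + z) * rho (y - x)).
Proof.
move=> mrho mg; rewrite /mollify.
rewrite -(Rintegral_trans hmu z (f := fun y => g y * rho (y - (x + z)))); last first.
  by apply: measurable_funM => //; exact: measurable_shiftN.
by apply: eq_Rintegral => y _; rewrite opprD addrACA subrr addr0.
Qed.

(** Moving [x] by [z] amounts to translating [g], so this follows from continuity of translations in
    L^1 and the bound on the kernel. *)
Lemma conv_continuous rho g (M : R) : measurable_fun setT rho -> (forall y, `|rho y| <= M) ->
  mu.-integrable setT (EFin \o g) -> continuous (mollify rho g).
Proof.
move=> mrho rM gi; have mg := integrable_EFin_measurable gi.
have M0 : 0 <= M by apply: le_trans (rM 0).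
apply/continuous_rVP => x e e0.
have M1 : 0 < M + 1 by rewrite ltr_wpDl.
have e1 : 0 < e / (M + 1) / 2 by rewrite !divr_gt0.
have [r r0 hr] := isLp_trans_cont hmu ltr01 ((isLp1_integrable g).2 gi) e1.
exists r => // z zr.
have gzi : mu.-integrable setT (EFin \o trans z g) by exact: integrable_trans.
rewrite conv_shift // /mollify -RintegralB //; last 2 first.
- exact: (conv_integrable x mrho rM gzi).
- exact: (conv_integrable x mrho rM gi).
rewrite -lte_fin.
apply: (@le_lt_trans _ _ (\int[mu]_y ((M + 1) * `|g (y + z) - g y|)%:E)%E).
  apply: le_abs_Rintegral.
  - apply: measurable_funB; apply: measurable_funM; try exact: measurable_shiftN => //.
      exact: measurable_trans.
    by [].
  - apply: measurable_funM => //; apply: measurableT_comp => //.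
    by apply: measurable_funB => //; exact: measurable_trans.
  - move=> y; rewrite -mulrBl normrM mulrC ler_wpM2r //.
    by apply: le_trans (rM _) _; rewrite lerDl.
rewrite nintegralZ ?ltW //; last first.
  by apply: measurableT_comp => //; apply: measurable_funB => //; exact: measurable_trans.
have := hr z zr; rewrite pintE.
rewrite (_ : (\int[mu]_x0 (`|g (x0 + z) - g x0| `^ 1)%:E = \int[mu]_x0 `|g (x0 + z) - g x0|%:E)%E); last first.
  by apply: eq_integral => y _; rewrite powRr1.
move=> h; apply: (@le_lt_trans _ _ ((M + 1)%:E * (e / (M + 1) / 2)%:E)%E).
  by apply: lee_wpmul2l => //; rewrite lee_fin ltW.
rewrite -EFinM lte_fin (_ : (M + 1) * (e / (M + 1) / 2) = e / 2); last by field; rewrite gt_eqF.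
by rewrite ltr_pdivrMr // ltr_pMr // ltr1n.
Qed.

Lemma is_derive_quadratic f x v (D C : R) :
  (forall h : R, `|f (x + h *: v) - f x - h * D| <= C * h ^+ 2) -> is_derive x v f D.
Proof.
move=> H.
have C0 : 0 <= C.
  have := H 1; rewrite expr1n mulr1; exact: le_trans.
have L : (fun h : R => h^-1 *: ((f \o shift x) (h *: v) - f x)) @ 0^' --> D.
  apply/cvgrPdist_le => e e0.
  have E0 : 0 < e / (C + 1) by rewrite divr_gt0 // ltr_wpDl.
  exists (e / (C + 1)) => //= h hh hn0.
  have {hh} : `|h| < e / (C + 1) by move: hh; rewrite /= sub0r normrN.
  rewrite ltr_pdivlMr ?ltr_wpDl // => hh.
  have hp : 0 < `|h| by rewrite normr_gt0.
  rewrite /GRing.scale /= distrC [_ *: v + x]addrC.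
  rewrite (_ : _ - D = h^-1 * (f (x + h *: v) - f x - h * D)); last first.
    by rewrite [RHS]mulrBr mulKf.
  rewrite normrM normfV mulrC ler_pdivrMr //.
  apply: le_trans (H h) _.
  rewrite -(real_normK (num_real h)) expr2 mulrA ler_pM2r //.
  apply: le_trans (ltW hh); rewrite mulrDr mulr1 mulrC lerDl //.
split; first by apply/cvg_ex; exists D.
by rewrite /derive; apply/cvg_lim.
Qed.

(** Differentiation under the integral: the second order Taylor bound of the kernel is uniform, so
    integrating it against [|g|] leaves a quadratic remainder, from which the derivative can be read
    off. *)
Lemma conv_taylor rho g i (M : R) x (h : R) : smooth rho ->
  (exists2 K, compact K & forall y, ~ K y -> rho y = 0) ->
  (forall y, `|partial i (partial i rho) y| <= M) ->
  mu.-integrable setT (EFin \o g) ->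
  `|mollify rho g (x + h *: e_ i) - mollify rho g x - h * - mollify (partial i rho) g x| <=
    (M * \int[mu]_y `|g y|) * h ^+ 2.
Proof.
move=> srho [K cK rho0] rM gi; have mg := integrable_EFin_measurable gi.
have [M0 _ rM0] := smooth_bounded srho cK rho0.
have srho' := smooth_partial i srho.
have rho0' := partial_compl_eq0 i (compact_rV_closed cK) rho0.
have [M1 _ rM1] := smooth_bounded srho' cK rho0'.
have mr := smooth_measurable srho; have mr' := smooth_measurable srho'.
have I1 := conv_integrable (x + h *: e_ i) mr rM0 gi.
have I2 := conv_integrable x mr rM0 gi.
have I3 := conv_integrable x mr' rM1 gi.
have -> : mollify rho g (x + h *: e_ i) - mollify rho g x - h * - mollify (partial i rho) g x =
  \int[mu]_y ((g y * rho (y - (x + h *: e_ i)) - g y * rho (y - x)) +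
     h * (g y * partial i rho (y - x))).
  rewrite mulrN opprK RintegralD ?RintegralB ?RintegralZl //.
  - exact: integrable_subr.
  - exact: integrable_mulrl.
have gi' : mu.-integrable setT (EFin \o (fun y => `|g y|)) by exact: (integrable_norm gi).
rewrite mulrAC -RintegralZl // -lee_fin -nintegral_Rintegral; last exact: integrable_mulrl.
apply: le_abs_Rintegral.
- apply: measurable_funD.
    by apply: measurable_funB; apply: measurable_funM => //; exact: measurable_shiftN.
  apply: measurable_funM => //; apply: measurable_funM => //; exact: measurable_shiftN.
- by apply: measurable_funM => //; exact: measurableT_comp.
move=> y.
have := smooth_taylor (y - x) (- h) srho rM.
rewrite sqrrN scaleNr => hT.
rewrite (_ : _ + _ = g y * (rho (y - x - h *: e_ i) - rho (y - x) - - h * partial i rho (y - x))).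
  by rewrite normrM mulrC ler_wpM2r.
by rewrite opprD addrA; ring.
Qed.

Lemma is_derive_conv rho g i x : smooth rho ->
  (exists2 K, compact K & forall y, ~ K y -> rho y = 0) ->
  mu.-integrable setT (EFin \o g) ->
  is_derive x (e_ i) (mollify rho g) (- mollify (partial i rho) g x).
Proof.
move=> srho hK gi; have [K cK rho0] := hK.
have rho0' := partial_compl_eq0 i (compact_rV_closed cK) rho0.
have rho0'' := partial_compl_eq0 i (compact_rV_closed cK) rho0'.
have [M _ rM] := smooth_bounded (smooth_partial i (smooth_partial i srho)) cK rho0''.
apply: is_derive_quadratic => h.
exact: conv_taylor.
Qed.

Lemma partial_conv rho g i : smooth rho ->
  (exists2 K, compact K & forall y, ~ K y -> rho y = 0) ->
  mu.-integrable setT (EFin \o g) ->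
  partial i (mollify rho g) = (fun x => - mollify (partial i rho) g x).
Proof.
by move=> srho hK gi; apply/funext => x; have [_ <-] := is_derive_conv i x srho hK gi.
Qed.

Lemma smooth_conv rho g : smooth rho ->
  (exists2 K, compact K & forall y, ~ K y -> rho y = 0) ->
  mu.-integrable setT (EFin \o g) -> smooth (mollify rho g).
Proof.
move=> srho [K cK rho0] gi.
apply: (@smooth_ind R d (fun h => exists rho, [/\ smooth rho, forall y, ~ K y -> rho y = 0
   & h = mollify rho g])); last by exists rho.
move=> _ [{srho rho0}rho [srho rho0 ->]].
have hK : exists2 K, compact K & forall y, ~ K y -> rho y = 0 by exists K.
split.
  have [M _ rM] := smooth_bounded srho cK rho0.
  exact: conv_continuous (smooth_measurable srho) rM gi.
move=> i; split; first by move=> x; have [] := is_derive_conv i x srho hK gi.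
(* The sign produced by differentiating in [x] is put into the kernel, so the result is again a
   mollification. *)
exists (fun x => (-1) * partial i rho x); split.
- exact/smoothZ/smooth_partial.
- by move=> y nK; rewrite (partial_compl_eq0 i (compact_rV_closed cK) rho0 nK) mulr0.
- rewrite (partial_conv i srho hK gi); apply/funext => x.
  have [M _ rM] := smooth_bounded (smooth_partial i srho) cK (partial_compl_eq0 i (compact_rV_closed cK) rho0).
  have I3 := conv_integrable x (smooth_measurable (smooth_partial i srho)) rM gi.
  transitivity (\int[mu]_y (- 1 * (g y * partial i rho (y - x)))).
    by rewrite RintegralZl // mulN1r.
  by apply: eq_Rintegral => y _; ring.
Qed.

End convolution.

(** * Convergence of mollifications in L^p *)

Section approximation.
Context {R : realType} {d : nat}.
Variable mu : {sigma_finite_measure set 'rV[R]_d -> \bar R}.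
Hypothesis hmu : haar mu.
Local Notation V := 'rV[R]_d.
Implicit Types (x y z : V) (p q : R) (f g rho : V -> R) (i : 'I_d).

Lemma mollifier_supp (r : R) rho : mollifier mu r rho ->
  exists2 K : set V, compact K & forall y, ~ K y -> rho y = 0.
Proof. by move=> h; exists (cball 0 r); [exact: compact_cball|exact: molli_supp h]. Qed.

Lemma mollifier_bounded (r : R) rho : mollifier mu r rho ->
  exists M : R, forall y, `|rho y| <= M.
Proof.
move=> h; have [M _ hM] := smooth_bounded (molli_smooth h) (@compact_cball _ _ 0 r) (molli_supp h).
by exists M.
Qed.

Lemma mollifier_smooth_conv (r : R) rho g : mollifier mu r rho ->
  mu.-integrable setT (EFin \o g) -> smooth (mollify mu rho g).
Proof.
move=> h gi; apply: smooth_conv => //; [exact: molli_smooth h|exact: mollifier_supp h].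
Qed.

Lemma conv_subE (r : R) rho g x : mollifier mu r rho ->
  mu.-integrable setT (EFin \o g) ->
  mollify mu rho g x - g x = \int[mu]_z (rho z * (g (x + z) - g x)).
Proof.
move=> h gi; have mg := integrable_EFin_measurable gi.
have mr := smooth_measurable (molli_smooth h).
have [M rM] := mollifier_bounded h.
have ri : mu.-integrable setT (EFin \o rho).
  apply: nintegral_integrable => //; first exact: molli_ge0 h.
  by rewrite (molli_int h) ltry.
have r1 : \int[mu]_z rho z = 1 by rewrite /Rintegral (molli_int h).
have I0 := conv_integrable 0 mr rM (integrable_trans hmu x gi).
rewrite -{1}[x]add0r conv_shift //.
rewrite -[g x in LHS]mulr1 -r1 -RintegralZl // -RintegralB //.
- by apply: eq_Rintegral => z _; rewrite subr0 [z + x]addrC; ring.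
- exact: integrable_mulrl.
Qed.

(** Since [rho] has mass 1, the error at [x] is the [rho]-average of [g (x + z) - g x]. Jensen's
    inequality and Tonelli's theorem bound the integral of its p-th power by an average over
    [|z| <= r] of translation defects, each at most [e]. *)
Lemma conv_approx p q g (e : R) : 0 < p -> 0 < q -> p^-1 + q^-1 = 1 ->
  isLp mu p g -> mu.-integrable setT (EFin \o g) -> 0 < e ->
  exists2 r0 : R, 0 < r0 & forall r rho, r < r0 -> mollifier mu r rho ->
    (pint mu p (fun x => mollify mu rho g x - g x)%R <= e%:E)%E.
Proof.
move=> p0 q0 pq gp gi e0; have mg := integrable_EFin_measurable gi.
have [r0 r00 hr0] := isLp_trans_cont hmu p0 gp e0.
exists r0 => // r rho rr0 h.
have mr := smooth_measurable (molli_smooth h).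
pose F (z : V * V) : \bar R := (rho z.2 * `|g (z.1 + z.2) - g z.1| `^ p)%:E.
have mF : measurable_fun setT F.
  apply/measurable_EFinP; apply: measurable_funM.
    exact: (measurableT_comp mr measurable_snd).
  apply: measurable_abs_powR; apply: measurable_funB.
    exact: (measurableT_comp mg measurable_add_rV).
  exact: (measurableT_comp mg measurable_fst).
have F0 (z : V * V) : (0 <= F z)%E by rewrite lee_fin mulr_ge0 ?powR_ge0 ?(molli_ge0 h).
have mcg : measurable_fun setT (fun x => mollify mu rho g x - g x).
  by apply: measurable_funB => //; exact: smooth_measurable (mollifier_smooth_conv h gi).
rewrite pintE; apply: (@le_trans _ _ (\int[mu]_x \int[mu]_z F (x, z))%E).
  apply: ge0_le_integral => //.
  - by apply/measurable_EFinP; exact: measurable_abs_powR.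
  - exact: measurable_fun_fubini_tonelli_F.
  - move=> x _; rewrite (conv_subE x h gi).
    apply: (jensen_powR p0 q0 pq) => //; last exact: molli_int h.
    + apply: measurable_funB => //.
      by under eq_fun do rewrite addrC; exact: measurable_trans.
    + exact: molli_ge0 h.
rewrite fubini_tonelli //.
apply: (@le_trans _ _ (\int[mu]_z (e * rho z)%:E)%E); last first.
  rewrite (nintegralZ mu (ltW e0) mr (molli_ge0 h)).
  by rewrite (molli_int h) mule1.
apply: ge0_le_integral => //.
- by move=> z _; apply: integral_ge0 => x _; exact: F0.
- exact: measurable_fun_fubini_tonelli_G.
- by apply/measurable_EFinP; exact: measurable_funM.
move=> z _; rewrite /F /=.
have m1 : measurable_fun setT (fun x => `|g (x + z) - g x| `^ p).
  by apply: measurable_abs_powR; apply: measurable_funB => //; exact: measurable_trans.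
rewrite nintegralZ ?(molli_ge0 h) //.
have [zr|zr] := pselect (cball 0 r z); last first.
  by rewrite (molli_supp h zr) mul0e mulr0.
rewrite mulrC EFinM; apply: lee_wpmul2l; first by rewrite lee_fin (molli_ge0 h).
rewrite -pintE; apply: hr0; move: zr; rewrite /cball /= subr0 => /le_lt_trans; exact.
Qed.

Lemma mollifier_shift_test (r : R) rho (Omega : set V) x : mollifier mu r rho ->
  cball x r `<=` Omega -> test_function Omega (fun y => rho (y - x)).
Proof.
move=> h xO; apply: (@test_functionI _ _ _ (cball x r)) => //.
- exact: smooth_shift (molli_smooth h).
- exact: compact_cball.
- by move=> y hy; apply: (molli_supp h); rewrite /cball /= subr0.
Qed.

Lemma restrict_Rintegral (Omega K0 K : set V) f phi : K `<=` K0 -> K0 `<=` Omega ->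
  (forall y, ~ K y -> phi y = 0) ->
  \int[mu]_(y in Omega) (f y * phi y) = \int[mu]_y ((f \_ K0) y * phi y).
Proof.
move=> KK0 K0O phi0; rewrite Rintegral_mkcond; apply: eq_Rintegral => y _.
(* Off [K] both integrands vanish, the default value [point] taken off [Omega] being 0 in [R]. *)
rewrite /patch; have [Ky|nK] := pselect (K y).
  by rewrite !mem_set //; [exact: KK0|exact/K0O/KK0].
rewrite phi0 // !mulr0; have -> : (point : R) = 0 by [].
by case: (y \in Omega).
Qed.

End approximation.

Section weak_gradient_conv.
Context {R : realType} {d : nat}.
Local Notation mu := (@lebesgue_rV R d).
Local Notation V := 'rV[R]_d.

(** The translated kernel is supported in a ball inside [K0]: it is an admissible test function and
    does not see the truncation to [K0]. The two minus signs cancel. *)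
Lemma partial_conv_weak (r : R) rho (Omega K0 : set V) (u : V -> R) (Du : V -> V) x i :
  mollifier mu r rho -> weak_gradient Omega u Du ->
  cball x r `<=` K0 -> K0 `<=` Omega ->
  mu.-integrable setT (EFin \o (u \_ K0)) ->
  partial i (mollify mu rho (u \_ K0)) x = mollify mu rho ((fun y => Du y ord0 i) \_ K0) x.
Proof.
move=> h wg xK K0O ui; have hmu := haar_lebesgue_rV R d.
rewrite (partial_conv i (molli_smooth h) (mollifier_supp h) ui).
have tphi := mollifier_shift_test h (subset_trans xK K0O).
have phi0 y : ~ cball x r y -> rho (y - x) = 0.
  by move=> hy; apply: (molli_supp h); rewrite /cball /= subr0.
have := wg _ tphi i; rewrite partial_shift.
have phi1 y : ~ cball x r y -> partial i rho (y - x) = 0.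
  move=> ny; have := partial_compl_eq0 i (compact_rV_closed (@compact_cball R d x r)) phi0 ny.
  by rewrite partial_shift.
rewrite (@restrict_Rintegral R d mu Omega K0 (cball x r) u _ xK K0O phi1).
rewrite (@restrict_Rintegral R d mu Omega K0 (cball x r) (fun y => Du y ord0 i) _ xK K0O phi0).
by rewrite /mollify => ->; rewrite opprK.
Qed.

End weak_gradient_conv.

(** * Difference quotients *)

Section finite_jensen.
Context {R : realType}.

(** Jensen for the uniform measure on [n] points, proved as for integrals by Young's inequality at
    the mean [B]. *)
Lemma sum_powR_le (p q : R) n (b : 'I_n -> R) : 0 < p -> 0 < q -> p^-1 + q^-1 = 1 ->
  (forall j, 0 <= b j) ->
  (\sum_j b j) `^ p <= n%:R `^ (p - 1) * \sum_j b j `^ p.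
Proof.
move=> p0 q0 pq b0.
case: n b b0 => [|n] b b0.
  by rewrite !big_ord0 powR0 ?gt_eqF // mulr0.
set N : R := n.+1%:R; have N0 : 0 < N by rewrite ltr0n.
set S := \sum_j b j; have S0 : 0 <= S by apply: sumr_ge0.
set B := S / N; have B0 : 0 <= B by rewrite divr_ge0 // ltW.
have SE : S = N * B by rewrite /B mulrC divfK // gt_eqF.
have [S00|Sn0] := eqVneq B 0.
  rewrite SE S00 mulr0 powR0 ?gt_eqF // mulr_ge0 ?powR_ge0 // sumr_ge0 // => j _.
  exact: powR_ge0.
have BB : B * B `^ (p / q) = B `^ p.
  rewrite -{1}(powRr1 B0) -powRD; last by rewrite Sn0 implybT.
  congr (_ `^ _); have -> : 1 + p / q = p * (p^-1 + q^-1) by rewrite mulrDr divff ?gt_eqF.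
  by rewrite pq mulr1.
have h : S * B `^ (p / q) <= p^-1 * \sum_j b j `^ p + N * (B `^ p / q).
  rewrite mulr_suml mulr_sumr.
  have -> : N * (B `^ p / q) = \sum_(j < n.+1) (B `^ p / q).
    by rewrite sumr_const card_ord -mulr_natl.
  rewrite -big_split /=; apply: ler_sum => j _.
  have := conjugate_powR (b0 j) (powR_ge0 B (p / q)) p0 q0 pq.
  by rewrite -powRrM -[p / q * q]mulrA mulVf ?gt_eqF // mulr1 [_ / p]mulrC.
have key : N * B `^ p <= \sum_j b j `^ p.
  move: h; rewrite {1}SE -mulrA BB.
  have -> : q^-1 = 1 - p^-1 by rewrite -pq; ring.
  set X := B `^ p; set Y := \sum_j _ => h.
  have : p^-1 * (N * X) <= p^-1 * Y by lra.
  by rewrite ler_pM2l // invr_gt0.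
rewrite SE powRM ?(ltW N0) //.
have -> : N `^ p = N `^ (p - 1) * N.
  rewrite -{3}(powRr1 (ltW N0)) -powRD; last by rewrite (gt_eqF N0) implybT.
  by congr (_ `^ _); ring.
by rewrite -mulrA ler_wpM2l ?powR_ge0.
Qed.

End finite_jensen.

Section difference_quotient.
Context {R : realType} {d : nat}.
Variable mu : {sigma_finite_measure set 'rV[R]_d -> \bar R}.
Hypothesis hmu : haar mu.
Local Notation V := 'rV[R]_d.
Implicit Types (x y z : V) (p q h : R) (f g u rho : V -> R) (i : 'I_d).
Local Notation e_ i := (delta_mx ord0 i : V).

Definition tau h i f : V -> R := fun x => f (x + h *: e_ i) - f x.

Lemma measurable_tau h i f : measurable_fun setT f -> measurable_fun setT (tau h i f).
Proof. by move=> mf; apply: measurable_funB => //; exact: measurable_trans. Qed.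

Lemma pint_tau p h i f : 0 <= p -> measurable_fun setT f ->
  (pint mu p (tau h i f) <= (2 `^ p)%:E * (pint mu p f + pint mu p f))%E.
Proof.
move=> p0 mf.
apply: le_trans (pintD mu p0 (measurable_trans (h *: e_ i) mf) (measurableT_comp (@oppr_measurable _ _) mf)) _.
by rewrite pint_trans // (pintN mu p f).
Qed.

Lemma isLp_tau p h i f : 0 <= p -> isLp mu p f -> isLp mu p (tau h i f).
Proof. by move=> p0 fp; apply: isLpB => //; exact: isLp_trans. Qed.

Lemma tau_telescope u (delta : R) i x n :
  tau (n%:R * delta) i u x = \sum_(j < n) tau delta i u (x + (j%:R * delta) *: e_ i).
Proof.
elim: n => [|n IH]; first by rewrite big_ord0 /tau mul0r scale0r addr0 subrr.
rewrite big_ord_recr /= -IH /tau.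
have -> : x + (n.+1%:R * delta) *: e_ i = x + (n%:R * delta) *: e_ i + delta *: e_ i.
  by rewrite -addrA -scalerDl -natr1 mulrDl mul1r.
by rewrite addrC subrKA.
Qed.

(* [g] is the weak i-th partial derivative of [u] inside [K0], expressed through
   mollifications instead of test functions. *)
Definition local_weak_partial (K0 : set V) i u g :=
  forall r rho x, mollifier mu r rho -> cball x r `<=` K0 ->
  partial i (mollify mu rho u) x = mollify mu rho g x.

Lemma norm_delta i (c : R) : `|c *: e_ i| <= `|c|.
Proof.
rewrite normrZ -[leRHS]mulr1 ler_wpM2l //.
rewrite [leLHS]mx_normrE; apply/bigmax_leP; split=> //= -[a b] _.
by rewrite /= mxE; case: (_ && _); rewrite ?normr1 ?normr0.
Qed.

Lemma inner_cball (K0 : set V) (s r t : R) i x : inner K0 s x -> `|t| + r < s ->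
  cball (x + t *: e_ i) r `<=` K0.
Proof.
move=> xs trs y yr; apply: xs; rewrite -ball_normE /=.
apply: le_lt_trans trs; rewrite distrC -[y - x](subrKA (x + t *: e_ i)).
apply: le_trans (ler_normD _ _) _; rewrite addrC lerD //.
by rewrite addrAC subrr add0r norm_delta.
Qed.

(** A discrete form of integrating the derivative along the segment: it is cut into [n] steps and
    each increment is replaced by its first order Taylor term. The remainders add up to at most [h],
    which produces the term with [mu (inner K0 s)]. *)
Lemma pint_tau_smooth p q (K0 : set V) i u g (s r h : R) rho : 0 < p -> 0 < q ->
  p^-1 + q^-1 = 1 -> compact K0 ->
  mu.-integrable setT (EFin \o u) -> mu.-integrable setT (EFin \o g) ->
  local_weak_partial K0 i u g -> mollifier mu r rho -> r < s / 2 -> 0 < h < s / 2 ->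
  (pint mu p (fun x => \1_(inner K0 s) x * tau h i (mollify mu rho u) x)%R <=
   (2 `^ p * h `^ p)%:E * (pint mu p (mollify mu rho g) + mu (inner K0 s)))%E.
Proof.
move=> p0 q0 pq cK ui gi wp mrho rs /andP[h0 hs].
have s0 : 0 < s by lra.
set U := mollify mu rho u; set G := mollify mu rho g; set K := inner K0 s.
have mK : measurable K by apply: measurable_closed_rV; exact: closed_inner.
have sU : smooth U by exact: mollifier_smooth_conv mrho ui.
have sG : smooth G by exact: mollifier_smooth_conv mrho gi.
have mU := smooth_measurable sU; have mG := smooth_measurable sG.
have [M hM] : exists M : R, forall x (t : R), `|U (x + t *: e_ i) - U x - t * partial i U x| <= M * t ^+ 2.
  have [C cC rho0] := mollifier_supp mrho.
  have cl := compact_rV_closed cC.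
  have rho1 := partial_compl_eq0 i cl rho0; have rho2 := partial_compl_eq0 i cl rho1.
  have [M _ rM] := smooth_bounded (smooth_partial i (smooth_partial i (molli_smooth mrho))) cC rho2.
  exists (M * \int[mu]_y `|u y|) => x t.
  rewrite (partial_conv i (molli_smooth mrho) (mollifier_supp mrho) ui).
  exact: (conv_taylor _ _ (molli_smooth mrho) (mollifier_supp mrho) rM ui).
(* [n] exceeds [|M| h], so the remainder [M dl^2] of one step is at most [dl]. Thus [M], which
   depends on [rho], disappears from the bound. *)
pose n := (Num.truncn (`|M| * h)).+1.
have n0 : 0 < n%:R :> R by rewrite ltr0n.
pose dl := h / n%:R.
have dl0 : 0 < dl by rewrite divr_gt0.
have hE : h = n%:R * dl by rewrite /dl mulrC divfK // gt_eqF.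
have Mdl : `|M| * dl <= 1.
  by rewrite /dl mulrA ler_pdivrMr // mul1r; exact/ltW/truncnS_gt.
pose T x := \sum_(j < n) dl * `|G (x + (j%:R * dl) *: e_ i)|.
have mT : measurable_fun setT T.
  apply: measurable_sum => j; apply: measurable_funM => //.
  by apply: measurableT_comp => //; exact: measurable_trans.
have T0 x : 0 <= T x by apply: sumr_ge0 => j _; rewrite mulr_ge0 // ltW.
have m1 : measurable_fun setT (fun x => \1_K x * tau h i U x).
  by apply: measurable_funM => //; exact: measurable_tau.
have m2 : measurable_fun setT (fun x => h * \1_K x) by exact: measurable_funM.
have bound x : `|\1_K x * tau h i U x| <= 1 * `|T x + h * \1_K x|.
  rewrite mul1r [leRHS]ger0_norm; last by rewrite addr_ge0 // mulr_ge0 // ltW.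
  rewrite indicE; have [Kx|nK] := pselect (K x); last first.
    by rewrite memNset // mul0r normr0 mulr0 addr0.
  rewrite mem_set // mul1r mulr1 {1}hE tau_telescope.
  apply: le_trans (ler_norm_sum _ _ _) _.
  have -> : h = \sum_(j < n) dl by rewrite sumr_const card_ord -mulr_natl.
  rewrite -big_split /=; apply: ler_sum => j _.
  set y := x + _.
  have yK : cball y r `<=` K0.
    apply: (inner_cball Kx); rewrite (ger0_norm (mulr_ge0 (ler0n _ _) (ltW dl0))).
    have : j%:R * dl <= h by rewrite [leRHS]hE; apply: ler_wpM2r; [exact: ltW|rewrite ler_nat ltnW].
    lra.
  have := hM y dl; rewrite (wp _ _ _ mrho yK) -/G => hT.
  have hT2 : M * dl ^+ 2 <= dl.
    rewrite expr2 mulrA; apply: le_trans (_ : 1 * dl <= _); last by rewrite mul1r.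
    rewrite ler_wpM2r ?(ltW dl0) //; apply: le_trans Mdl.
    by rewrite ler_wpM2r ?(ltW dl0) // ler_norm.
  rewrite -(subrK (dl * G y) (tau dl i U y)).
  apply: le_trans (ler_normD _ _) _; rewrite [leRHS]addrC.
  by apply: lerD; [exact: le_trans hT hT2|rewrite normrM gtr0_norm].
apply: le_trans (le_pint mu (ltW p0) ler01 m1 (measurable_funD mT m2) bound) _.
rewrite powR1 mul1e.
apply: le_trans (pintD mu (ltW p0) mT m2) _.
rewrite EFinM -muleA; apply: lee_wpmul2l; first by rewrite lee_fin powR_ge0.
rewrite ge0_muleDr ?pint_ge0 //; apply: leeD.
  have m3 (j : 'I_n) : measurable_fun setT (fun x => `|G (x + (j%:R * dl) *: e_ i)| `^ p).
    by apply: measurable_abs_powR; exact: measurable_trans.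
  rewrite pintE.
  (* Jensen over the [n] steps, then translation invariance: [dl^p n^(p-1)] times [n] copies of the
     integral of [|G|^p] is [h^p] times that integral. *)
  apply: (@le_trans _ _ (\int[mu]_x ((dl `^ p * n%:R `^ (p - 1)) *
      \sum_(j < n) `|G (x + (j%:R * dl) *: e_ i)| `^ p)%:E)%E).
    apply: le_nintegral; first exact: measurable_abs_powR.
      by apply: measurable_funM => //; exact: measurable_sum.
    move=> x; rewrite powR_ge0 /= ger0_norm // /T -mulr_sumr.
    rewrite powRM ?(ltW dl0) //; last by apply: sumr_ge0.
    rewrite -mulrA ler_wpM2l ?powR_ge0 //.
    exact: (sum_powR_le p0 q0 pq).
  rewrite nintegralZ ?mulr_ge0 ?powR_ge0 //; last 2 first.
  - exact: measurable_sum.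
  - by move=> x; apply: sumr_ge0 => j _; exact: powR_ge0.
  have -> : (\int[mu]_x (\sum_(j < n) `|G (x + (j%:R * dl) *: e_ i)| `^ p)%:E =
     n%:R%:E * pint mu p G)%E.
    under eq_integral do rewrite -sumEFin.
    rewrite ge0_integral_sum //; last by move=> j; apply/measurable_EFinP; exact: m3.
    under eq_bigr => j _ do rewrite -(pintE mu p (trans _ G)) pint_trans //.
    by rewrite sumr_const card_ord mule_natl.
  rewrite muleA -EFinM le_eqVlt; apply/orP; left; apply/eqP; congr (_ %:E * _)%E.
  rewrite [in RHS]hE powRM ?(ltW n0) ?(ltW dl0) // [RHS]mulrC -mulrA; congr (_ * _).
  rewrite -{2}(powRr1 (ltW n0)) -powRD; last by rewrite (gt_eqF n0) implybT.
  by congr (_ `^ _); ring.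
rewrite (_ : pint mu p (fun x => h * \1_K x) = ((h `^ p)%:E * mu K)%E) // pintE.
rewrite (_ : (fun x => _) = (fun x => (h `^ p * \1_K x)%:E)).
  by rewrite nintegralZ ?powR_ge0 // integral_indic // setIT.
apply/funext => x; rewrite indicE; case: (_ \in _).
  by rewrite !mulr1 gtr0_norm.
by rewrite !mulr0 normr0 powR0 // gt_eqF.
Qed.

(** The estimate is transferred from mollifications. Their radius may depend on [h], so [u] can be
    approximated up to [h^p], while the constant only involves [p], the size of [g] and the measure
    of the inset. *)
Lemma tau_bound p q (K0 : set V) i u g (s : R) : 0 < p -> 0 < q ->
  p^-1 + q^-1 = 1 -> compact K0 -> 0 < s ->
  isLp mu p u -> isLp mu p g ->
  mu.-integrable setT (EFin \o u) -> mu.-integrable setT (EFin \o g) ->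
  local_weak_partial K0 i u g ->
  exists2 C : R, 0 <= C & forall h, 0 < h < s / 2 ->
  (pint mu p (fun x => \1_(inner K0 s) x * tau h i u x)%R <= (C * h `^ p)%:E)%E.
Proof.
move=> p0 q0 pq cK s0 up gp ui gi wp.
have mK : measurable (inner K0 s) by apply: measurable_closed_rV; exact: closed_inner.
have Koo : mu (inner K0 s) \is a fin_num.
  rewrite ge0_fin_numE //; apply: le_lt_trans (compact_measure_fin hmu cK).
  by apply: le_measure; rewrite ?inE //; [exact: measurable_compact_rV|exact: inner_sub].
pose a := fine (mu (inner K0 s)); pose b := fine (pint mu p g).
have a0 : 0 <= a by rewrite fine_ge0.
have b0 : 0 <= b by rewrite fine_ge0 // pint_ge0.
have P0 : 0 < 2 `^ p :> R by rewrite powR_gt0.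
exists (2 `^ p * (2 `^ p * (2 `^ p * (1 + b) + a) + 2 `^ p * 2)).
  by rewrite !(mulr_ge0, addr_ge0) // ltW.
move=> h /andP[h0 hs].
have hp0 : 0 < h `^ p by rewrite powR_gt0.
have [r1 r10 H1] := conv_approx hmu p0 q0 pq up ui hp0.
have [r2 r20 H2] := conv_approx hmu p0 q0 pq gp gi ltr01.
pose r := Num.min (s / 2) (Num.min r1 r2) / 2.
have m0 : 0 < Num.min (s / 2) (Num.min r1 r2) by rewrite !lt_min r10 r20 divr_gt0.
have r0 : 0 < r by rewrite divr_gt0.
have rlt : r < Num.min (s / 2) (Num.min r1 r2) by rewrite /r ltr_pdivrMr // ltr_pMr // ltr1n.
move: rlt; rewrite !lt_min => /and3P[rs rr1 rr2].
have [rho mrho] := mollifier_exists hmu r0.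
have {}H1 := H1 r rho rr1 mrho; have {}H2 := H2 r rho rr2 mrho.
have mu' := up.1; have mg := gp.1.
set U := mollify mu rho u in H1 *; set G := mollify mu rho g in H2 *.
have mU : measurable_fun setT U := smooth_measurable (mollifier_smooth_conv hmu mrho ui).
have mG : measurable_fun setT G := smooth_measurable (mollifier_smooth_conv hmu mrho gi).
have GB : (pint mu p G <= (2 `^ p * (1 + b))%:E)%E.
  rewrite (_ : G = (fun x => (G x - g x) + g x)); last by apply/funext => x; rewrite subrK.
  apply: le_trans (pintD mu (ltW p0) (measurable_funB mG mg) mg) _.
  rewrite EFinM; apply: lee_wpmul2l; first by rewrite lee_fin ltW.
  rewrite EFinD; apply: leeD => //.
  by rewrite /b fineK // isLp_fin.
have S := pint_tau_smooth p0 q0 pq cK ui gi wp mrho rs _ (h := h).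
have {}S := S (introT andP (conj h0 hs)); rewrite -/U -/G in S.
have mdU : measurable_fun setT (fun x => U x - u x) by exact: measurable_funB.
have mt : measurable_fun setT (fun x => \1_(inner K0 s) x * tau h i U x).
  by apply: measurable_funM => //; exact: measurable_tau.
have mt2 : measurable_fun setT (fun x => - (\1_(inner K0 s) x * tau h i (fun x => U x - u x) x)).
  by apply: measurableT_comp => //; apply: measurable_funM => //; exact: measurable_tau.
have -> : (fun x => \1_(inner K0 s) x * tau h i u x) =
  (fun x => \1_(inner K0 s) x * tau h i U x + - (\1_(inner K0 s) x * tau h i (fun x => U x - u x) x)).
  by apply/funext => x; rewrite /tau; ring.
apply: le_trans (pintD mu (ltW p0) mt mt2) _.
rewrite -mulrA EFinM; apply: lee_wpmul2l; first by rewrite lee_fin ltW.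
rewrite mulrDl EFinD; apply: leeD.
  apply: le_trans S _.
  apply: (@le_trans _ _ ((2 `^ p * h `^ p)%:E * ((2 `^ p * (1 + b))%:E + a%:E))%E).
    apply: lee_wpmul2l; first by rewrite lee_fin mulr_ge0 // ltW.
    by apply: leeD => //; rewrite /a fineK.
  by rewrite -EFinD -EFinM lee_fin mulrAC.
rewrite pintN.
apply: (@le_trans _ _ (pint mu p (tau h i (fun x => U x - u x)))).
  rewrite -[leRHS]mul1e -[1%E](_ : (1 `^ p)%:E = _); last by rewrite powR1.
  apply: le_pint => //; first exact: ltW.
  - by apply: measurable_funM => //; exact: measurable_tau.
  - exact: measurable_tau.
  - move=> x; rewrite mul1r normrM ler_piMl // indicE.
    by case: (_ \in _); rewrite ?normr1 ?normr0.
apply: le_trans (pint_tau h i (ltW p0) mdU) _.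
rewrite -mulrA EFinM; apply: lee_wpmul2l; first by rewrite lee_fin ltW.
by rewrite mulr_natl mulr2n EFinD; apply: leeD.
Qed.

End difference_quotient.

(** * The Caccioppoli inequality *)

Section real_inequalities.
Context {R : realType}.
Implicit Types (m p s t r : R).

Lemma powR_pred_mul m s : 0 < m -> 0 <= s -> s `^ (m - 1) * s = s `^ m.
Proof.
move=> m0 s0; have [->|sn0] := eqVneq s 0; first by rewrite mulr0 powR0 // gt_eqF.
rewrite -{2}(powRr1 s0) -powRD; last by rewrite sn0 implybT.
by congr (_ `^ _); ring.
Qed.

(** Convexity of the power, obtained from Young's inequality for [t] and [s^(m-1)] with exponents
    [m] and [m/(m-1)]. *)
Lemma powR_tangent m s t : 1 <= m -> 0 <= s -> 0 <= t ->
  s `^ m - t `^ m <= m * s `^ (m - 1) * (s - t).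
Proof.
move=> m1 s0 t0; have m0 : 0 < m by lra.
have [->|mn1] := eqVneq m 1.
  by rewrite !powRr1 // subrr powRr0 !mul1r.
have m1' : 0 < m - 1 by rewrite subr_gt0 lt_neqAle eq_sym mn1.
have q0 : 0 < m / (m - 1) by rewrite divr_gt0.
have pq : m^-1 + (m / (m - 1))^-1 = 1.
  by field; rewrite !gt_eqF.
have := conjugate_powR t0 (powR_ge0 s (m - 1)) m0 q0 pq.
rewrite -powRrM (_ : (m - 1) * (m / (m - 1)) = m); last by field; rewrite gt_eqF.
move=> /(ler_wpM2l (ltW m0)).
rewrite [m * (_ + _)](_ : _ = t `^ m + (m - 1) * s `^ m); last by field; rewrite !gt_eqF.
have := powR_pred_mul m0 s0.
set a := s `^ (m - 1); set b := s `^ m; set e := t `^ m => <- h.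
rewrite -subr_ge0 in h; rewrite -subr_ge0.
by apply: le_trans h _; rewrite le_eqVlt; apply/orP; left; apply/eqP; ring.
Qed.

Lemma powR_half_split m s : 0 <= s -> 1 <= m -> s `^ (2 * m - 1) = s `^ (m - 1) * s `^ m.
Proof.
move=> s0 m1; have [->|sn0] := eqVneq s 0.
  have h1 : 2 * m - 1 != 0 by rewrite gt_eqF //; lra.
  have h2 : m != 0 by rewrite gt_eqF //; lra.
  by rewrite (powR0 h1) (powR0 h2) mulr0.
by rewrite -powRD ?sn0 ?implybT //; congr (_ `^ _); ring.
Qed.

(** For [b <= a], bound one factor [a^m - b^m] by the tangent inequality and use [a^(m-1) (a^m -
    b^m) <= a^(2m-1) - b^(2m-1)]. It is applied with [m = p/2]. *)
Lemma powR_sub_sqr_le m s t : 1 <= m -> 0 <= s -> 0 <= t ->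
  (s `^ m - t `^ m) ^+ 2 <= m * ((s `^ (2 * m - 1) - t `^ (2 * m - 1)) * (s - t)).
Proof.
move=> m1.
have key a b : 0 <= b -> b <= a ->
    (a `^ m - b `^ m) ^+ 2 <= m * ((a `^ (2 * m - 1) - b `^ (2 * m - 1)) * (a - b)).
  move=> b0 ba; have a0 : 0 <= a by exact: le_trans ba.
  rewrite !powR_half_split //.
  have h1 := powR_tangent m1 a0 b0.
  have h2 : b `^ m <= a `^ m by apply: ge0_ler_powR; rewrite ?nnegrE //; lra.
  have h3 : b `^ (m - 1) <= a `^ (m - 1) by apply: ge0_ler_powR; rewrite ?nnegrE //; lra.
  have b1 := powR_ge0 b m; have a1 := powR_ge0 a (m - 1).
  move: h1 h2 h3 b1 a1; set x := a `^ m; set y := b `^ m.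
  set x' := a `^ (m - 1); set y' := b `^ (m - 1) => h1 h2 h3 b1 a1.
  have ab : 0 <= a - b by lra.
  apply: (@le_trans _ _ ((x - y) * (m * x' * (a - b)))).
    by rewrite expr2 ler_wpM2l // subr_ge0.
  rewrite (_ : (x - y) * (m * x' * (a - b)) = (m * (a - b)) * (x' * (x - y))); last by ring.
  rewrite [leRHS](_ : _ = (m * (a - b)) * (x' * x - y' * y)); last by ring.
  have y'x' : y' * y <= x' * y by rewrite ler_wpM2r.
  by rewrite ler_wpM2l ?mulr_ge0 //; lra.
move=> s0 t0; have [st|ts] := leP s t; last by apply: key => //; exact: ltW.
have := key t s s0 st.
rewrite (_ : (t `^ m - s `^ m) ^+ 2 = (s `^ m - t `^ m) ^+ 2); last by ring.
rewrite (_ : (t `^ (2 * m - 1) - s `^ (2 * m - 1)) * (t - s) =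
  (s `^ (2 * m - 1) - t `^ (2 * m - 1)) * (s - t)) //; by ring.
Qed.

(** For [b <= a], right side minus left side equals [a^(m-1) b^(m-1) (a - b)]. It expresses the
    cross term through the very quantity whose square is being estimated. *)
Lemma powR_sub_le m s t : 1 <= m -> 0 <= s -> 0 <= t ->
  `|s `^ (2 * m - 1) - t `^ (2 * m - 1)| <= (s `^ (m - 1) + t `^ (m - 1)) * `|s `^ m - t `^ m|.
Proof.
move=> m1.
have key a b : 0 <= b -> b <= a ->
   `|a `^ (2 * m - 1) - b `^ (2 * m - 1)| <= (a `^ (m - 1) + b `^ (m - 1)) * `|a `^ m - b `^ m|.
  move=> b0 ba; have a0 : 0 <= a by exact: le_trans ba.
  have h2 : b `^ m <= a `^ m by apply: ge0_ler_powR; rewrite ?nnegrE //; lra.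
  have h3 : b `^ (2 * m - 1) <= a `^ (2 * m - 1) by apply: ge0_ler_powR; rewrite ?nnegrE //; lra.
  rewrite !ger0_norm ?subr_ge0 // !powR_half_split //.
  have m0 : 0 < m by lra.
  rewrite -(powR_pred_mul m0 a0) -(powR_pred_mul m0 b0).
  have a1 := powR_ge0 a (m - 1); have b1 := powR_ge0 b (m - 1).
  move: a1 b1; set x := a `^ (m - 1); set y := b `^ (m - 1) => a1 b1.
  rewrite -subr_ge0 (_ : _ - _ = x * y * (a - b)); last by ring.
  by rewrite !mulr_ge0 // subr_ge0.
move=> s0 t0; have [st|ts] := leP s t; last by apply: key => //; exact: ltW.
by have := key t s s0 st; rewrite distrC [`|t `^ m - _|]distrC [t `^ (m - 1) + _]addrC.
Qed.

(** Replacing the smaller of [s] and [|r|] by the larger turns the product into a power [p/2]. *)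
Lemma powR_pred_sqr_le p s r : 2 <= p -> 0 <= s ->
  (s `^ (p / 2 - 1) * r) ^+ 2 <= s `^ p + `|r| `^ p.
Proof.
move=> p2 s0; have m0 : 0 <= p / 2 - 1 by lra.
have pE : p = 2 * (p / 2) by field.
have sq (a : R) : 0 <= a -> (a `^ (p / 2 - 1) * a) ^+ 2 = a `^ p.
  move=> a0; rewrite powR_pred_mul //; last by lra.
  by rewrite -(powR_mulrn 2 (powR_ge0 _ _)) -powRrM divfK.
have [sr|rs] := leP s `|r|.
  apply: (@le_trans _ _ (`|r| `^ p)); last by rewrite lerDr powR_ge0.
  rewrite -(sq `|r|) // exprMn [leRHS]exprMn [`|r| ^+ 2](real_normK (num_real r)).
  rewrite ler_wpM2r ?sqr_ge0 // ler_sqr ?nnegrE ?powR_ge0 //.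
  by apply: ge0_ler_powR; rewrite ?nnegrE.
apply: (@le_trans _ _ (s `^ p)); last by rewrite lerDl powR_ge0.
rewrite -(sq s) // !exprMn ler_wpM2l ?sqr_ge0 //.
by rewrite -(real_normK (num_real r)) ler_sqr ?nnegrE // ltW.
Qed.

(* [X] and [Y] absorb the cross term: 2 z g w P <= (z X)^2 / p + p (g w Y)^2. *)
Lemma caccioppoli_scalar p (a b s t z g w G h : R) (kap : bool) :
  s = Num.max a 0 -> t = Num.max b 0 ->
  2 <= p -> 0 < h -> `|g| <= G -> (~~ kap -> z = 0) ->
  (z * (s `^ (p / 2) - t `^ (p / 2))) ^+ 2 <=
  p * ((s `^ (p - 1) - t `^ (p - 1)) * (z ^+ 2 * (a - b) + 2 * z * g * w)) +
  kap%:R * (2 * p ^+ 2 * G ^+ 2 * h ^+ 2) * (s `^ p + t `^ p + 2 * `|w / h| `^ p).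
Proof.
move=> sE tE p2 h0 gG kz.
have s0 : 0 <= s by rewrite sE le_max lexx orbT.
have t0 : 0 <= t by rewrite tE le_max lexx orbT.
(* Where the cutoff vanishes both sides are 0, which is why the error may carry the indicator
   [kap]. *)
case: kap kz => [_|/(_ isT) ->]; last first.
  by rewrite mul0r expr0n /= !(mulr0, mul0r, addr0).
rewrite mul1r.
have m1 : 1 <= p / 2 by lra.
have pE : p - 1 = 2 * (p / 2) - 1 by field.
(* Truncation at 0 only helps: if [a] or [b] is not positive, [a - b] is at least as favourable as
   [s - t], because powers are monotone. *)
have mono : (s `^ (p - 1) - t `^ (p - 1)) * (s - t) <= (s `^ (p - 1) - t `^ (p - 1)) * (a - b).
  rewrite -subr_ge0 -mulrBr.
  have hm (x y : R) : 0 <= x -> x <= y -> x `^ (p - 1) <= y `^ (p - 1).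
    by move=> x0 xy; apply: ge0_ler_powR; rewrite ?nnegrE //; lra.
  rewrite sE tE; have [a0|a0] := leP a 0; have [b0|b0] := leP b 0.
  - by rewrite subrr mul0r.
  - by rewrite mulr_le0 ?subr_le0 //; [apply: hm => //; exact: ltW|lra].
  - by rewrite mulr_ge0 ?subr_ge0 //; [apply: hm => //; exact: ltW|lra].
  - by rewrite (_ : a - b - (a - b) = 0) ?mulr0 //; ring.
have I1 := powR_sub_sqr_le m1 s0 t0; rewrite -pE in I1.
have I2 := powR_sub_le m1 s0 t0; rewrite -pE in I2.
have J1 := powR_pred_sqr_le (w / h) p2 s0.
have J2 := powR_pred_sqr_le (w / h) p2 t0.
move: mono I1 I2 J1 J2.
set P := s `^ (p - 1) - t `^ (p - 1); set X := s `^ (p / 2) - t `^ (p / 2).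
set s1 := s `^ (p / 2 - 1); set t1 := t `^ (p / 2 - 1).
set sp := s `^ p; set tp := t `^ p; set wp := `|w / h| `^ p.
move=> mono I1 I2 J1 J2.
have G0 : 0 <= G by exact: le_trans gG.
have s10 : 0 <= s1 by exact: powR_ge0.
have t10 : 0 <= t1 by exact: powR_ge0.
have A1 : X ^+ 2 <= p / 2 * (P * (a - b)).
  apply: le_trans I1 _; rewrite ler_wpM2l //; lra.
have A2 : (z * X) ^+ 2 <= p / 2 * (P * (z ^+ 2 * (a - b))).
  rewrite exprMn (_ : p / 2 * _ = z ^+ 2 * (p / 2 * (P * (a - b)))); last by ring.
  by rewrite ler_wpM2l ?sqr_ge0.
set Y := (s1 + t1) * `|w| * G.
have Y0 : 0 <= Y by rewrite !mulr_ge0 ?addr_ge0.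
have A3 : - (`|z * X| * Y) <= P * (z * g * w).
  apply: (@le_trans _ _ (- `|P * (z * g * w)|)); last by rewrite lerNl -normrN ler_norm.
  rewrite lerN2 !normrM (_ : `|z| * `|X| * Y = ((s1 + t1) * `|X|) * (`|z| * G * `|w|)); last by rewrite /Y; ring.
  by rewrite ler_pM // ?mulr_ge0 // ler_wpM2r // ler_wpM2l.
have A4 : Y ^+ 2 <= (2 * (sp + tp + 2 * wp)) * (G ^+ 2 * h ^+ 2).
  have -> : Y ^+ 2 = ((s1 + t1) * (w / h)) ^+ 2 * (G ^+ 2 * h ^+ 2).
    rewrite /Y !exprMn (real_normK (num_real w)) exprVn; field.
    by rewrite gt_eqF.
  apply: ler_wpM2r; first exact: mulr_ge0 (sqr_ge0 _) (sqr_ge0 _).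
  have := sqr_ge0 (s1 * (w / h) - t1 * (w / h)).
  move: J1 J2; rewrite mulrDl; set u1 := s1 * _; set u2 := t1 * _; nra.
(* The factor [p] is twice the [p/2] of [A2]: one copy of the square is the claim, the other pays
   for the cross term. *)
rewrite (_ : p * (P * _) = 2 * (p / 2 * (P * (z ^+ 2 * (a - b)))) + p * (2 * (P * (z * g * w)))); last by field.
have p0 : 0 < p by lra.
have A5' : p * (2 * (`|z * X| * Y)) <= (z * X) ^+ 2 + p ^+ 2 * Y ^+ 2.
  rewrite -(real_normK (num_real (z * X))); move: (`|z * X|) => u.
  rewrite -subr_ge0 (_ : _ - _ = (u - p * Y) ^+ 2) ?sqr_ge0 //; by ring.
have A3' : - (p * (2 * (`|z * X| * Y))) <= p * (2 * (P * (z * g * w))).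
  by rewrite -mulrN -mulrN ler_pM2l // ler_pM2l.
have A4' : p ^+ 2 * Y ^+ 2 <= 2 * p ^+ 2 * G ^+ 2 * h ^+ 2 * (sp + tp + 2 * wp).
  apply: le_trans (ler_wpM2l (sqr_ge0 p) A4) _.
  by rewrite le_eqVlt; apply/orP; left; apply/eqP; ring.
move: A2 A3' A4' A5'.
set Q0 := (z * X) ^+ 2; set Q1 := p / 2 * _; set Q2 := p * (2 * (P * _)).
set Q3 := p * _; set Q4 := p ^+ 2 * _; set Q5 := _ * (sp + _ + _); lra.
Qed.

End real_inequalities.

Section caccioppoli_vector.
Context {R : realType} {d N : nat}.
Variables (v : 'I_N -> 'rV[R]_d) (delta c : 'I_N -> R) (p : R).
Implicit Types (A B Z x y : 'rV[R]_d).

Definition excess (k : 'I_N) x : R := Num.max (dotv x (v k) - delta k * c k) 0.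

Lemma excess_ge0 k x : 0 <= excess k x.
Proof. by rewrite le_max lexx orbT. Qed.

Lemma F_coor x j : F v delta c p x ord0 j = \sum_k excess k x `^ (p - 1) * v k ord0 j.
Proof. by rewrite /F summxE; apply: eq_bigr => k _; rewrite /F_k mxE. Qed.

(** Each [F_k] points along [v k], so exchanging the sums over [j] and [k] leaves components along
    [v k], and the scalar inequality applies for each [k]. In use, [A] and [B] are the gradients at
    [x + h e_i] and [x], [Z] is the gradient of the cutoff and [w] the difference of [u]. *)
Lemma caccioppoli_pointwise A B Z (z w G h : R) (kap : bool) :
  2 <= p -> 0 < h -> (forall k, `|dotv Z (v k)| <= G) -> (~~ kap -> z = 0) ->
  \sum_k (z * (excess k A `^ (p / 2) - excess k B `^ (p / 2))) ^+ 2 <=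
  p * \sum_j (F v delta c p A ord0 j - F v delta c p B ord0 j) *
      (z ^+ 2 * (A ord0 j - B ord0 j) + 2 * z * Z ord0 j * w) +
  kap%:R * (2 * p ^+ 2 * G ^+ 2 * h ^+ 2) *
    \sum_k (excess k A `^ p + excess k B `^ p + 2 * `|w / h| `^ p).
Proof.
move=> p2 h0 ZG kz.
have -> : \sum_j (F v delta c p A ord0 j - F v delta c p B ord0 j) *
      (z ^+ 2 * (A ord0 j - B ord0 j) + 2 * z * Z ord0 j * w) =
  \sum_k (excess k A `^ (p - 1) - excess k B `^ (p - 1)) *
    (z ^+ 2 * ((dotv A (v k) - delta k * c k) - (dotv B (v k) - delta k * c k))
      + 2 * z * dotv Z (v k) * w).
  under eq_bigr => j _ do rewrite !F_coor -sumrB mulr_suml.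
  rewrite exchange_big /=; apply: eq_bigr => k _.
  rewrite (_ : _ - _ - (_ - _) = dotv A (v k) - dotv B (v k)); last by ring.
  rewrite /dotv -sumrB !mulr_sumr mulr_suml -big_split /= mulr_sumr.
  by apply: eq_bigr => j _; ring.
rewrite !mulr_sumr -big_split /=; apply: ler_sum => k _.
exact: caccioppoli_scalar.
Qed.

End caccioppoli_vector.

Section small_sequences.
Context {dT} {T : measurableType dT} {R : realType}.
Variable mu : {measure set T -> \bar R}.
Implicit Types (p q : R) (b c : nat -> T -> R).

Definition small p b := (forall n, measurable_fun setT (b n)) /\
  forall e : R, 0 < e -> \forall n \near \oo, (pint mu p (b n) <= e%:E)%E.

Lemma small_le p b c (C : R) : 0 <= p -> 0 <= C -> (forall n, measurable_fun setT (c n)) ->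
  (forall n x, `|c n x| <= C * `|b n x|) -> small p b -> small p c.
Proof.
move=> p0 C0 mc cb [mb sb]; split => // e e0.
have C1 : 0 < C `^ p + 1 by rewrite ltr_wpDl // powR_ge0.
apply: filterS (sb _ (divr_gt0 e0 C1)) => n h.
apply: le_trans (le_pint mu p0 C0 (mc n) (mb n) (cb n)) _.
apply: (@le_trans _ _ ((C `^ p)%:E * (e / (C `^ p + 1))%:E)%E).
  by apply: lee_wpmul2l => //; rewrite lee_fin powR_ge0.
rewrite -EFinM lee_fin mulrA ler_pdivrMr // mulrC ler_pM2l //.
by rewrite lerDl.
Qed.

Lemma pairing_cvg p q a b (l : T -> R) : 0 < p -> 0 < q -> p^-1 + q^-1 = 1 ->
  isLp mu q a -> (forall n, isLp mu p (b n)) -> isLp mu p l ->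
  small p (fun n x => b n x - l x) ->
  \int[mu]_x (a x * b n x) @[n --> \oo] --> \int[mu]_x (a x * l x).
Proof.
move=> p0 q0 pq aq bp lp [mbl sbl]; have qp : q^-1 + p^-1 = 1 by rewrite addrC.
apply/cvgrPdist_le => e e0.
have [eta eta0 H] := mul_pint_small q0 p0 qp aq e0.
apply: filterS (sbl _ eta0) => n h.
rewrite distrC -RintegralB //; last 2 first.
- exact: (isLp_mul_integrable q0 p0 qp aq (bp n)).
- exact: (isLp_mul_integrable q0 p0 qp aq lp).
rewrite -lee_fin; apply: le_trans (H _ (mbl n) h).
apply: le_abs_Rintegral.
- have [ma _] := aq; have [mb _] := bp n; have [ml _] := lp.
  by apply: measurable_funB; apply: measurable_funM.
- have [ma _] := aq; apply: measurableT_comp => //; exact: measurable_funM.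
- by move=> x; rewrite -mulrBr.
Qed.

Lemma Rintegral_sum n (F : 'I_n -> T -> R) :
  (forall j, mu.-integrable setT (EFin \o F j)) ->
  mu.-integrable setT (EFin \o (fun x => \sum_j F j x)) /\
  \int[mu]_x (\sum_j F j x) = \sum_j \int[mu]_x F j x.
Proof.
elim: n F => [|n IH] F iF.
  split; last by rewrite big_ord0; under eq_Rintegral do rewrite big_ord0; rewrite /Rintegral integral0.
  by rewrite (_ : _ \o _ = cst 0%E); [exact: integrable0|apply/funext => x /=; rewrite big_ord0].
have [i1 i2] := IH (fun j => F (lift ord0 j)) (fun j => iF (lift ord0 j)).
have E : (fun x => \sum_j F j x) = (fun x => F ord0 x + \sum_j F (lift ord0 j) x).
  by apply/funext => x; rewrite big_ord_recl.
rewrite E; split; first exact: integrable_addr.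
by rewrite RintegralD // i2 big_ord_recl.
Qed.

Lemma cvg_sum_ord n (F : 'I_n -> nat -> R) (l : 'I_n -> R) :
  (forall j, F j k @[k --> \oo] --> l j) -> \sum_j F j k @[k --> \oo] --> \sum_j l j.
Proof.
elim: n F l => [|n IH] F l cF.
  by under eq_fun do rewrite big_ord0; rewrite big_ord0; exact: cvg_cst.
under eq_fun do rewrite big_ord_recl; rewrite big_ord_recl.
by apply: cvgD; [exact: cF|exact: IH].
Qed.

End small_sequences.

(** * The equation satisfied by differences *)

Section translated_equation.
Context {R : realType} {d : nat}.
Variable mu : {sigma_finite_measure set 'rV[R]_d -> \bar R}.
Hypothesis hmu : haar mu.
Local Notation V := 'rV[R]_d.
Implicit Types (x y z : V) (h : R) (rho : V -> R) (i : 'I_d).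
Local Notation e_ i := (delta_mx ord0 i : V).

Lemma small_tau p h i b : 0 <= p -> small mu p b -> small mu p (fun n => tau h i (b n)).
Proof.
move=> p0 [mb sb]; split; first by move=> n; exact: measurable_tau.
move=> e e0; have P0 : 0 < 2 `^ p :> R by rewrite powR_gt0.
have e1 : 0 < e / 2 / 2 `^ p by rewrite !divr_gt0.
apply: filterS (sb _ e1) => n h1.
apply: le_trans (pint_tau hmu h i p0 (mb n)) _.
apply: (@le_trans _ _ ((2 `^ p)%:E * ((e / 2 / 2 `^ p)%:E + (e / 2 / 2 `^ p)%:E))%E).
  by apply: lee_wpmul2l; [rewrite lee_fin ltW|exact: leeD].
rewrite -EFinD -EFinM lee_fin le_eqVlt; apply/orP; left; apply/eqP.
by field; rewrite gt_eqF.
Qed.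

Lemma small_mollify p q g (rho : nat -> V -> R) : 0 < p -> 0 < q -> p^-1 + q^-1 = 1 ->
  (forall n, mollifier mu n.+1%:R^-1 (rho n)) ->
  isLp mu p g -> mu.-integrable setT (EFin \o g) ->
  small mu p (fun n x => mollify mu (rho n) g x - g x).
Proof.
move=> p0 q0 pq mrho gp gi; split.
  move=> n; apply: measurable_funB; last by case: gp.
  exact: smooth_measurable (mollifier_smooth_conv hmu (mrho n) gi).
move=> e e0; have [r r0 H] := conv_approx hmu p0 q0 pq gp gi e0.
exists (Num.truncn r^-1) => // n /= nr; apply: H (mrho n).
rewrite -[ltRHS]invrK ltf_pV2 ?posrE ?invr_gt0 //.
by apply: lt_le_trans (truncnS_gt _) _; rewrite ler_nat.
Qed.

Variables (p q : R) (K0 : set V) (u f : V -> R) (g F : 'I_d -> V -> R).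
Hypotheses (p0 : 0 < p) (q0 : 0 < q) (pq : p^-1 + q^-1 = 1) (cK0 : compact K0).
Hypotheses (up : isLp mu p u) (ui : mu.-integrable setT (EFin \o u)).
Hypotheses (gp : forall j, isLp mu p (g j)) (gi : forall j, mu.-integrable setT (EFin \o g j)).
Hypotheses (Fq : forall j, isLp mu q (F j)) (fq : isLp mu q f).
Hypothesis wp : forall j, local_weak_partial mu K0 j u (g j).

(** Meant for functions extended by 0 off [K0]: integrals run over the whole space so that the
    equation can be translated. *)
Definition weak_equation := forall phi : V -> R, smooth phi ->
  (forall x, ~ K0 x -> phi x = 0) ->
  \sum_j \int[mu]_x (F j x * partial j phi x) = \int[mu]_x (f x * phi x).

Hypothesis eqn : weak_equation.

(** Test with [phi (x - h e_i)] and with [phi], subtract, and move the shift to the other factor by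
    translation invariance. As [h < s], the shifted test function still vanishes off [K0]. *)
Lemma weak_equation_tau (s h : R) i (phi : V -> R) : smooth phi -> 0 < h < s ->
  (forall x, ~ inner K0 s x -> phi x = 0) ->
  \sum_j \int[mu]_x (tau h i (F j) x * partial j phi x) =
  \int[mu]_x (tau h i f x * phi x).
Proof.
move=> sphi /andP[h0 hs] phi0; have s0 : 0 < s by exact: lt_trans hs.
have qp : q^-1 + p^-1 = 1 by rewrite addrC.
have cl := compact_rV_closed cK0.
have phi00 x : ~ K0 x -> phi x = 0.
  by move=> nK; apply: phi0 => xs; apply: nK; exact: (inner_sub s0 xs).
have Lphi : isLp mu p phi := compact_supp_isLp hmu p0 (smooth_continuous sphi) cK0 phi00.
have Ldphi j : isLp mu p (partial j phi).
  exact: (compact_supp_isLp hmu p0 (smooth_continuous (smooth_partial j sphi)) cK0 (partial_compl_eq0 j cl phi00)).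
have psi0 y : ~ K0 y -> phi (y + - (h *: e_ i)) = 0.
  move=> nK; apply: phi0 => ys; apply: nK; apply: ys.
  rewrite -ball_normE /= addrAC subrr add0r normrN.
  by apply: le_lt_trans (norm_delta _ _) _; rewrite ger0_norm // ltW.
have H1 := eqn sphi phi00.
have H2 := eqn (smooth_shift (- (h *: e_ i)) sphi) psi0.
have {}H2 : \sum_j \int[mu]_x (F j x * partial j phi (x + - (h *: e_ i))) =
    \int[mu]_x (f x * phi (x + - (h *: e_ i))).
  by rewrite -H2; apply: eq_bigr => j _; rewrite partial_shift.
have key (a b : V -> R) : isLp mu q a -> isLp mu p b ->
    \int[mu]_x (tau h i a x * b x) =
    \int[mu]_x (a x * b (x + - (h *: e_ i))) - \int[mu]_x (a x * b x).
  move=> La Lb; have [ma _] := La; have [mb _] := Lb.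
  rewrite -(Rintegral_trans hmu (h *: e_ i) (f := fun x => a x * b (x + - (h *: e_ i)))); last first.
    by apply: measurable_funM => //; exact: measurable_trans.
  under [X in _ = X - _]eq_Rintegral do rewrite addrK.
  rewrite -RintegralB //.
  - by apply: eq_Rintegral => x _; rewrite /tau mulrBl.
  - exact: (isLp_mul_integrable q0 p0 qp (isLp_trans hmu (h *: e_ i) La) Lb).
  - exact: (isLp_mul_integrable q0 p0 qp La Lb).
transitivity (\sum_j (\int[mu]_x (F j x * partial j phi (x + - (h *: e_ i))) -
    \int[mu]_x (F j x * partial j phi x))).
  by apply: eq_bigr => j _; exact: key.
rewrite sumrB; exact: (etrans (congr2 (fun a b : R => a - b) H2 H1) (esym (key f phi fq Lphi))).
Qed.

Lemma smooth_tau h i (w : V -> R) : smooth w -> smooth (tau h i w).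
Proof. by move=> sw; exact: smoothB (smooth_shift _ sw) sw. Qed.

Lemma isLp_mul_tau h i (a w : V -> R) (A : R) : measurable_fun setT a -> 0 <= A ->
  (forall x, `|a x| <= A) -> isLp mu p w -> isLp mu p (fun x => a x * tau h i w x).
Proof.
move=> ma A0 aA wL.
apply: (isLp_le (ltW p0) A0 _ _ (isLp_tau hmu h i (ltW p0) wL)).
  by apply: measurable_funM => //; apply: measurable_tau; case: wL.
by move=> x; rewrite normrM ler_wpM2r.
Qed.

Lemma small_mul_tau h i (a : V -> R) (A : R) b : measurable_fun setT a -> 0 <= A ->
  (forall x, `|a x| <= A) -> small mu p b -> small mu p (fun n x => a x * tau h i (b n) x).
Proof.
move=> ma A0 aA sb; apply: (small_le (ltW p0) A0 _ _ (small_tau h i (ltW p0) sb)).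
  by move=> n; apply: measurable_funM => //; apply: measurable_tau; case: sb.
by move=> n x; rewrite normrM ler_wpM2r.
Qed.

Lemma cutoff_pairing_cvg h i (a : V -> R) w W (F1 : V -> R) : smooth a ->
  (forall x, ~ K0 x -> a x = 0) -> isLp mu p w -> (forall n, smooth (W n)) ->
  small mu p (fun n x => W n x - w x) -> isLp mu q F1 ->
  \int[mu]_x (F1 x * (a x * tau h i (W n) x)) @[n --> \oo] -->
  \int[mu]_x (F1 x * (a x * tau h i w x)).
Proof.
move=> sa a0 wL sW sm F1q.
have [A A0 hA] := smooth_bounded sa cK0 a0.
have ma := smooth_measurable sa.
apply: (pairing_cvg p0 q0 pq F1q).
- move=> n; apply: (compact_supp_isLp hmu p0 _ cK0).
    exact: (smooth_continuous (smoothM sa (smooth_tau _ _ (sW n)))).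
  by move=> x /a0 ->; rewrite mul0r.
- exact: (isLp_mul_tau h i ma (ltW A0) hA wL).
- have -> : (fun n x => a x * tau h i (W n) x - a x * tau h i w x) =
     (fun n x => a x * tau h i (fun y => W n y - w y) x).
    by apply/funext => n; apply/funext => x; rewrite /tau; ring.
  exact: small_mul_tau ma (ltW A0) hA sm.
Qed.

(** Test with [zeta^2] times the difference of the mollified [u], which is smooth, and let the
    radius tend to 0: the differences of [u] and of its derivatives converge in L^p and are paired
    with fixed functions in L^q. *)
Lemma caccioppoli_equation (s h : R) i (zeta : V -> R) : smooth zeta -> 0 < h < s / 2 ->
  (forall x, ~ inner K0 s x -> zeta x = 0) ->
  \sum_j (\int[mu]_x (tau h i (F j) x * (zeta x * zeta x * tau h i (g j) x)) +
     \int[mu]_x (tau h i (F j) x * (2 * (zeta x * partial j zeta x) * tau h i u x))) =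
  \int[mu]_x (tau h i f x * (zeta x * zeta x * tau h i u x)).
Proof.
move=> sz /andP[h0 hs] z0; have s0 : 0 < s by lra.
have hs' : 0 < h < s by rewrite h0 /=; lra.
have cl := compact_rV_closed cK0.
have z00 x : ~ K0 x -> zeta x = 0.
  by move=> nK; apply: z0 => xs; apply: nK; exact: (inner_sub s0 xs).
have [rho mrho] := choice (fun n : nat => @mollifier_exists R d mu hmu n.+1%:R^-1 (eqbRL (invr_gt0 _) (ltr0Sn R n))).
have sU n : smooth (mollify mu (rho n) u) by exact: mollifier_smooth_conv (mrho n) ui.
have sG j n : smooth (mollify mu (rho n) (g j)) by exact: mollifier_smooth_conv (mrho n) (gi j).
have Uu := small_mollify p0 q0 pq mrho up ui.
have Gg j := small_mollify p0 q0 pq mrho (gp j) (gi j).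
have szz : smooth (fun x => zeta x * zeta x) by exact: smoothM.
have zz0 x : ~ K0 x -> zeta x * zeta x = 0 by move=> /z00 ->; rewrite mul0r.
have szd j : smooth (fun x => 2 * (zeta x * partial j zeta x)).
  exact: (smoothZ 2 (smoothM sz (smooth_partial j sz))).
have zd0 j x : ~ K0 x -> 2 * (zeta x * partial j zeta x) = 0.
  by move=> /z00 ->; rewrite mul0r mulr0.
have tF j := isLp_tau hmu h i (ltW q0) (Fq j).
have tf := isLp_tau hmu h i (ltW q0) fq.
have qp : q^-1 + p^-1 = 1 by rewrite addrC.
have cR := cutoff_pairing_cvg (h := h) (i := i) szz zz0 up sU Uu tf.
have c1 j := cutoff_pairing_cvg (h := h) (i := i) szz zz0 (gp j) (sG j) (Gg j) (tF j).
have c2 j := cutoff_pairing_cvg (h := h) (i := i) (szd j) (zd0 j) up sU Uu (tF j).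
have cL := cvg_sum_ord (fun j => cvgD (c1 j) (c2 j)).
(* For large [n] the sequences converging to the two sides coincide, hence so do their limits. *)
apply: (norm_cvg_unique (cL _)); apply: cvg_trans cR; apply: near_eq_cvg.
exists (Num.truncn (s / 2)^-1) => // n /= nr.
have rs : n.+1%:R^-1 < s / 2.
  rewrite -[ltRHS]invrK ltf_pV2 ?posrE ?invr_gt0 //; last by lra.
  by apply: lt_le_trans (truncnS_gt _) _; rewrite ler_nat.
have rs1 : n.+1%:R^-1 < s by apply: lt_trans rs _; lra.
have sphi : smooth (fun x => zeta x * zeta x * tau h i (mollify mu (rho n) u) x).
  exact: (smoothM szz (smooth_tau _ _ (sU n))).
have phi0 x : ~ inner K0 s x -> zeta x * zeta x * tau h i (mollify mu (rho n) u) x = 0.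
  by move=> /z0 ->; rewrite mul0r mul0r.
rewrite -(weak_equation_tau i sphi hs' phi0).
apply: eq_bigr => j _.
have L1 : isLp mu p (fun x => zeta x * zeta x * tau h i (mollify mu (rho n) (g j)) x).
  apply: (compact_supp_isLp hmu p0 _ cK0).
    exact: (smooth_continuous (smoothM szz (smooth_tau _ _ (sG j n)))).
  by move=> x /zz0 ->; rewrite mul0r.
have L2 : isLp mu p (fun x => 2 * (zeta x * partial j zeta x) * tau h i (mollify mu (rho n) u) x).
  apply: (compact_supp_isLp hmu p0 _ cK0).
    exact: (smooth_continuous (smoothM (szd j) (smooth_tau _ _ (sU n)))).
  by move=> x /(zd0 j) ->; rewrite mul0r.
rewrite -RintegralD //; last 2 first.
- exact: (isLp_mul_integrable q0 p0 qp (tF j) L1).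
- exact: (isLp_mul_integrable q0 p0 qp (tF j) L2).
apply: eq_Rintegral => x _; rewrite -mulrDr; congr (_ * _).
rewrite (partialM j szz (smooth_tau h i (sU n))) (partialM j sz sz).
rewrite /tau (partialB j (smooth_shift _ (sU n)) (sU n)) partial_shift.
(* Inside the inset, [h] and the radius are both below [s/2], so the balls about [x] and [x + h e_i]
   lie in [K0] and derivatives commute with mollification. *)
have [xK|/z0 ->] := pselect (inner K0 s x); last by rewrite !(mul0r, mulr0, addr0).
have x1 : cball x n.+1%:R^-1 `<=` K0.
  have := @inner_cball _ _ K0 s n.+1%:R^-1 0 i x xK.
  by rewrite scale0r addr0 normr0 add0r; exact.
have x2 : cball (x + h *: e_ i) n.+1%:R^-1 `<=` K0.
  by apply: (inner_cball xK); rewrite gtr0_norm // (splitr s) ltrD.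
rewrite (wp j (mrho n) x1) (wp j (mrho n) x2); ring.
Qed.

End translated_equation.

(** * Cutoff functions between two insets *)

Section cutoff.
Context {R : realType} {d : nat}.
Variable mu : {sigma_finite_measure set 'rV[R]_d -> \bar R}.
Hypothesis hmu : haar mu.
Local Notation V := 'rV[R]_d.

(** Mollify the indicator of the intermediate inset, of depth [2 s], with radius [s/2]: a ball of
    that radius misses this inset when centred outside [inner K0 s], and lies in it when centred at
    depth [3 s]. *)
Lemma cutoff_exists (K0 : set V) (s : R) : compact K0 -> 0 < s ->
  exists zeta : V -> R, [/\ smooth zeta, forall x, ~ inner K0 s x -> zeta x = 0,
    forall x, inner K0 (3 * s) x -> zeta x = 1 & forall x, `|zeta x| <= 1].
Proof.
move=> cK s0; have s20 : 0 < s / 2 by lra.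
have [rho mrho] := mollifier_exists hmu s20.
have s2 : 0 < 2 * s by lra.
have mA : measurable (inner K0 (2 * s)) by apply: measurable_closed_rV; exact: closed_inner.
have Aoo : (mu (inner K0 (2 * s)) < +oo)%E.
  apply: le_lt_trans (compact_measure_fin hmu cK); apply: le_measure; rewrite ?inE //.
    exact: measurable_compact_rV.
  exact: inner_sub.
have Ai : mu.-integrable setT (EFin \o (\1_(inner K0 (2 * s)) : V -> R)).
  apply/isLp1_integrable; apply: (bounded_isLp ltr01 ler01 _ mA Aoo).
  - exact: measurable_indic.
  - by move=> x; rewrite indicE; case: (_ \in _); rewrite ?normr1 ?normr0.
  - by move=> x nA; rewrite indicE memNset.
have ri : mu.-integrable setT (EFin \o rho).
  apply: nintegral_integrable.
  - exact: smooth_measurable (molli_smooth mrho).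
  - exact: molli_ge0 mrho.
  - by rewrite (molli_int mrho) ltry.
have rxi x : mu.-integrable setT (EFin \o (fun y => rho (y - x))).
  exact: (integrable_trans hmu (- x) ri).
have r1 x : \int[mu]_y rho (y - x) = 1.
  rewrite (Rintegral_trans hmu (- x) (smooth_measurable (molli_smooth mrho))).
  by rewrite /Rintegral (molli_int mrho).
have rho0 x y : ~ cball x (s / 2) y -> rho (y - x) = 0.
  by move=> h; apply: (molli_supp mrho); rewrite /cball /= subr0.
exists (mollify mu rho \1_(inner K0 (2 * s))); split.
- exact: (mollifier_smooth_conv hmu mrho Ai).
- move=> x nx; rewrite /mollify.
  under eq_Rintegral => y _.
    rewrite (_ : _ * _ = 0); first by over.
    have [yx|/rho0 ->] := pselect (cball x (s / 2) y); last by rewrite mulr0.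
    rewrite indicE memNset ?mul0r // => yA; apply: nx => z xz; apply: yA.
    move: xz yx; rewrite -!ball_normE /cball /= => xz yx.
    rewrite -(subrKA x) (le_lt_trans (ler_normD _ _)) //.
    by rewrite (_ : 2 * s = s + s) ?ltrD //; [lra|ring].
  by rewrite /Rintegral integral0.
- move=> x xs; rewrite -[RHS](r1 x) /mollify; apply: eq_Rintegral => y _.
  have [yx|/rho0 ->] := pselect (cball x (s / 2) y); last by rewrite mulr0.
  rewrite indicE mem_set ?mul1r // => z yz; apply: xs.
  move: yz yx; rewrite -!ball_normE /cball /= => yz yx.
  rewrite -(subrKA y) (le_lt_trans (ler_normD _ _)) // [`|x - y|]distrC.
  by rewrite (_ : 3 * s = s + 2 * s) ?ltrD //; [lra|ring].
- move=> x; rewrite -lee_fin -[1 in leRHS](r1 x) -nintegral_Rintegral //.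
  apply: le_abs_Rintegral.
  + apply: measurable_funM; first exact: measurable_indic.
    exact: measurable_shiftN (smooth_measurable (molli_smooth mrho)).
  + exact: measurable_shiftN (smooth_measurable (molli_smooth mrho)).
  + move=> y; rewrite normrM (ger0_norm (molli_ge0 mrho _)) ler_piMl ?(molli_ge0 mrho) //.
    by rewrite indicE; case: (_ \in _); rewrite ?normr1 ?normr0.
Qed.

End cutoff.

(** This identity sends [s^(p-1)], for [s] in L^p, into L^q, so that [F(Du)] can be paired with
    gradients in L^p. *)
Lemma conjugate_exponent {R : realType} (p q : R) : 0 < p -> 0 < q ->
  p^-1 + q^-1 = 1 -> (p - 1) * q = p.
Proof.
move=> p0 q0 pq; have : p * q * (p^-1 + q^-1) = p * q by rewrite pq mulr1.
rewrite (_ : p * q * (p^-1 + q^-1) = q + p); last by field; rewrite !gt_eqF.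
by move=> h; rewrite mulrBl mul1r -h; ring.
Qed.

Lemma isLp_powR_ge0 {dT} {T : measurableType dT} {R : realType}
    (mu : {measure set T -> \bar R}) (p q r : R) (e : T -> R) :
  r * q = p -> (forall x, 0 <= e x) -> isLp mu p e -> isLp mu q (fun x => e x `^ r).
Proof.
move=> rq e0 [me eoo]; split; first exact: (measurableT_comp (measurable_powR r) me).
suff -> : pint mu q (fun x => e x `^ r)%R = pint mu p e by [].
rewrite !pintE; apply: eq_integral => x _; congr EFin.
by rewrite (ger0_norm (e0 x)) (ger0_norm (powR_ge0 _ _)) -powRrM rq.
Qed.

Section excess_integrability.
Context {dT} {T : measurableType dT} {R : realType} {d N : nat}.
Variable mu : {measure set T -> \bar R}.
Variables (v : 'I_N -> 'rV[R]_d) (delta c : 'I_N -> R) (p q : R).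
Hypotheses (hc : forall k, 0 < c k) (hdelta : forall k, 0 < delta k).
Hypotheses (p0 : 0 < p) (q0 : 0 < q) (pq : p^-1 + q^-1 = 1).
Implicit Types (D : T -> 'rV[R]_d).

Lemma isLp_powR r (w : T -> R) : isLp mu r w ->
  mu.-integrable setT (EFin \o (fun x => `|w x| `^ r)) /\
  \int[mu]_x (`|w x| `^ r) = fine (pint mu r w).
Proof.
move=> [mw wr]; have mwr := measurable_abs_powR r mw.
have i : mu.-integrable setT (EFin \o (fun x => `|w x| `^ r)).
  by apply: nintegral_integrable => //; rewrite -pintE.
by split=> //; rewrite pintE.
Qed.

Lemma measurable_dotv D k : (forall j, measurable_fun setT (fun x => D x ord0 j)) ->
  measurable_fun setT (fun x => dotv (D x) (v k)).
Proof. by move=> mD; apply: measurable_sum => j; exact: measurable_funM. Qed.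

Lemma measurable_excess D k : (forall j, measurable_fun setT (fun x => D x ord0 j)) ->
  measurable_fun setT (fun x => excess v delta c k (D x)).
Proof.
move=> mD; apply: measurable_maxr => //; apply: measurable_funB => //.
exact: measurable_dotv.
Qed.

Lemma excess_le k x : excess v delta c k x <= `|dotv x (v k)|.
Proof.
rewrite /excess ge_max normr_ge0 andbT.
apply: le_trans (ler_norm _).
by rewrite gerBl mulr_ge0 // ltW.
Qed.

Lemma excess_isLp D k : (forall j, isLp mu p (fun x => D x ord0 j)) ->
  isLp mu p (fun x => excess v delta c k (D x)).
Proof.
move=> LD.
have L : isLp mu p (fun x => dotv (D x) (v k)).
  apply: (isLp_sum p0) => j.
  rewrite (_ : (fun x => _) = (fun x => v k ord0 j * D x ord0 j)).
    exact: isLpZ (ltW p0) (LD j).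
  by apply/funext => x; rewrite mulrC.
apply: (isLp_le (ltW p0) ler01 _ _ L).
  by apply: measurable_excess => j; case: (LD j).
by move=> x; rewrite mul1r ger0_norm ?excess_ge0 // excess_le.
Qed.

Lemma F_isLp D j : (forall j, isLp mu p (fun x => D x ord0 j)) ->
  isLp mu q (fun x => F v delta c p (D x) ord0 j).
Proof.
move=> LD; under eq_fun do rewrite F_coor.
apply: (isLp_sum q0) => k.
rewrite (_ : (fun x => _) = (fun x => v k ord0 j * excess v delta c k (D x) `^ (p - 1))); last first.
  by apply/funext => x; rewrite mulrC.
apply: (isLpZ _ (ltW q0)).
exact: (isLp_powR_ge0 (conjugate_exponent p0 q0 pq) (fun x => excess_ge0 _ _ _ _ _) (excess_isLp k LD)).
Qed.

End excess_integrability.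


(** * The L^2 estimate for differences of powers of the excess *)

Section main_estimate.
Context {R : realType} {d N : nat}.
Variable mu : {sigma_finite_measure set 'rV[R]_d -> \bar R}.
Hypothesis hmu : haar mu.
Local Notation V := 'rV[R]_d.
Variables (v : 'I_N -> 'rV[R]_d) (delta c : 'I_N -> R) (p q : R).
Hypotheses (hc : forall k, 0 < c k) (hdelta : forall k, 0 < delta k).
Hypotheses (p2 : 2 <= p) (q0 : 0 < q) (pq : p^-1 + q^-1 = 1).
Variables (K0 : set V) (u f df : V -> R) (D : V -> V) (i : 'I_d).
Hypothesis cK0 : compact K0.
Hypotheses (up : isLp mu p u) (ui : mu.-integrable setT (EFin \o u)).
Hypotheses (Dp : forall j, isLp mu p (fun x => D x ord0 j))
  (Di : forall j, mu.-integrable setT (EFin \o (fun x => D x ord0 j))).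
Hypotheses (fq : isLp mu q f) (fi : mu.-integrable setT (EFin \o f)).
Hypotheses (dfq : isLp mu q df) (dfi : mu.-integrable setT (EFin \o df)).
Hypothesis wu : forall j, local_weak_partial mu K0 j u (fun x => D x ord0 j).
Hypothesis wf : local_weak_partial mu K0 i f df.
Hypothesis eqn : weak_equation mu K0 f (fun j x => F v delta c p (D x) ord0 j).

Local Notation e_ i := (delta_mx ord0 i : V).
Let p0 : 0 < p. Proof. exact: lt_le_trans (ltr0Sn R 1) p2. Qed.

(** Dividing by [h] turns differences of order [h] into uniformly bounded functions; it serves for
    [u] with exponent [p] and for [f] with exponent [q]. *)
Lemma scaled_tau_bound r r' (w dw : V -> R) (s : R) : 0 < r -> 0 < r' -> r^-1 + r'^-1 = 1 ->
  0 < s -> isLp mu r w -> isLp mu r dw ->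
  mu.-integrable setT (EFin \o w) -> mu.-integrable setT (EFin \o dw) ->
  local_weak_partial mu K0 i w dw ->
  exists2 C : R, 0 <= C & forall h, 0 < h < s / 2 ->
    isLp mu r (fun x => \1_(inner K0 s) x * (tau h i w x / h)) /\
    \int[mu]_x (`|\1_(inner K0 s) x * (tau h i w x / h)| `^ r) <= C.
Proof.
move=> r0 r'0 rr s0 wL dwL wi dwi ww.
have [C C0 H] := tau_bound hmu r0 r'0 rr cK0 s0 wL dwL wi dwi ww.
exists C => // h hs; have /andP[h0 _] := hs.
have mK : measurable (inner K0 s) by apply: measurable_closed_rV; exact: closed_inner.
have mt := measurable_tau h i wL.1.
have m1 : measurable_fun setT (fun x => \1_(inner K0 s) x * tau h i w x) by exact: measurable_funM.
have m2 : measurable_fun setT (fun x => \1_(inner K0 s) x * (tau h i w x / h)).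
  by apply: measurable_funM => //; exact: measurable_funM.
have B : (pint mu r (fun x => \1_(inner K0 s) x * (tau h i w x / h))%R <= C%:E)%E.
  have hV : 0 <= h^-1 by rewrite invr_ge0 ltW.
  apply: le_trans (le_pint mu (ltW r0) hV m2 m1 _) _.
    by move=> x; rewrite mulrA normrM (ger0_norm hV) mulrC.
  apply: (@le_trans _ _ ((h^-1 `^ r)%:E * (C * h `^ r)%:E)%E).
    by apply: lee_wpmul2l; [rewrite lee_fin powR_ge0|exact: H].
  rewrite -EFinM lee_fin mulrCA -powRM ?(ltW h0) // mulVf ?gt_eqF //.
  by rewrite powR1 mulr1.
have L : isLp mu r (fun x => \1_(inner K0 s) x * (tau h i w x / h)).
  by split=> //; apply: le_lt_trans B _; rewrite ltry.
split=> //; rewrite (isLp_powR L).2 -lee_fin fineK //.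
exact: isLp_fin.
Qed.

Let qp : q^-1 + p^-1 = 1. Proof. by rewrite addrC. Qed.
Local Notation tauF h j := (tau h i (fun x => F v delta c p (D x) ord0 j)).

(** Write the product of differences as [h^2] times the product of the two quotients and apply
    Young's inequality; [|zeta| <= 1] removes the cutoff. *)
Lemma energy_le (s h Cu Cf : R) (zeta : V -> R) : smooth zeta -> 0 < h < s / 2 ->
  (forall x, ~ inner K0 s x -> zeta x = 0) -> (forall x, `|zeta x| <= 1) ->
  isLp mu p (fun x => \1_(inner K0 s) x * (tau h i u x / h)) ->
  \int[mu]_x (`|\1_(inner K0 s) x * (tau h i u x / h)| `^ p) <= Cu ->
  isLp mu q (fun x => \1_(inner K0 s) x * (tau h i f x / h)) ->
  \int[mu]_x (`|\1_(inner K0 s) x * (tau h i f x / h)| `^ q) <= Cf ->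
  \int[mu]_x (tau h i f x * (zeta x * zeta x * tau h i u x)) <= h ^+ 2 * (Cf + Cu).
Proof.
move=> sz /andP[h0 hs] z0 zle LU BU LF BF.
have [iU _] := isLp_powR LU; have [iF _] := isLp_powR LF.
have iS := integrable_mulrl (h ^+ 2) (integrable_addr iF iU).
have mz := smooth_measurable sz.
have mu0 := measurable_tau h i up.1; have mf0 := measurable_tau h i fq.1.
apply: le_trans (ler_norm _) _; rewrite -lee_fin.
apply: (@le_trans _ _ (\int[mu]_x (h ^+ 2 * (`|\1_(inner K0 s) x * (tau h i f x / h)| `^ q +
    `|\1_(inner K0 s) x * (tau h i u x / h)| `^ p))%:E)%E).
  apply: le_abs_Rintegral.
  - apply: measurable_funM; first exact: mf0.
    apply: measurable_funM; last exact: mu0.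
    by apply: measurable_funM; exact: mz.
  - exact: integrable_EFin_measurable iS.
  - move=> x; have [xK|/z0 ->] := pselect (inner K0 s x); last first.
      rewrite !mul0r mulr0 normr0; apply: mulr_ge0; first exact: sqr_ge0.
      by apply: addr_ge0; exact: powR_ge0.
    rewrite indicE mem_set // !mul1r.
    apply: (@le_trans _ _ (h ^+ 2 * `|tau h i f x / h * (tau h i u x / h)|)); last first.
      by apply: ler_wpM2l; [exact: sqr_ge0|exact: young_powR q0 p0 qp].
    rewrite -[h ^+ 2](ger0_norm (sqr_ge0 h)) -normrM.
    rewrite (_ : h ^+ 2 * _ = tau h i f x * tau h i u x); last by field; rewrite gt_eqF.
    rewrite mulrCA normrM [leRHS](_ : _ = 1 * `|tau h i f x * tau h i u x|); last by rewrite mul1r.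
    apply: ler_wpM2r => //; rewrite normrM -[1](mulr1 1).
    by apply: ler_pM.
rewrite (nintegral_Rintegral iS) lee_fin.
rewrite (RintegralZl _ measurableT (integrable_addr iF iU)).
apply: ler_wpM2l; first exact: sqr_ge0.
by rewrite (RintegralD measurableT iF iU); exact: lerD.
Qed.

Lemma energy_integral (s h : R) (zeta : V -> R) : smooth zeta -> 0 < h < s / 2 ->
  (forall x, ~ inner K0 s x -> zeta x = 0) ->
  mu.-integrable setT (EFin \o (fun x => \sum_j tauF h j x *
    (zeta x * zeta x * tau h i (fun y => D y ord0 j) x +
     2 * (zeta x * partial j zeta x) * tau h i u x))) /\
  \int[mu]_x (\sum_j tauF h j x *
    (zeta x * zeta x * tau h i (fun y => D y ord0 j) x +
     2 * (zeta x * partial j zeta x) * tau h i u x)) =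
  \int[mu]_x (tau h i f x * (zeta x * zeta x * tau h i u x)).
Proof.
move=> sz hs z0; have /andP[h0 hs2] := hs; have s0 : 0 < s by lra.
have FL j := F_isLp v hc hdelta p0 q0 pq j Dp.
have tF j := isLp_tau hmu h i (ltW q0) (FL j).
have cl := compact_rV_closed cK0.
have z00 x : ~ K0 x -> zeta x = 0.
  by move=> nK; apply: z0 => xs; apply: nK; exact: (inner_sub s0 xs).
have L1 j : isLp mu p (fun x => zeta x * zeta x * tau h i (fun y => D y ord0 j) x).
  have szz := smoothM sz sz.
  have [A A0 hA] : exists2 A : R, 0 < A & forall x, `|zeta x * zeta x| <= A.
    by apply: (smooth_bounded szz cK0) => x /z00 ->; rewrite mul0r.
  exact: (isLp_mul_tau hmu p0 h i (smooth_measurable szz) (ltW A0) hA (Dp j)).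
have L2 j : isLp mu p (fun x => 2 * (zeta x * partial j zeta x) * tau h i u x).
  have szz := smoothZ 2 (smoothM sz (smooth_partial j sz)).
  have [A A0 hA] : exists2 A : R, 0 < A & forall x, `|2 * (zeta x * partial j zeta x)| <= A.
    by apply: (smooth_bounded szz cK0) => x /z00 ->; rewrite mul0r mulr0.
  exact: (isLp_mul_tau hmu p0 h i (smooth_measurable szz) (ltW A0) hA up).
have J1 j := isLp_mul_integrable q0 p0 qp (tF j) (L1 j).
have J2 j := isLp_mul_integrable q0 p0 qp (tF j) (L2 j).
have EE : (fun x => \sum_j tauF h j x *
    (zeta x * zeta x * tau h i (fun y => D y ord0 j) x +
     2 * (zeta x * partial j zeta x) * tau h i u x)) =
  (fun x => \sum_j (tauF h j x * (zeta x * zeta x * tau h i (fun y => D y ord0 j) x) +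
    tauF h j x * (2 * (zeta x * partial j zeta x) * tau h i u x))).
  by apply/funext => x; apply: eq_bigr => j _; rewrite mulrDr.
have [iS eS] := Rintegral_sum (fun j => integrable_addr (J1 j) (J2 j)).
rewrite EE; split; first exact: iS.
rewrite eS -(caccioppoli_equation hmu p0 q0 pq cK0 up ui Dp Di FL fq wu eqn i sz hs z0).
by apply: eq_bigr => j _; exact: (RintegralD measurableT (J1 j) (J2 j)).
Qed.

(** The two excess terms have equal integrals by translation invariance, whence the factor 2. *)
Lemma excess_pair_integral (h s Cu : R) (k : 'I_N) :
  isLp mu p (fun x => \1_(inner K0 s) x * (tau h i u x / h)) ->
  \int[mu]_x (`|\1_(inner K0 s) x * (tau h i u x / h)| `^ p) <= Cu ->
  mu.-integrable setT (EFin \o (fun x => excess v delta c k (D (x + h *: e_ i)) `^ p +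
    excess v delta c k (D x) `^ p + 2 * `|\1_(inner K0 s) x * (tau h i u x / h)| `^ p)) /\
  \int[mu]_x (excess v delta c k (D (x + h *: e_ i)) `^ p +
    excess v delta c k (D x) `^ p + 2 * `|\1_(inner K0 s) x * (tau h i u x / h)| `^ p) <=
  2 * (fine (pint mu p (fun x => excess v delta c k (D x))) + Cu).
Proof.
move=> LU BU; have [iU _] := isLp_powR LU.
have Le := excess_isLp v hc hdelta p0 k Dp.
have [ie ee] := isLp_powR Le.
have ie' := integrable_trans hmu (h *: e_ i) ie.
have aE (x : V) : `|excess v delta c k (D x)| = excess v delta c k (D x).
  by rewrite ger0_norm ?excess_ge0.
have fE : (fun x : V => `|excess v delta c k (D x)| `^ p) = (fun x => excess v delta c k (D x) `^ p).
  by apply/funext => x; rewrite aE.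
rewrite fE in ie ie' ee.
have ee' := Rintegral_trans hmu (h *: e_ i) (integrable_EFin_measurable ie).
have i1 := integrable_addr ie' ie; have i2 := integrable_mulrl 2 iU.
split; first exact: (integrable_addr i1 i2).
rewrite (RintegralD measurableT i1 i2) (RintegralD measurableT ie' ie).
rewrite (RintegralZl _ measurableT iU) mulrDr.
apply: lerD; last by apply: ler_wpM2l.
have add (a b e : R) : a = e -> b = e -> a + b <= 2 * e.
  by move=> -> ->; rewrite mulr_natl mulr2n.
exact: (add _ _ _ (etrans ee' ee) ee).
Qed.

Lemma tau_excess_estimate (s : R) (k : 'I_N) : 0 < s ->
  exists2 C : R, 0 <= C & forall h, 0 < h < s / 2 ->
  (pint mu 2 (fun x => \1_(inner K0 (3 * s)) x *
     tau h i (fun y => excess v delta c k (D y) `^ (p / 2)) x)%R <= (C * h ^+ 2)%:E)%E.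
Proof.
move=> s0.
have [zeta [sz z0 z1 zle]] := cutoff_exists hmu cK0 s0.
have [Cu Cu0 HU] := scaled_tau_bound p0 q0 pq s0 up (Dp i) ui (Di i) (wu i).
have [Cf Cf0 HF] := scaled_tau_bound q0 p0 qp s0 fq dfq fi dfi wf.
have cl := compact_rV_closed cK0.
have z00 x : ~ K0 x -> zeta x = 0.
  by move=> nK; apply: z0 => xs; apply: nK; exact: (inner_sub s0 xs).
(* [G] bounds the gradient of the cutoff along every [v k], independently of [h]. *)
have [G HG] : exists G : R, forall x k, `|dotv (grad zeta x) (v k)| <= G.
  have [b hb] : {b : 'I_d -> R & forall j x, `|partial j zeta x| <= b j}.
    apply: (@choice _ _ (fun j b => forall x, `|partial j zeta x| <= b)) => j.
    have [b _ hb] := smooth_bounded (smooth_partial j sz) cK0 (partial_compl_eq0 j cl z00).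
    by exists b.
  exists (\sum_j b j * \sum_k' `|v k' ord0 j|) => x k1.
  apply: le_trans (ler_norm_sum _ _ _) _; apply: ler_sum => j _.
  rewrite normrM mxE; apply: ler_pM => //.
  by rewrite (bigD1 k1) //= lerDl sumr_ge0.
pose Ek k := fine (pint mu p (fun x => excess v delta c k (D x))).
have Ek0 k1 : 0 <= Ek k1 by rewrite fine_ge0 // pint_ge0.
pose cst := 2 * p ^+ 2 * G ^+ 2.
have cst0 : 0 <= cst.
  by rewrite /cst; apply: mulr_ge0 (sqr_ge0 G); apply: mulr_ge0 (sqr_ge0 p).
exists (p * (Cf + Cu) + cst * \sum_k (2 * (Ek k + Cu))).
  apply: addr_ge0; apply: mulr_ge0 => //; first exact: ltW p0.
    exact: addr_ge0.
  by apply: sumr_ge0 => k1 _; apply: mulr_ge0 => //; exact: addr_ge0.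
move=> h hs; have /andP[h0 _] := hs.
have [LU BU] := HU h hs; have [LF BF] := HF h hs.
have [iE eE] := energy_integral sz hs z0.
have bE := energy_le sz hs z0 zle LU BU LF BF.
have iB k1 := (excess_pair_integral k1 LU BU).1.
have bB k1 := (excess_pair_integral k1 LU BU).2.
have [iBs eBs] := Rintegral_sum iB.
have iR := integrable_addr (integrable_mulrl p iE) (integrable_mulrl (cst * h ^+ 2) iBs).
have mX k1 : measurable_fun setT (fun y => excess v delta c k1 (D y) `^ (p / 2)).
  apply: (measurableT_comp (measurable_powR (p / 2))).
  by apply: measurable_excess => j; case: (Dp j).
have mK : measurable (inner K0 (3 * s)).
  by apply: measurable_closed_rV; apply: closed_inner; exact: mulr_gt0.
rewrite pintE.
apply: (le_trans (le_nintegral mu _ (integrable_EFin_measurable iR) _)).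
- apply: (measurable_abs_powR 2); apply: measurable_funM; first exact: measurable_indic.
  exact: measurable_tau.
- move=> x; apply/andP; split; first exact: powR_ge0.
  have kz : ~~ (x \in inner K0 s) -> zeta x = 0 by move=> nx; apply: z0 => /mem_set; exact/negP.
  have := caccioppoli_pointwise delta c (D (x + h *: e_ i)) (D x) (tau h i u x) p2 h0 (HG x) kz.
  move=> main; apply: (@le_trans _ _ ((zeta x * (excess v delta c k (D (x + h *: e_ i)) `^ (p / 2) -
      excess v delta c k (D x) `^ (p / 2))) ^+ 2)).
    rewrite powR_mulrn // real_normK ?num_real // indicE.
    have [/set_mem xK|_] := boolP (x \in inner K0 (3 * s)); first by rewrite (z1 x xK).
    by rewrite mul0r expr0n /= sqr_ge0.
  apply: le_trans (le_trans _ main) _.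
    rewrite (bigD1 k) //= lerDl; apply: sumr_ge0 => k1 _; exact: sqr_ge0.
  apply: lerD.
    apply: ler_wpM2l (ltW p0) _ _ _; rewrite le_eqVlt; apply/orP; left; apply/eqP.
    by apply: eq_bigr => j _; rewrite mxE /tau; ring.
  rewrite -mulrA [_%:R * _]mulrC -[leLHS]mulrA; apply: ler_wpM2l.
    by apply: mulr_ge0 => //; exact: sqr_ge0.
  rewrite mulr_suml; apply: ler_sum => k1 _.
  rewrite indicE; case: (x \in inner K0 s); first by rewrite mulr1 !mul1r.
  rewrite mulr0; apply: addr_ge0; last by apply: mulr_ge0 => //; exact: powR_ge0.
  by apply: addr_ge0; exact: powR_ge0.
- rewrite (nintegral_Rintegral iR) lee_fin.
  rewrite (RintegralD measurableT (integrable_mulrl p iE) (integrable_mulrl (cst * h ^+ 2) iBs)).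
  rewrite (RintegralZl _ measurableT iE) (RintegralZl _ measurableT iBs) eE eBs.
  apply: le_trans (lerD (ler_wpM2l (ltW p0) bE) (ler_wpM2l _ (ler_sum _ (fun k1 _ => bB k1)))) _.
    by apply: mulr_ge0 => //; exact: sqr_ge0.
  by rewrite le_eqVlt; apply/orP; left; apply/eqP; rewrite -/Ek; ring.
Qed.

End main_estimate.

(** * Riesz representation in L^2 *)

Section L2_completeness.
Context {dT} {T : measurableType dT} {R : realType}.
Variable mu : {measure set T -> \bar R}.

(** The intervals about [x n] whose radius is the full geometric tail [2 s / 2^n] are nested; the
    limit is the supremum of their left ends. *)
Lemma geometric_cauchy (x : nat -> R) (s : R) : 0 <= s ->
  (forall k, `|x k.+1 - x k| <= s * 2^-1 ^+ k) ->
  exists l, forall n, `|x n - l| <= 2 * s * 2^-1 ^+ n.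
Proof.
move=> s0 hx; pose e n : R := 2 * s * 2^-1 ^+ n.
have e0 n : 0 <= e n by rewrite /e !mulr_ge0 // exprn_ge0.
have step k : `|x k.+1 - x k| <= e k - e k.+1.
  by apply: le_trans (hx k) _; rewrite /e exprS le_eqVlt; apply/orP; left; apply/eqP; field.
have inc : {homo (fun n => x n - e n) : m n / (m <= n)%N >-> m <= n}.
  apply: homo_leq => // [y1 y2 y3|n]; first exact: le_trans.
  by have := step n; rewrite ler_norml => /andP[]; lra.
have dec : {homo (fun n => x n + e n) : m n / (m <= n)%N >-> n <= m}.
  apply: homo_leq => // [y1 y2 y3 a b|n]; first exact: le_trans b a.
  by have := step n; rewrite ler_norml => /andP[]; lra.
have ab m n : x m - e m <= x n + e n.
  apply: le_trans (inc m (maxn m n) (leq_maxl _ _)) _.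
  apply: le_trans _ (dec n (maxn m n) (leq_maxr _ _)).
  by have := e0 (maxn m n); lra.
pose A := range (fun n => x n - e n).
have A0 : A !=set0 by exists (x 0%N - e 0%N), 0%N.
exists (sup A) => n; rewrite ler_norml -/(e n).
have h1 : x n - e n <= sup A.
  by apply: ub_le_sup; [exists (x 0%N + e 0%N) => _ [m _ <-]; exact: ab|exists n].
have h2 : sup A <= x n + e n by apply: ge_sup => // _ [m _ <-]; exact: ab.
by apply/andP; split; lra.
Qed.

(* [S = \sum_k 4^k |phi_(k+1) - phi_k|^2] is integrable, and where it is finite
   consecutive terms differ by at most [2^-k sqrt S]. *)
Lemma L2_cauchy_limit (phi : nat -> T -> R) (c : R) : 0 <= c ->
  (forall n, isLp mu 2 (phi n)) ->
  (forall n, (pint mu 2 (fun x => phi n.+1 x - phi n x)%R <= (c * 8^-1 ^+ n)%:E)%E) ->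
  exists2 Phi, isLp mu 2 Phi & small mu 2 (fun n x => phi n x - Phi x).
Proof.
move=> c0 L H.
pose t n x := 4 ^+ n * `|phi n.+1 x - phi n x| `^ 2.
have t0 n x : 0 <= t n x by rewrite mulr_ge0 ?exprn_ge0 ?powR_ge0.
have md n : measurable_fun setT (fun x => phi n.+1 x - phi n x).
  by apply: measurable_funB; [case: (L n.+1)|case: (L n)].
have mt n : measurable_fun setT (t n).
  by apply: measurable_funM => //; exact: measurable_abs_powR.
pose S x := (\sum_(n <oo) (t n x)%:E)%E.
have S0 x : (0 <= S x)%E by apply: nneseries_ge0 => n _ _; rewrite lee_fin.
have mtE n : measurable_fun setT (fun x => (t n x)%:E) by exact/measurable_EFinP.
have mS : measurable_fun setT S.
  by apply: (ge0_emeasurable_sum (P := xpredT)) => // n x _ _; rewrite lee_fin.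
have IS : (\int[mu]_x S x <= (2 * c)%:E)%E.
  rewrite /S integral_nneseries //; last by move=> n x _; rewrite lee_fin.
  (* [4^n] times the hypothesis is [c / 2^n = 2 c / 2^(n+1)], and these numbers sum to [2 c]. *)
  apply: le_trans (epsilon_trick0 xpredT (mulr_ge0 (ler0n R 2) c0)).
  apply: lee_nneseries => [n _ _|n _]; first by apply: integral_ge0 => x _; rewrite lee_fin.
  rewrite /t nintegralZ ?exprn_ge0 //; last exact: measurable_abs_powR.
  apply: le_trans (lee_wpmul2l _ (_ : _ <= (c * 8^-1 ^+ n)%:E)%E) _.
  - by rewrite lee_fin exprn_ge0.
  - by rewrite -pintE; exact: H.
  rewrite -EFinM lee_fin mulrCA -exprMn (_ : 4 * 8^-1 = 2^-1 :> R); last by field.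
  by rewrite natrX exprVn exprS le_eqVlt; apply/orP; left; apply/eqP; field; rewrite expf_neq0.
have tS n x : (S x < +oo)%E -> t n x <= fine (S x).
  move=> Sx; rewrite -lee_fin fineK ?ge0_fin_numE //.
  have := @nneseries_lim_ge R (fun n => (t n x)%:E) xpredT 0%N n.+1 (fun n _ _ => t0 n x).
  apply: le_trans; rewrite big_nat_recr //= leeDr //.
  by apply: sume_ge0 => k _; rewrite lee_fin.
have dS n x : (S x < +oo)%E -> `|phi n.+1 x - phi n x| <= Num.sqrt (fine (S x)) * 2^-1 ^+ n.
  move=> Sx; have fS : 0 <= fine (S x) by rewrite fine_ge0.
  rewrite -ler_sqr ?nnegrE ?mulr_ge0 ?sqrtr_ge0 ?exprn_ge0 // exprMn sqr_sqrtr //.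
  have := tS n x Sx; rewrite /t powR_mulrn // => h.
  rewrite -exprM mulnC exprM exprVn -exprVn (_ : 2^-1 ^+ 2 = 4^-1 :> R); last by field.
  by rewrite exprVn ler_pdivlMr ?exprn_gt0 // mulrC.
(* The limit is set to 0 where [S] is infinite, which makes it the pointwise limit of the [phi n]
   cut to [A], hence measurable. *)
have [Phi HPhi] : {Phi : T -> R & forall x, ((S x < +oo)%E ->
    forall n, `|phi n x - Phi x| <= 2 * Num.sqrt (fine (S x)) * 2^-1 ^+ n) /\
    (~ (S x < +oo)%E -> Phi x = 0)}.
  apply: (@choice _ _ (fun x l => ((S x < +oo)%E ->
    forall n, `|phi n x - l| <= 2 * Num.sqrt (fine (S x)) * 2^-1 ^+ n) /\
    (~ (S x < +oo)%E -> l = 0))) => x.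
  have [Sx|nSx] := pselect (S x < +oo)%E; last by exists 0.
  have [l hl] := geometric_cauchy (sqrtr_ge0 _) (fun k => dS k x Sx).
  by exists l.
pose A := [set x | (S x < +oo)%E].
have mA : measurable A by rewrite -[A]setTI; exact: emeasurable_fun_infty_o.
have mPhi : measurable_fun setT Phi.
  apply: (@measurable_fun_cvg _ _ _ _ (fun n x => \1_A x * phi n x)).
    by move=> n; apply: measurable_funM; [exact: measurable_indic|case: (L n)].
  move=> x _; have [Sx|nSx] := pselect (S x < +oo)%E; last first.
    rewrite ((HPhi x).2 nSx) indicE memNset //.
    under eq_fun do rewrite mul0r.
    exact: cvg_cst.
  rewrite indicE mem_set //.
  under eq_fun do rewrite mul1r.
  apply/cvgrPdist_le => e e0.
  have : geometric (2 * Num.sqrt (fine (S x))) (2^-1) @ \oo --> (0 : R).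
    by apply: cvg_geometric; rewrite ger0_norm // invf_lt1 // ltr1n.
  move=> /cvgrPdist_le /(_ e e0); apply: filterS => n; rewrite sub0r normrN /= => h.
  rewrite distrC; apply: le_trans ((HPhi x).1 Sx n) _; exact: le_trans (ler_norm _) h.
have B n : (pint mu 2 (fun x => phi n x - Phi x)%R <= (4 * 4^-1 ^+ n * (2 * c))%:E)%E.
  rewrite pintE.
  apply: (@le_trans _ _ (\int[mu]_x ((4 * 4^-1 ^+ n)%:E * S x))%E).
    apply: ge0_le_integral => //.
    - apply/measurable_EFinP; apply: measurable_abs_powR.
      by apply: measurable_funB => //; case: (L n).
    - exact: measurable_funeM.
    - move=> x _; have [Sx|nSx] := pselect (S x < +oo)%E; last first.
        move: nSx => /negP; rewrite -leNgt leye_eq => /eqP ->.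
        by rewrite gt0_muley ?leey // lte_fin mulr_gt0 // exprn_gt0.
      rewrite -[S x]fineK ?ge0_fin_numE // -EFinM lee_fin powR_mulrn //.
      apply: le_trans (lerXn2r 2 _ _ ((HPhi x).1 Sx n)) _; rewrite ?nnegrE //.
      rewrite !exprMn sqr_sqrtr ?fine_ge0 // -exprM mulnC exprM.
      rewrite (_ : 2^-1 ^+ 2 = 4^-1 :> R); last by field.
      by rewrite le_eqVlt; apply/orP; left; apply/eqP; ring.
  rewrite ge0_integralZl_EFin //.
  by rewrite [leRHS]EFinM; apply: lee_wpmul2l; rewrite ?lee_fin ?mulr_ge0 ?exprn_ge0.
have sm : small mu 2 (fun n x => phi n x - Phi x).
  split=> [n|e e0]; first by apply: measurable_funB => //; case: (L n).
  have : geometric (4 * (2 * c)) (4^-1) @ \oo --> (0 : R).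
    by apply: cvg_geometric; rewrite ger0_norm // invf_lt1 // ltr1n.
  move=> /cvgrPdist_le /(_ e e0); apply: filterS => n; rewrite sub0r normrN /= => h.
  apply: le_trans (B n) _; rewrite lee_fin mulrAC; exact: le_trans (ler_norm _) h.
exists Phi => //.
rewrite (_ : Phi = (fun x => phi 0%N x - (phi 0%N x - Phi x))); last first.
  by apply/funext => x; rewrite subKr.
apply: isLpB => //; split; first by case: sm.
exact: le_lt_trans (B 0%N) (ltry _).
Qed.

(* The representing function is the limit of a minimizing sequence of
   [\int (a phi)^2 / 2 - L phi]. *)
Lemma riesz_weighted (P : set (T -> R)) (a : T -> R) (L : (T -> R) -> R) (B : R) :
  P !=set0 ->
  (forall f g t, P f -> P g -> P (fun x => f x + t * g x)) ->
  (forall f g t, P f -> P g -> L (fun x => f x + t * g x) = L f + t * L g) ->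
  (forall f, P f -> isLp mu 2 (fun x => a x * f x)) ->
  (forall f, P f -> L f <= B + 2^-1 * \int[mu]_x (a x * f x) ^+ 2) ->
  exists2 Phi, isLp mu 2 Phi & forall f, P f -> \int[mu]_x (a x * f x * Phi x) = L f.
Proof.
move=> [f0 Pf0] Padd Ladd aL Lbd.
have two0 : 0 < 2 :> R by [].
have two1 : 2^-1 + 2^-1 = 1 :> R by field.
have ip f g : P f -> P g ->
    mu.-integrable setT (EFin \o (fun x => a x * f x * (a x * g x))).
  by move=> Pf Pg; exact: (isLp_mul_integrable two0 two0 two1 (aL f Pf) (aL g Pg)).
pose N f := \int[mu]_x (a x * f x) ^+ 2.
pose b f g := \int[mu]_x (a x * f x * (a x * g x)).
have sq f : P f -> mu.-integrable setT (EFin \o (fun x => (a x * f x) ^+ 2)).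
  by move=> Pf; exact: ip.
have N0 f : 0 <= N f by apply: Rintegral_ge0 => x _; exact: sqr_ge0.
have Npint f : P f -> pint mu 2 (fun x => a x * f x)%R = (N f)%:E.
  move=> Pf; rewrite pintE -nintegral_Rintegral; last exact: sq.
  by apply: eq_integral => x _; rewrite powR_mulrn // real_normK ?num_real.
have NE f g t : P f -> P g -> N (fun x => f x + t * g x) = N f + 2 * t * b f g + t ^+ 2 * N g.
  move=> Pf Pg; have i1 := sq f Pf; have i2 := integrable_mulrl (2 * t) (ip f g Pf Pg).
  have i3 := integrable_mulrl (t ^+ 2) (sq g Pg).
  rewrite /N /b -(RintegralZl _ measurableT (ip f g Pf Pg)) -(RintegralZl _ measurableT (sq g Pg)).
  rewrite -(RintegralD measurableT i1 i2) -(RintegralD measurableT (integrable_addr i1 i2) i3).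
  by apply: eq_Rintegral => x _; ring.
pose J f := 2^-1 * N f - L f.
have JE f g t : P f -> P g ->
    J (fun x => f x + t * g x) = J f + t * (b f g - L g) + t ^+ 2 / 2 * N g.
  by move=> Pf Pg; rewrite /J NE // Ladd //; field.
pose m := inf [set J f | f in P].
have lbJ : has_lbound [set J f | f in P].
  by exists (- B) => _ [f Pf <-]; have := Lbd f Pf; rewrite /J /N; lra.
have hI : has_inf [set J f | f in P] by split => //; exists (J f0), f0.
have mJ f : P f -> m <= J f by move=> Pf; apply: ge_inf => //; exists f.
have e0 n : 0 < 8^-1 ^+ n :> R by rewrite exprn_gt0.
have [phi Hphi] : {phi : nat -> T -> R & forall n, P (phi n) /\ J (phi n) < m + 8^-1 ^+ n}.
  apply: (@choice _ _ (fun n f => P f /\ J f < m + 8^-1 ^+ n)) => n.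
  by have [_ [f Pf <-] h] := inf_adherent (e0 n) hI; exists f.
have Pphi n := (Hphi n).1; have Jphi n := (Hphi n).2.
have [Phi LPhi sm] : exists2 Phi, isLp mu 2 Phi & small mu 2 (fun n x => a x * phi n x - Phi x).
  apply: (@L2_cauchy_limit (fun n x => a x * phi n x) 8 _ (fun n => aL _ (Pphi n))) => // n.
  (* [J] is quadratic on the segment from [phi n] to [phi n.+1]: its midpoint value is the mean of
     the end values minus [N dl / 8], and is at least [m]. So [N dl] is at most
     [4 (8^-n + 8^-(n+1))], which is below [8] times [8^-n]. *)
  pose dl x := phi n.+1 x + -1 * phi n x.
  have Pdl : P dl by exact: Padd.
  have -> : (fun x => a x * phi n.+1 x - a x * phi n x) = (fun x => a x * dl x).
    by apply/funext => x; rewrite /dl; ring.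
  rewrite (Npint dl Pdl) lee_fin.
  have h1 := mJ _ (Padd _ _ 2^-1 (Pphi n) Pdl).
  have h2 := JE _ _ 1 (Pphi n) Pdl.
  have h3 := JE _ _ 2^-1 (Pphi n) Pdl.
  have E1 : (fun x => phi n x + 1 * dl x) = phi n.+1 by apply/funext => x; rewrite /dl; ring.
  rewrite E1 in h2; rewrite h3 in h1.
  have j1 := Jphi n; have j2 := Jphi n.+1; rewrite h2 (exprS 8^-1) in j2.
  have := e0 n; move: h1 j1 j2; clear.
  set j := J _; set w := b _ _ - _; set M := N _; set e := _ ^+ n.
  rewrite expr1n mul1r (_ : 2^-1 ^+ 2 / 2 * M = 8^-1 * M); last by field.
  lra.
exists Phi => // f Pf.
have cv := pairing_cvg two0 two0 two1 (aL f Pf) (fun n => aL _ (Pphi n)) LPhi sm.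
set w := \int[mu]_x _ in cv *.
(* [J (phi n + t f) >= m] and [J (phi n) < m + 8^-n] give this up to [8^-n], before passing to the
   limit. *)
have key t : 0 <= t * (w - L f) + t ^+ 2 / 2 * N f.
  have c1 : t * (\int[mu]_x (a x * f x * (a x * phi n x)) - L f) + t ^+ 2 / 2 * N f
      @[n --> \oo] --> t * (w - L f) + t ^+ 2 / 2 * N f.
    by apply: cvgD; [apply: cvgM; [exact: cvg_cst|]; apply: cvgB => //; exact: cvg_cst|exact: cvg_cst].
  have c2 : - (8^-1 ^+ n : R) @[n --> \oo] --> - 0.
    by apply: cvgN; apply: cvg_expr; rewrite ger0_norm // invf_lt1 // ltr1n.
  rewrite -oppr0; apply: (ler_cvg_to c2 c1); apply: nearW => n.
  have h1 := mJ _ (Padd _ _ t (Pphi n) Pf); rewrite JE // in h1.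
  have h2 := Jphi n; rewrite /b in h1.
  have E1 : \int[mu]_x (a x * phi n x * (a x * f x)) = \int[mu]_x (a x * f x * (a x * phi n x)).
    by apply: eq_Rintegral => x _; rewrite mulrC.
  rewrite E1 in h1; move: h1 h2; clear; lra.
apply/eqP; rewrite -subr_eq0; apply/eqP.
(* With r = [w - L f] and n = [N f], the value [t = - r / (n + 1)] makes the expression a negative
   multiple of [r^2], so [r = 0]; the [+ 1] covers [n = 0]. *)
have := key (- (w - L f) / (N f + 1)); have := N0 f; move: (N f) (w - L f) => n r n0.
rewrite (_ : _ + _ = - (r ^+ 2 * ((n + 2) / (2 * (n + 1) ^+ 2)))); last first.
  by field; rewrite gt_eqF //; lra.
rewrite oppr_ge0 => h; apply/eqP; rewrite -sqrf_eq0 eq_le sqr_ge0 andbT.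
by move: h; rewrite pmulr_lle0 // divr_gt0 ?mulr_gt0 ?exprn_gt0 //; lra.
Qed.

End L2_completeness.

(** * Weak derivatives from difference quotients *)

Section weight.
Context {dT} {T : measurableType dT} {R : realType}.

(** [a] takes the value [c m] for the first index [m] with [x] in [K m]; measurability is checked on
    the disjoint pieces [seqDU K m]. The value 1 elsewhere keeps the weight positive when all [c m]
    are. *)
Lemma weight_exists (K : nat -> set T) (c : nat -> R) : (forall n, measurable (K n)) ->
  exists a : T -> R, [/\ measurable_fun setT a,
    forall M x, K M x -> exists m, [/\ (m <= M)%N, K m x & a x = c m] &
    forall x, (forall M, ~ K M x) -> a x = 1].
Proof.
move=> mK; have mD := seqDU_measurable mK.
have [a Ha] : {a : T -> R & forall x, (forall M, seqDU K M x -> a x = c M) /\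
    ((forall M, ~ K M x) -> a x = 1)}.
  apply: (@choice _ _ (fun x l => (forall M, seqDU K M x -> l = c M) /\
    ((forall M, ~ K M x) -> l = 1))) => x.
  have [[m xm]|nx] := pselect (exists m, seqDU K m x).
    exists (c m); split; last by move=> /(_ m); case; exact: subset_seqDU xm.
    move=> M xM; congr c; apply: (@trivIset_seqDU _ K m M) => //.
    by exists x.
  by exists 1; split => // M xM; exfalso; apply: nx; exists M.
exists a; split.
- have E : [set: T] = (~` \bigcup_n seqDU K n) `|` \bigcup_n seqDU K n by rewrite setvU.
  have mU : measurable (\bigcup_n seqDU K n) by exact: bigcup_measurable.
  rewrite E; apply/measurable_funU => //; first exact: measurableC.
  split.
    apply: (@eq_measurable_fun _ _ T R _ (fun=> 1)) => // x /set_mem nx; apply/esym/(Ha x).2 => M xM.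
    by apply: nx; rewrite -seqDU_bigcup_eq; exists M.
  apply/measurable_fun_bigcup => // n.
  by apply: (@eq_measurable_fun _ _ T R _ (fun=> c n)) => // x /set_mem xn; apply/esym/(Ha x).1.
- move=> M x xM.
  have : (\big[setU/set0]_(k < M.+1) K k) x.
    by rewrite big_ord_recr /=; right.
  rewrite bigsetU_seqDU -bigcup_mkord => -[m /= mM xm]; exists m; split=> //.
    exact: subset_seqDU xm.
  exact: (Ha x).1.
- by move=> x; exact: (Ha x).2.
Qed.

End weight.

Section weak_partial_of_difference_quotients.
Context {R : realType} {d : nat}.
Variable mu : {sigma_finite_measure set 'rV[R]_d -> \bar R}.
Hypothesis hmu : haar mu.
Local Notation V := 'rV[R]_d.
Local Notation e_ i := (delta_mx ord0 i : V).
Variables (Omega : set V) (g : V -> R) (i : 'I_d).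
Hypothesis cI : forall r : R, 0 < r -> compact (inner Omega r).
Hypothesis exI : forall K, compact K -> K `<=` Omega -> exists2 r : R, 0 < r & K `<=` inner Omega r.
Hypothesis mg : measurable_fun setT g.
Hypothesis gL : forall r : R, 0 < r -> isLp mu 2 (fun x => \1_(inner Omega r) x * g x).

Let two0 : 0 < 2 :> R. Proof. by []. Qed.
Let two1 : 2^-1 + 2^-1 = 1 :> R. Proof. by field. Qed.
Let mI (r : R) : 0 < r -> measurable (inner Omega r).
Proof. by move=> r0; apply: measurable_closed_rV; exact: closed_inner. Qed.

Lemma test_function_inner phi : test_function Omega phi ->
  exists2 r : R, 0 < r & forall x, ~ inner Omega r x -> phi x = 0.
Proof.
move=> tphi; have [sphi cphi phiO] := tphi.
have [r r0 Kr] := exI cphi phiO; exists r => // x nx.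
by apply: (test_function_eq0 tphi) => /Kr.
Qed.

Lemma test_functionD phi psi (t : R) : test_function Omega phi -> test_function Omega psi ->
  test_function Omega (fun x => phi x + t * psi x).
Proof.
move=> tphi tpsi; have [r r0 hr] := test_function_inner tphi.
have [r' r'0 hr'] := test_function_inner tpsi.
have r''0 : 0 < Num.min r r' by rewrite lt_min r0.
apply: (test_functionI (K := inner Omega (Num.min r r'))).
- by apply: smoothD; [case: tphi|apply: smoothZ; case: tpsi].
- exact: cI.
- exact: inner_sub.
- move=> x nx; rewrite hr ?hr' ?mulr0 ?addr0 // => xr; apply: nx; apply: le_inner xr.
    by rewrite ge_min lexx orbT.
  by rewrite ge_min lexx.
Qed.

Lemma mul_inner_integrable (r : R) phi : 0 < r -> continuous phi ->
  (forall x, ~ inner Omega r x -> phi x = 0) ->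
  mu.-integrable setT (EFin \o (fun x => g x * phi x)).
Proof.
move=> r0 cphi phi0.
have -> : (fun x => g x * phi x) = (fun x => \1_(inner Omega r) x * g x * phi x).
  apply/funext => x; have [xr|/phi0 ->] := pselect (inner Omega r x); last by rewrite !mulr0.
  by rewrite indicE mem_set // mul1r.
exact: (isLp_mul_integrable two0 two0 two1 (gL r0) (compact_supp_isLp hmu two0 cphi (cI r0) phi0)).
Qed.

Lemma inner_shiftN (r h : R) x : 0 < h < r / 2 -> inner Omega r (x + - (h *: e_ i)) ->
  inner Omega (r / 2) x.
Proof.
move=> /andP[h0 hr]; rewrite [X in inner _ X](splitr r) => /inner_shift; apply.
rewrite -ball_normE /= addrAC subrr add0r normrN.
by apply: le_lt_trans (norm_delta _ _) _; rewrite ger0_norm // ltW.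
Qed.

(* Moving the difference quotient from [g] to [phi] costs an error of second
   order in [h]. *)
Lemma partial_le_tau (r : R) phi : 0 < r -> smooth phi ->
  (forall x, ~ inner Omega r x -> phi x = 0) ->
  exists2 A : R, 0 <= A & forall h : R, 0 < h < r / 2 ->
    mu.-integrable setT (EFin \o (fun x => tau h i g x * phi x)) /\
    (- (\int[mu]_x (g x * partial i phi x)) * h <= \int[mu]_x (tau h i g x * phi x) + A * h ^+ 2)%R.
Proof.
move=> r0 sphi phi0; have r20 : 0 < r / 2 by exact: divr_gt0.
have cl := compact_rV_closed (cI r0).
have dphi0 := partial_compl_eq0 i cl phi0.
have [M M0 HM] := smooth_bounded (smooth_partial i (smooth_partial i sphi)) (cI r0)
  (partial_compl_eq0 i cl dphi0).
have c1 : mu.-integrable setT (EFin \o (fun x => \1_(inner Omega (r / 2)) x * g x)).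
  have mu2 : (mu (inner Omega (r / 2)) < +oo)%E by exact: compact_measure_fin (cI r20).
  have L1 : isLp mu 2 (\1_(inner Omega (r / 2)) : V -> R).
    apply: (bounded_isLp two0 ler01 _ (mI r20) mu2).
    - by apply: measurable_indic; exact: mI.
    - by move=> x; rewrite indicE; case: (_ \in _); rewrite ?normr1 ?normr0.
    - by move=> x nx; rewrite indicE memNset.
  have := isLp_mul_integrable two0 two0 two1 L1 (gL r20).
  congr (is_true (_ _)); apply/funext => x /=; rewrite indicE.
  by case: (_ \in _); rewrite ?mul1r ?mul0r.
have ai : mu.-integrable setT (EFin \o (fun x => `|\1_(inner Omega (r / 2)) x * g x|)).
  exact: integrable_abse c1.
(* For [h < r/2] both [phi] and its shift vanish off [inner Omega (r / 2)], so the remainder only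
   involves [|g|] there, uniformly in [h]. *)
exists (M * \int[mu]_x `|\1_(inner Omega (r / 2)) x * g x|).
  by apply: mulr_ge0; [exact: ltW|exact: Rintegral_ge0].
move=> h hr; have /andP[h0 hr2] := hr.
have le_r : inner Omega r `<=` inner Omega (r / 2) by apply: le_inner; lra.
have phi0' x : ~ inner Omega (r / 2) x -> phi (x + - (h *: e_ i)) = 0.
  by move=> nx; apply: phi0 => /(inner_shiftN hr).
have i0 := mul_inner_integrable r0 (smooth_continuous sphi) phi0.
have i1 := mul_inner_integrable r0 (smooth_continuous (smooth_partial i sphi)) dphi0.
have i2 := mul_inner_integrable r20 (smooth_continuous (smooth_shift (- (h *: e_ i)) sphi)) phi0'.
have i3 := integrable_trans hmu (h *: e_ i) i2.
have E3 : (fun x => trans (h *: e_ i) (fun x => g x * phi (x + - (h *: e_ i))) x - g x * phi x) =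
    (fun x => tau h i g x * phi x).
  by apply/funext => x; rewrite /trans addrK /tau mulrBl.
have i4 := integrable_subr i3 i0; rewrite E3 in i4; split; first exact: i4.
have I4 : \int[mu]_x (tau h i g x * phi x) =
    \int[mu]_x (g x * phi (x + - (h *: e_ i))) - \int[mu]_x (g x * phi x).
  rewrite -(Rintegral_trans hmu (h *: e_ i) (integrable_EFin_measurable i2)).
  by rewrite -E3 (RintegralB measurableT i3 i0).
have i5 := integrable_subr i2 i0.
have i6 := integrable_mulrl h i1.
have i7 := integrable_addr i5 i6.
have I7 : \int[mu]_x (g x * phi (x + - (h *: e_ i)) - g x * phi x + h * (g x * partial i phi x)) =
    \int[mu]_x (tau h i g x * phi x) + h * \int[mu]_x (g x * partial i phi x).
  by rewrite I4 (RintegralD measurableT i5 i6) (RintegralB measurableT i2 i0) (RintegralZl _ measurableT i1).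
have ai' := integrable_mulrl (M * h ^+ 2) ai.
have B : `|\int[mu]_x (g x * phi (x + - (h *: e_ i)) - g x * phi x + h * (g x * partial i phi x))| <=
    M * h ^+ 2 * \int[mu]_x `|\1_(inner Omega (r / 2)) x * g x|.
  rewrite -(RintegralZl _ measurableT ai) -lee_fin -(nintegral_Rintegral ai').
  apply: le_abs_Rintegral; [exact: (integrable_EFin_measurable i7)|exact: (integrable_EFin_measurable ai')|].
  move=> x; have := smooth_taylor x (- h) sphi HM.
  rewrite scaleNr sqrrN => hT.
  rewrite (_ : _ - _ + _ = g x * (phi (x - h *: e_ i) - phi x - - h * partial i phi x)); last by ring.
  have [xr|nx] := pselect (inner Omega (r / 2) x).
    by rewrite indicE mem_set // mul1r normrM mulrC ler_wpM2r.
  have nxr : ~ inner Omega r x by move=> /le_r.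
  rewrite phi0' // (phi0 _ nxr) (dphi0 _ nxr) mulr0 !subr0 mulr0 normr0.
  apply: mulr_ge0 => //; apply: mulr_ge0; [exact: ltW|exact: sqr_ge0].
rewrite I7 in B; move: B; rewrite ler_norml => /andP[B _].
move: B; move: (\int[mu]_x _) (\int[mu]_x _) (\int[mu]_x _) => y1 y2 y3 B.
by rewrite -subr_ge0; rewrite -subr_ge0 in B; apply: le_trans B _; rewrite le_eqVlt; apply/orP; left; apply/eqP; ring.
Qed.

Hypothesis gB : forall r : R, 0 < r -> exists C h0 : R, [/\ 0 <= C, 0 < h0 &
  forall h : R, 0 < h < h0 ->
    (pint mu 2 (fun x => \1_(inner Omega r) x * tau h i g x)%R <= (C * h ^+ 2)%:E)%E].

(** If [phi] vanishes off [K M], then [h L phi] is at most the integral of [phi] times the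
    difference of [g], up to [A h^2]. Where [a = c m], Young's inequality bounds the integrand by
    [(tau h i g)^2 / (2 c_m^2 h) + h (a phi)^2 / 2], and the first terms integrate to at most [h] in
    total. Dividing by [h] gives the bound required for the Riesz representation, with [B = 2]. *)
Lemma weak_partial_exists : exists2 G : V -> R,
  forall r : R, 0 < r -> isLp mu 2 (fun x => \1_(inner Omega r) x * G x) &
  forall phi, test_function Omega phi ->
    \int[mu]_x (g x * partial i phi x) = - \int[mu]_x (G x * phi x).
Proof.
have rn n : 0 < n.+1%:R^-1 :> R by rewrite invr_gt0.
have [C HC] : {C : nat -> R & forall n, 0 <= C n /\ exists2 h0 : R, 0 < h0 & forall h : R, 0 < h < h0 ->
    (pint mu 2 (fun x => \1_(inner Omega n.+1%:R^-1) x * tau h i g x)%R <= (C n * h ^+ 2)%:E)%E}.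
  apply: (@choice _ _ (fun n C => 0 <= C /\ exists2 h0 : R, 0 < h0 & forall h : R, 0 < h < h0 ->
    (pint mu 2 (fun x => \1_(inner Omega n.+1%:R^-1) x * tau h i g x)%R <= (C * h ^+ 2)%:E)%E)) => n.
  by have [C [h0 [C0 h00 H]]] := gB (rn n); exists C; split => //; exists h0.
pose K n := inner Omega n.+1%:R^-1.
(* so that [\sum_n C n / c n ^+ 2 <= 2] *)
pose c n : R := 2 ^+ n * (1 + C n).
have c0 n : 0 < c n.
  by rewrite /c mulr_gt0 ?exprn_gt0 //; have := (HC n).1; lra.
have mK n : measurable (K n) by exact: mI.
have [a [ma aK a1]] := weight_exists c mK.
have a0 x : 0 < a x.
  have [[M /aK [m [_ _ ->]]]|nx] := pselect (exists M, K M x); first exact: c0.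
  by rewrite a1 // => M xM; apply: nx; exists M.
have aB M x : K M x -> `|a x| <= \sum_(m < M.+1) c m.
  move=> /aK [m [mM _ ->]]; rewrite gtr0_norm //.
  rewrite (bigD1 (Ordinal (mM : (m < M.+1)%N))) //= lerDl sumr_ge0 // => k _; exact: ltW.
have exM (r : R) : 0 < r -> exists M, inner Omega r `<=` K M.
  move=> r0; exists (Num.truncn r^-1); apply: le_inner; apply: ltW.
  rewrite -[ltRHS]invrK ltf_pV2 ?posrE ?invr_gt0 //.
  exact: truncnS_gt.
have exMphi phi : test_function Omega phi -> exists M, forall x, ~ K M x -> phi x = 0.
  move=> /test_function_inner [r r0 hr]; have [M rM] := exM r r0.
  by exists M => x nx; apply: hr => /rM.
pose L phi := - (\int[mu]_x (g x * partial i phi x)).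
have smallh M : exists2 h0 : R, 0 < h0 & forall m h, (m <= M)%N -> 0 < h < h0 ->
    (pint mu 2 (fun x => \1_(K m) x * tau h i g x)%R <= (C m * h ^+ 2)%:E)%E.
  elim: M => [|M [h1 h10 H1]].
    have [_ [h0 h00 H]] := HC 0%N; exists h0 => // m h; rewrite leqn0 => /eqP -> ; exact: H.
  have [_ [h0 h00 H]] := HC M.+1; exists (Num.min h0 h1); first by rewrite lt_min h00.
  move=> m h mM /andP[hp]; rewrite lt_min => /andP[hh0 hh1].
  move: mM; rewrite leq_eqVlt => /predU1P[->|mM]; first by apply: H; rewrite hp.
  by apply: H1 => //; rewrite hp.
have aL phi : test_function Omega phi -> isLp mu 2 (fun x => a x * phi x).
  move=> tphi; have [sphi _ _] := tphi; have [M hM] := exMphi phi tphi.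
  have [Mb Mb0 hMb] := smooth_bounded sphi (cI (rn M)) hM.
  have S0 : 0 <= \sum_(m < M.+1) c m by apply: sumr_ge0 => k _; exact: ltW.
  apply: (bounded_isLp two0 (mulr_ge0 S0 (ltW Mb0)) _ (mK M) (compact_measure_fin hmu (cI (rn M)))).
  - by apply: measurable_funM => //; exact: smooth_measurable.
  - move=> x; have [xM|/hM ->] := pselect (K M x); last first.
      by rewrite mulr0 normr0 mulr_ge0 // ltW.
    by rewrite normrM ler_pM // aB.
  - by move=> x /hM ->; rewrite mulr0.
have ig phi : test_function Omega phi ->
    mu.-integrable setT (EFin \o (fun x => g x * partial i phi x)).
  move=> tphi; have [sphi _ _] := tphi; have [M hM] := exMphi phi tphi.
  apply: (mul_inner_integrable (rn M) (smooth_continuous (smooth_partial i sphi))).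
  exact: (partial_compl_eq0 i (compact_rV_closed (cI (rn M))) hM).
have [Phi LPhi HPhi] : exists2 Phi, isLp mu 2 Phi & forall phi, test_function Omega phi ->
    \int[mu]_x (a x * phi x * Phi x) = L phi.
  apply: (riesz_weighted (P := test_function Omega) (B := 2) (a := a) (L := L)).
  - exists (cst 0); apply: (test_functionI (K := set0)) => //; first exact: smooth_cst.
    exact: compact0.
  - by move=> f1 f2 t; exact: test_functionD.
  - move=> f1 f2 t t1 t2; have [s1 _ _] := t1; have [s2 _ _] := t2.
    have lin (y y1 y2 : R) : y = y1 + t * y2 -> - y = - y1 + t * - y2 by move=> ->; ring.
    apply: lin; rewrite -(RintegralZl _ measurableT (ig f2 t2)).
    rewrite -(RintegralD measurableT (ig f1 t1) (integrable_mulrl t (ig f2 t2))).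
    apply: eq_Rintegral => x _; rewrite (partialD i s1 (smoothZ t s2)) (partialZ t i s2).
    by ring.
  - exact: aL.
  move=> phi tphi; have [sphi _ _] := tphi; have [M hM] := exMphi phi tphi.
  have [A A0 HA] := partial_le_tau (rn M) sphi hM.
  have [h1 h10 H1] := smallh M.
  (* Three constraints: the estimates for all [m <= M] hold, the shift stays within the margin of
     the support, and [A h <= 1]. The last one costs 1 in [B], the geometric sum the other 1. *)
  pose h : R := Num.min (Num.min (h1 / 2) (M.+1%:R^-1 / 2 / 2)) (1 / (A + 1)).
  have h0 : 0 < h by rewrite !lt_min !divr_gt0 //; lra.
  have hh1 : 0 < h < h1.
    by rewrite h0 /=; apply: (@le_lt_trans _ _ (h1 / 2)); [rewrite !ge_min lexx|lra].
  have hh2 : 0 < h < M.+1%:R^-1 / 2.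
    rewrite h0 /=; apply: (@le_lt_trans _ _ (M.+1%:R^-1 / 2 / 2)); first by rewrite !ge_min lexx orbT.
    by have := rn M; move: (M.+1%:R^-1) => z z0; lra.
  have hA : A * h <= 1.
    have : h <= 1 / (A + 1) by rewrite ge_min lexx orbT.
    by rewrite ler_pdivlMr; [lra|lra].
  have [it le_t] := HA h hh2.
  have mt := measurable_tau h i mg.
  have LK m : (m <= M)%N -> isLp mu 2 (fun x => \1_(K m) x * tau h i g x).
    move=> mM; split; last by apply: le_lt_trans (H1 m h mM hh1) _; exact: ltry.
    by apply: measurable_funM => //; exact: measurable_indic.
  have sq (w : V -> R) : isLp mu 2 w -> mu.-integrable setT (EFin \o (fun x => w x ^+ 2)) /\
      pint mu 2 w = (\int[mu]_x (w x ^+ 2))%:E.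
    move=> Lw; have iw := isLp_mul_integrable two0 two0 two1 Lw Lw.
    split; first exact: iw.
    rewrite pintE -nintegral_Rintegral; last exact: iw.
    by apply: eq_integral => x _; rewrite powR_mulrn // real_normK ?num_real.
  pose X (m : 'I_M.+1) x := (2 * (c m) ^+ 2 * h)^-1 * (\1_(K m) x * tau h i g x) ^+ 2.
  have X0 m x : 0 <= X m x.
    rewrite /X; apply: mulr_ge0 (sqr_ge0 _); rewrite invr_ge0; apply: mulr_ge0 (ltW h0).
    by apply: mulr_ge0 (sqr_ge0 _).
  have iX m : mu.-integrable setT (EFin \o X m).
    exact: (integrable_mulrl _ (sq _ (LK m (ltn_ord m : (m <= M)%N))).1).
  have [iS eS] := Rintegral_sum iX.
  have [iN _] := sq _ (aL phi tphi).
  have iN' := integrable_mulrl (h / 2) iN.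
  have iT := integrable_addr iS iN'.
  (* Only the index [m] with [a x = c m] matters at [x]; the other terms are nonnegative. The
     inequality for that term is a completed square. *)
  have B1 : \int[mu]_x (tau h i g x * phi x) <= \int[mu]_x (\sum_m X m x + h / 2 * (a x * phi x) ^+ 2).
    apply: le_Rintegral => // x _.
    have [xM|nx] := pselect (K M x); last first.
      rewrite hM // !mulr0 expr0n mulr0 addr0; apply: sumr_ge0 => m _.
      exact: X0.
    have [m [mM xm am]] := aK M x xM.
    apply: (@le_trans _ _ (X (Ordinal (mM : (m < M.+1)%N)) x + h / 2 * (a x * phi x) ^+ 2)); last first.
      rewrite lerD2r (bigD1 (Ordinal (mM : (m < M.+1)%N))) //= lerDl.
      apply: sumr_ge0 => k _.
      exact: X0.
    rewrite /X /= indicE mem_set // mul1r am; have := c0 m.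
    move: (c m) (tau h i g x) (phi x) => cm t f cm0.
    rewrite -subr_ge0 (_ : _ - _ = (t / (cm * h) - cm * f) ^+ 2 * (h / 2)); last first.
      by field; rewrite !gt_eqF.
    by rewrite mulr_ge0 ?sqr_ge0 // divr_ge0 // ltW.
  (* As [c m = 2^m (1 + C m)], the ratio [C m / c_m^2] is at most [4^-m], better than the [2^-m]
     asked for. *)
  have BX m : \int[mu]_x X m x <= h / 2 * 2^-1 ^+ m.
    have [i1 e1] := sq _ (LK m (ltn_ord m : (m <= M)%N)).
    rewrite /X (RintegralZl _ measurableT i1).
    have := H1 m h (ltn_ord m : (m <= M)%N) hh1; rewrite e1 lee_fin => b1.
    have cm0 := c0 m; have C0 := (HC m).1.
    have z0 : 0 < 2 * c m ^+ 2 * h by apply: mulr_gt0 h0; apply: mulr_gt0 => //; exact: exprn_gt0.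
    rewrite mulrC ler_pdivrMr //.
    apply: le_trans b1 _.
    rewrite [leRHS](_ : _ = 2^-1 ^+ m * (c m) ^+ 2 * h ^+ 2); last by field.
    apply: ler_wpM2r; first exact: sqr_ge0.
    have -> : 2^-1 ^+ m * c m ^+ 2 = 2 ^+ m * (1 + C m) ^+ 2.
      by rewrite /c exprVn; field; rewrite expf_neq0.
    have e2 : 1 <= 2 ^+ m :> R by apply: exprn_ege1; rewrite ler1n.
    apply: (@le_trans _ _ ((1 + C m) ^+ 2)).
      by rewrite expr2; nra.
    by rewrite ler_peMl ?sqr_ge0.
  have geo : \sum_(m < M.+1) (h / 2 * 2^-1 ^+ m) <= h.
    rewrite -mulr_sumr.
    have : \sum_(m < M.+1) (2^-1 ^+ m : R) <= 2.
      have := subrX1 (2^-1 : R) M.+1.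
      have : 0 <= 2^-1 ^+ M.+1 :> R by exact: exprn_ge0.
      by move: (2^-1 ^+ M.+1) (\sum_(_ < _) _) => z S z0 E; lra.
    by move=> /(ler_wpM2l (ltW h0)); lra.
  have B2 : \int[mu]_x (\sum_m X m x + h / 2 * (a x * phi x) ^+ 2) <=
      h + h / 2 * \int[mu]_x ((a x * phi x) ^+ 2).
    rewrite (RintegralD measurableT iS iN') eS (RintegralZl _ measurableT iN) lerD2r.
    by apply: le_trans (ler_sum _ (fun m _ => BX m)) geo.
  have := le_trans le_t (lerD (le_trans B1 B2) (lexx _)).
  rewrite -/(L phi); move: (L phi) (\int[mu]_x (a x * phi x) ^+ 2) => l n hl.
  rewrite -(ler_pM2r h0); apply: le_trans hl _.
  rewrite -subr_ge0 (_ : _ - _ = h * (1 - A * h)); last by field.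
  by rewrite mulr_ge0 ?subr_ge0 // ltW.
(* The representation pairs [Phi] with [a phi], so the derivative is [a Phi]; it is locally in L^2
   because [a] is bounded on each [K M]. *)
exists (fun x => a x * Phi x).
  move=> r r0; have [M rM] := exM r r0.
  have S0 : 0 <= \sum_(m < M.+1) c m by apply: sumr_ge0 => k _; exact: ltW.
  apply: (isLp_le (ltW two0) S0 _ _ LPhi).
    apply: measurable_funM; first by apply: measurable_indic; exact: mI.
    by apply: measurable_funM => //; case: LPhi.
  move=> x; rewrite indicE; have [xr|nx] := pselect (inner Omega r x); last first.
    by rewrite memNset // mul0r normr0 mulr_ge0.
  rewrite mem_set // mul1r normrM ler_wpM2r //; apply: aB; exact: rM.
move=> phi tphi; rewrite -[LHS]opprK -/(L phi) -(HPhi phi tphi); congr (- _).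
by apply: eq_Rintegral => x _; ring.
Qed.

End weak_partial_of_difference_quotients.

(** * Regularity of the solution *)

Section exhaustion.
Context {R : realType} {d : nat}.
Local Notation V := 'rV[R]_d.
Variable Omega : set V.

Lemma compact_inner (r : R) : bounded_set Omega -> 0 < r -> compact (inner Omega r).
Proof.
move=> [M [_ hM]] r0; apply: (subclosed_compact (closed_inner r0) (@compact_cball _ _ 0 (M + 1))).
move=> x xr; rewrite /cball /= subr0; apply: (hM (M + 1)); first by rewrite ltrDl.
exact: (inner_sub r0 xr).
Qed.

(** A Lebesgue number argument: near each point of [K] one radius works for a whole ball, and
    compactness makes it uniform. *)
Lemma compact_sub_inner (K : set V) : open Omega -> compact K -> K `<=` Omega ->
  exists2 r : R, 0 < r & K `<=` inner Omega r.
Proof.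
move=> oO /compact_near_coveringP cK KO.
have := cK R (0^'+) (fun r x => ball x r `<=` Omega) _.
move=> /(_ _) [].
  move=> x Kx; have /nbhs_ballP [e /= e0 he] : nbhs x Omega by apply: open_nbhs_nbhs; split => //; exact: KO.
  have e20 : 0 < e / 2 by exact: divr_gt0.
  exists (ball x (e / 2), [set r | r < e / 2]) => /=.
    by split; [exact: nbhsx_ballx|exact: nbhs_right_lt].
  move=> [y r] /= [xy re] z yz; apply: he.
  rewrite [e]splitr; apply: ball_triangle xy _; apply: le_ball yz; exact: ltW.
move=> e /= e0 he; exists (e / 2); first exact: divr_gt0.
apply: he => /=; rewrite ?divr_gt0 //.
by rewrite sub0r normrN gtr0_norm ?divr_gt0 // ltr_pdivrMr // ltr_pMr // ltr1n.
Qed.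

End exhaustion.

Section restriction.
Context {R : realType} {d : nat}.
Local Notation V := 'rV[R]_d.
Variable mu : {sigma_finite_measure set V -> \bar R}.
Hypothesis hmu : haar mu.

Lemma restrictE (g : V -> R) (K : set V) x : (g \_ K) x = \1_K x * g x.
Proof. by rewrite /patch indicE; case: (x \in K); rewrite ?mul1r ?mul0r. Qed.

(** Pair with the indicator of [K], which lies in L^q because [K] has finite measure. *)
Lemma isLp_restrict_integrable p q (g : V -> R) (K : set V) : 0 < p -> 0 < q -> p^-1 + q^-1 = 1 ->
  compact K -> isLp mu p (g \_ K) -> mu.-integrable setT (EFin \o (g \_ K)).
Proof.
move=> p0 q0 pq cK gL; have mK := measurable_compact_rV cK.
have L1 : isLp mu q (\1_K : V -> R).
  apply: (bounded_isLp q0 ler01 _ mK (compact_measure_fin hmu cK)).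
  - exact: measurable_indic.
  - by move=> x; rewrite indicE; case: (_ \in _); rewrite ?normr1 ?normr0.
  - by move=> x nx; rewrite indicE memNset.
have := isLp_mul_integrable p0 q0 pq gL L1.
congr (is_true (_ _)); apply/funext => x /=; rewrite /patch indicE.
by case: (_ \in _); rewrite ?mulr1 ?mul0r.
Qed.

End restriction.

Section assembly.
Context {R : realType} {d N : nat}.
Local Notation V := 'rV[R]_d.
Local Notation mu := (@lebesgue_rV R d).
Local Notation e_ i := (delta_mx ord0 i : V).
Variables (Omega : set V) (v : 'I_N -> V) (delta c : 'I_N -> R) (p q : R).
Hypotheses (oO : open Omega) (bO : bounded_set Omega).
Hypotheses (hc : forall k, 0 < c k) (hdelta : forall k, 0 < delta k).
Hypotheses (hp : 2 <= p) (pq : p^-1 + q^-1 = 1).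

Let p0 : 0 < p. Proof. exact: lt_le_trans (ltr0Sn R 1) hp. Qed.
Let q0 : 0 < q.
Proof.
rewrite -invr_gt0 -(addKr p^-1 q^-1) pq addrC subr_gt0 invf_lt1 //.
by apply: lt_le_trans hp; rewrite ltr1n.
Qed.
Let qp : q^-1 + p^-1 = 1. Proof. by rewrite addrC. Qed.
Let hmu := haar_lebesgue_rV R d.
Let cI r (r0 : 0 < r) := compact_inner bO r0.
Let two0 : 0 < 2 :> R. Proof. by []. Qed.

(** The thresholds are nonnegative; this makes extending the gradient by 0 compatible with powers of
    the excess. *)
Lemma excess0 k : excess v delta c k 0 = 0.
Proof.
rewrite /excess /dotv big1 ?sub0r; last by move=> j _; rewrite mxE mul0r.
by apply/max_idPr; rewrite oppr_le0 mulr_ge0 // ltW.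
Qed.

Variables (f u : V -> R) (Du : V -> V).
Hypothesis hf : W1p_loc Omega q f.
Hypothesis hu : local_weak_solution v delta c p Omega f u Du.

Let g k : V -> R := (fun x => excess v delta c k (Du x) `^ (p / 2)) \_ Omega.
Let D (K0 : set V) : V -> V := fun x => if x \in K0 then Du x else 0.

Let D_coor K0 j : (fun x => D K0 x ord0 j) = (fun x => Du x ord0 j) \_ K0.
Proof. by apply/funext => x; rewrite /D /patch; case: (x \in K0); rewrite ?mxE. Qed.

Let Lp_inner r w s : r != 0 -> 0 < s -> Lp_loc Omega r w -> isLp mu r (w \_ (inner Omega s)).
Proof.
move=> r0 s0 h; apply/Lfun_isLp => //; apply: h; first exact: cI.
exact: inner_sub.
Qed.

Lemma excess_powR_restrict K0 k : K0 `<=` Omega ->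
  (fun x => \1_K0 x * g k x) = (fun x => excess v delta c k (D K0 x) `^ (p / 2)).
Proof.
move=> KO; apply/funext => x; rewrite /g /D indicE /patch.
have [xK|nK] := pselect (K0 x); first by rewrite !mem_set ?mul1r //; exact: KO.
by rewrite !(memNset nK) mul0r excess0 powR0 // gt_eqF // divr_gt0.
Qed.

Lemma excess_powR_isLp k r : 0 < r -> isLp mu 2 (fun x => \1_(inner Omega r) x * g k x).
Proof.
move=> r0; have [[_ hD _] _] := hu.
rewrite (excess_powR_restrict k (inner_sub r0)).
have LD j : isLp mu p (fun x => D (inner Omega r) x ord0 j).
  by rewrite D_coor; apply: Lp_inner => //; rewrite gt_eqF.
have p22 : p / 2 * 2 = p by field.
exact: (isLp_powR_ge0 p22 (fun x => excess_ge0 _ _ _ _ _) (excess_isLp v hc hdelta p0 k LD)).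
Qed.

(** [Du] is only controlled on compact subsets of [Omega]. The cuts to the insets of depth [1/(n+1)]
    are measurable and eventually constant in [n] at each point. *)
Lemma measurable_excess_powR k : measurable_fun setT (g k).
Proof.
have rn n : 0 < n.+1%:R^-1 :> R by rewrite invr_gt0.
apply: (@measurable_fun_cvg _ _ _ _ (fun n x => \1_(inner Omega n.+1%:R^-1) x * g k x)).
  by move=> n; case: (excess_powR_isLp k (rn n)).
move=> x _; have [xO|nO] := pselect (Omega x); last first.
  rewrite /g /patch memNset //.
  by under eq_fun do rewrite mulr0; exact: cvg_cst.
have [r r0 hr] := compact_sub_inner oO (@compact_set1 _ x) (fun y (e : [set x] y) => eq_ind_r Omega xO e).
apply: cvg_near_cst; exists (Num.truncn r^-1) => // n /= nr.
rewrite indicE mem_set ?mul1r //; apply: le_inner (hr x erefl); apply: ltW.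
rewrite -[ltRHS]invrK ltf_pV2 ?posrE ?invr_gt0 //.
by apply: lt_le_trans (truncnS_gt _) _; rewrite ler_nat.
Qed.

(** A test function vanishing off the inset, together with its partial derivatives, does not see the
    truncation of [Du] and [f]. *)
Lemma weak_equation_restrict r : 0 < r ->
  weak_equation mu (inner Omega r) (f \_ (inner Omega r))
    (fun j x => F v delta c p (D (inner Omega r) x) ord0 j).
Proof.
move=> r0 phi sphi phi0; have [[_ hD _] heq] := hu.
set K0 := inner Omega r in phi0 *.
have cK : compact K0 by exact: cI.
have KO : K0 `<=` Omega by exact: inner_sub.
have tphi := test_functionI sphi cK KO phi0.
have dphi0 j := partial_compl_eq0 j (compact_rV_closed cK) phi0.
rewrite -(restrict_Rintegral mu f (@subset_refl _ K0) KO phi0) -(heq phi tphi).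
have LD j : isLp mu p (fun x => D K0 x ord0 j).
  by rewrite D_coor; apply: Lp_inner => //; rewrite gt_eqF.
have FL j := F_isLp v hc hdelta p0 q0 pq j LD.
have iF j := isLp_mul_integrable q0 p0 qp (FL j)
  (compact_supp_isLp hmu p0 (smooth_continuous (smooth_partial j sphi)) cK (dphi0 j)).
rewrite -(Rintegral_sum iF).2 [RHS]Rintegral_mkcond; apply: eq_Rintegral => x _.
rewrite restrictE; have [xK|nK] := pselect (K0 x).
  rewrite indicE mem_set ?mul1r; last exact: KO.
  by rewrite /dotv; apply: eq_bigr => j _; rewrite mxE /D mem_set.
rewrite big1; last by move=> j _; rewrite dphi0 ?mulr0.
by rewrite /dotv big1 ?mulr0 // => j _; rewrite mxE dphi0 ?mulr0.
Qed.

Lemma excess_powR_difference_quotient k i r : 0 < r -> exists C h0 : R, [/\ 0 <= C, 0 < h0 &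
  forall h : R, 0 < h < h0 ->
    (pint mu 2 (fun x => \1_(inner Omega r) x * tau h i (g k) x)%R <= (C * h ^+ 2)%:E)%E].
Proof.
(* [r = s + 3 s]: one [s] is spent on truncating to [K0], three on reaching the zone where the
   cutoff is 1. *)
move=> r0; pose s := r / 4; have s0 : 0 < s by exact: divr_gt0.
have [[hu1 hD wgu] _] := hu; have [Df [hf1 hDf wgf]] := hf.
set K0 := inner Omega s.
have cK : compact K0 by exact: cI.
have KO : K0 `<=` Omega by exact: inner_sub.
have pn : p != 0 by rewrite gt_eqF.
have qn : q != 0 by rewrite gt_eqF.
have LD j : isLp mu p (fun x => D K0 x ord0 j) by rewrite D_coor; exact: Lp_inner.
have iD j : mu.-integrable setT (EFin \o (fun x => D K0 x ord0 j)).
  by rewrite D_coor; apply: (isLp_restrict_integrable hmu p0 q0 pq cK); exact: Lp_inner.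
have Lu : isLp mu p (u \_ K0) by exact: Lp_inner.
have Lf : isLp mu q (f \_ K0) by exact: Lp_inner.
have Ldf : isLp mu q ((fun x => Df x ord0 i) \_ K0) by exact: Lp_inner.
have iu := isLp_restrict_integrable hmu p0 q0 pq cK Lu.
have if_ := isLp_restrict_integrable hmu q0 p0 qp cK Lf.
have idf := isLp_restrict_integrable hmu q0 p0 qp cK Ldf.
have wu j : local_weak_partial mu K0 j (u \_ K0) (fun x => D K0 x ord0 j).
  by move=> r1 rho x mrho xK; rewrite D_coor; exact: partial_conv_weak mrho wgu xK KO iu.
have wf : local_weak_partial mu K0 i (f \_ K0) ((fun x => Df x ord0 i) \_ K0).
  by move=> r1 rho x mrho xK; exact: partial_conv_weak mrho wgf xK KO if_.
have [C C0 H] := tau_excess_estimate hmu hc hdelta hp q0 pq cK Lu iu LD iD Lf if_ Ldf idf wu wf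
  (weak_equation_restrict s0) k s0.
exists C, (s / 2); split => //; first exact: divr_gt0.
move=> h hs; have /andP[h0 hs2] := hs.
rewrite -(excess_powR_restrict k KO) in H.
have mt := measurable_tau h i (measurable_excess_powR k).
have mt' : measurable_fun setT (tau h i (fun x => \1_K0 x * g k x)).
  by apply: measurable_tau; case: (excess_powR_isLp k s0).
have s30 : 0 < 3 * s by rewrite mulr_gt0.
have mr : measurable (inner Omega r) by apply: measurable_closed_rV; exact: closed_inner.
have mr3 : measurable (inner K0 (3 * s)) by apply: measurable_closed_rV; exact: closed_inner.
apply: le_trans (le_trans (@le_pint _ _ _ mu 2 _ (fun x => \1_(inner K0 (3 * s)) x * tau h i (fun x0 => \1_K0 x0 * g k x0) x) 1 (ltW two0) ler01 _ _ _) _) (H h hs).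
- by apply: measurable_funM => //; exact: measurable_indic.
- by apply: measurable_funM => //; exact: measurable_indic.
- move=> x; rewrite mul1r [in leLHS]indicE.
  have [xr|nx] := pselect (inner Omega r x); last by rewrite memNset // mul0r normr0.
  have x3 : inner K0 (3 * s) x.
    move=> y xy; apply: (@inner_shift _ _ Omega s (3 * s) x y) xy.
    by rewrite (_ : s + 3 * s = r) // /s; field.
  (* Both [x] and [x + h e_i] lie in [K0], so truncated and untruncated functions have the same
     difference there. *)
  have h1 : K0 x by exact: (inner_sub s30 x3).
  have h2 : K0 (x + h *: e_ i).
    apply: x3; rewrite -ball_normE /= opprD addrA subrr sub0r normrN.
    by apply: le_lt_trans (norm_delta _ _) _; rewrite gtr0_norm //; lra.
  by rewrite indicE /tau !indicE !mem_set // !mul1r.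
- by rewrite powR1 mul1e.
Qed.

(** Arbitrary coefficients cover the components of both [H] and each [H_k], so weak derivatives are
    combined only once. *)
Lemma W1p_loc_sum_excess (l : 'I_N -> R) :
  W1p_loc Omega 2 (fun x => \sum_k l k * excess v delta c k (Du x) `^ (p / 2)).
Proof.
have exI K (cK : compact K) (KO : K `<=` Omega) := compact_sub_inner oO cK KO.
have [G HG] : {G : 'I_N * 'I_d -> V -> R & forall ki,
    (forall r : R, 0 < r -> isLp mu 2 (fun x => \1_(inner Omega r) x * G ki x)) /\
    forall phi, test_function Omega phi ->
    \int[mu]_x (g ki.1 x * partial ki.2 phi x) = - (\int[mu]_x (G ki x * phi x))}.
  apply: (@choice _ _ (fun ki (G : V -> R) =>
    (forall r : R, 0 < r -> isLp mu 2 (fun x => \1_(inner Omega r) x * G x)) /\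
    forall phi, test_function Omega phi ->
    \int[mu]_x (g ki.1 x * partial ki.2 phi x) = - (\int[mu]_x (G x * phi x)))) => -[k i] /=.
  have [G h1 h2] := weak_partial_exists hmu cI exI (measurable_excess_powR k) (@excess_powR_isLp k)
    (@excess_powR_difference_quotient k i).
  by exists G.
have LpI (b : 'I_N -> V -> R) (w : V -> R) :
    (forall k (r : R), 0 < r -> isLp mu 2 (fun x => \1_(inner Omega r) x * b k x)) ->
    (forall x, Omega x -> w x = \sum_k l k * b k x) -> Lp_loc Omega 2 w.
  move=> bL wE K cK KO; have [r r0 Kr] := exI K cK KO; apply/Lfun_isLp => //.
  have -> : w \_ K = (fun x => \1_K x * \sum_k l k * (\1_(inner Omega r) x * b k x)).
    apply/funext => x; rewrite restrictE indicE.
    have [xK|nK] := pselect (K x); last by rewrite memNset // !mul0r.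
    rewrite mem_set // (wE x (KO x xK)); congr (_ * _); apply: eq_bigr => k _.
    by rewrite indicE mem_set ?mul1r //; exact: Kr.
  have LS : isLp mu 2 (fun x => \sum_k l k * (\1_(inner Omega r) x * b k x)).
    by apply: isLp_sum => // k; exact: isLpZ (ltW two0) (bL k r r0).
  apply: (isLp_le (ltW two0) ler01 _ _ LS).
    apply: measurable_funM; last by case: LS.
    by apply: measurable_indic; exact: measurable_compact_rV.
  move=> x; rewrite indicE mul1r normrM; case: (x \in K); first by rewrite normr1 mul1r.
  by rewrite normr0 mul0r.
exists (fun x => \row_i \sum_k l k * G (k, i) x); split.
- apply: (LpI g) => [k r|x xO]; first exact: excess_powR_isLp.
  by apply: eq_bigr => k _; rewrite /g /patch mem_set.
- move=> i; apply: (LpI (fun k => G (k, i))) => [k|x _]; first exact: (HG (k, i)).1.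
  by rewrite mxE.
move=> phi tphi i; have [sphi _ _] := tphi.
have [r r0 phi0] := test_function_inner exI tphi.
have phiO x : ~ Omega x -> phi x = 0.
  by move=> nO; apply: phi0 => /(inner_sub r0).
have dphi0 := partial_compl_eq0 i (compact_rV_closed (cI r0)) phi0.
have i1 k := mul_inner_integrable hmu cI (@excess_powR_isLp k) r0 (smooth_continuous (smooth_partial i sphi)) dphi0.
have i2 k := mul_inner_integrable hmu cI (HG (k, i)).1 r0 (smooth_continuous sphi) phi0.
have [_ e1] := Rintegral_sum (fun k => integrable_mulrl (l k) (i1 k)).
have [_ e2] := Rintegral_sum (fun k => integrable_mulrl (l k) (i2 k)).
transitivity (\sum_k l k * \int[mu]_x (g k x * partial i phi x)).
  rewrite Rintegral_mkcond; transitivity (\int[mu]_x (\sum_k l k * (g k x * partial i phi x))).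
    apply: eq_Rintegral => x _; rewrite restrictE mulr_suml mulr_sumr; apply: eq_bigr => k _.
    rewrite /g restrictE; ring.
  by rewrite e1; apply: eq_bigr => k _; rewrite (RintegralZl _ measurableT (i1 k)).
rewrite Rintegral_mkcond.
have -> : \int[mu]_x ((fun x => (\row_i0 \sum_k l k * G (k, i0) x) ord0 i * phi x) \_ Omega) x =
    \sum_k l k * \int[mu]_x (G (k, i) x * phi x).
  transitivity (\int[mu]_x (\sum_k l k * (G (k, i) x * phi x))).
    apply: eq_Rintegral => x _; rewrite restrictE mxE mulr_suml indicE.
    have [xO|nO] := pselect (Omega x).
      by rewrite mem_set // mul1r; apply: eq_bigr => k _; rewrite mulrA.
    rewrite memNset // mul0r big1 // => k _; rewrite phiO //; ring.
  by rewrite e2; apply: eq_bigr => k _; rewrite (RintegralZl _ measurableT (i2 k)).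
rewrite -sumrN; apply: eq_bigr => k _; rewrite -mulrN.
by congr (_ * _); exact: (HG (k, i)).2 phi tphi.
Qed.

End assembly.

Theorem theorem4p1 (R : realType) (d : nat) (hd : (2 <= d)%N)
  (Omega : set 'rV[R]_d)
  (hOmega : bounded_domain Omega) (hLip : lipschitz_boundary Omega)
  (N : nat) (v : 'I_N -> 'rV[R]_d) (c delta : 'I_N -> R)
  (hv : forall k, dotv (v k) (v k) = 1)
  (hc : forall k, 0 < c k) (hdelta : forall k, 0 < delta k)
  (p q : R) (hp : 2 <= p) (hq : p^-1 + q^-1 = 1)
  (f u : 'rV[R]_d -> R) (Du : 'rV[R]_d -> 'rV[R]_d)
  (hf : W1p_loc Omega q f)
  (hu : local_weak_solution v delta c p Omega f u Du) :
  W1p_loc_vec Omega 2 (fun x => H v delta c p (Du x)) /\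
  (forall k : 'I_N, W1p_loc_vec Omega 2 (fun x => H_k v delta c p k (Du x))).
Proof.
have [_ oO _ bO] := hOmega.
have W := W1p_loc_sum_excess oO bO hc hdelta hp hq hf hu.
split=> [j|k j].
  rewrite (_ : (fun x => _) = (fun x => \sum_k v k ord0 j * excess v delta c k (Du x) `^ (p / 2))); last first.
    by apply/funext => x; rewrite /H summxE; apply: eq_bigr => k _; rewrite mxE mulrC.
  exact: W.
rewrite (_ : (fun x => _) = (fun x => \sum_k' (if k' == k then v k ord0 j else 0) *
    excess v delta c k' (Du x) `^ (p / 2))); last first.
  apply/funext => x; rewrite (bigD1 k) //= eqxx big1 ?addr0; first by rewrite mxE mulrC.
  by move=> k' /negbTE ->; rewrite mul0r.
exact: W.
Qed.
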